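(* On the universal Teichmüller space $T_H(1)$ (with its Hilbert manifold structure), the holomorphic sectional curvatures and the sectional curvatures of the Weil--Petersson metric are bounded below by $-\frac{3}{2\pi}$.
   Context: $\mathbb{D}$ is the open unit disc in $\mathbb{C}$, with hyperbolic metric density $\rho(z)=\frac{4}{(1-|z|^2)^2}$, and $d^2z$ is Lebesgue measure. The universal Teichmüller space is $T(1)=\mathcal{B}^{-1,1}(\mathbb{D})/\sim$, where $\mathcal{B}^{-1,1}(\mathbb{D})$ is the set of bounded (measurable) functions $\mu$ on $\mathbb{D}$ with $\|\mu\|_\infty<1$; $\mu\sim\nu$ iff $w_\mu=w_\nu$ on the unit circle $S^1$, where $w_\mu$ is the quasiconformal self-map of $\hat{\mathbb{C}}$ fixing $-1,-i,1$ with Beltrami coefficient $\mu$ on $\mathbb{D}$, extended by reflection $\mu(z)=\overline{\mu(1/\bar z)}\,z^2/\bar z^2$ to the exterior of $\mathbb{D}$. Let $$A_2(\mathbb{D})=\Big\{q\text{ holomorphic on }\mathbb{D}:\ \iint_{\mathbb{D}}|q|^2\rho^{-1}d^2z<\infty\Big\},\qquad H^{-1,1}(\mathbb{D})=\{\rho^{-1}\bar q: q\in A_2(\mathbb{D})\}.$$ $T_H(1)$ denotes $T(1)$ with the Hilbert manifold structure of Takhtajan--Teo, for which the holomorphic tangent space at every point is identified with $H^{-1,1}(\mathbb{D})$. The Weil--Petersson metric on $T_H(1)$ is given on each tangent space by $$\langle\nu_\alpha,\nu_\beta\rangle_{WP}=\iint_{\mathbb{D}}\nu_\alpha\overline{\nu_\beta}\,\rho\,d^2z,\qquad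 \|\nu\|_{WP}^2=\langle\nu,\nu\rangle_{WP}.$$ Let $\Delta=-\rho^{-1}\partial\bar\partial$ be the (nonnegative) Laplace--Beltrami operator on $\mathbb{D}$, where $\partial=\partial/\partial z$, $\bar\partial=\partial/\partial\bar z$, and $G=\frac12\left(\Delta+\frac12\right)^{-1}$ acting on $L^2(\mathbb{D},\rho\,d^2z)$. The Riemann curvature tensor of the Weil--Petersson metric on $T_H(1)$ is, at every point, $$R_{\alpha\bar\beta\lambda\bar\delta}=-\iint_{\mathbb{D}}G(\nu_\alpha\bar\nu_\beta)\,\nu_\lambda\bar\nu_\delta\,\rho\,d^2z-\iint_{\mathbb{D}}G(\nu_\alpha\bar\nu_\delta)\,\nu_\lambda\bar\nu_\beta\,\rho\,d^2z ,\qquad \nu_\alpha,\nu_\beta,\nu_\lambda,\nu_\delta\in H^{-1,1}(\mathbb{D}).$$ Holomorphic sectional curvature in the direction of $\nu_\alpha$ with $\|\nu_\alpha\|_{WP}=1$: $s_\alpha=R_{\alpha\bar\alpha\alpha\bar\alpha}=-2\iint_{\mathbb{D}}G(|\nu_\alpha|^2)|\nu_\alpha|^2\rho\,d^2z$. Sectional curvature of the real plane spanned by the real tangent vectors corresponding to $\nu_\alpha,\nu_\beta$, where $\|\nu_\alpha\|_{WP}=\|\nu_\beta\|_{WP}=1$ and these vectors are orthogonal (i.e. $\mathrm{Re}\langle\nu_\alpha,\nu_\beta\rangle_{WP}=0$): $$K_{\alpha,\beta}=\tfrac14\left(R_{\alpha\bar\beta\beta\bar\alpha}+R_{\beta\bar\alpha\alpha\bar\beta}-R_{\alpha\bar\beta\alpha\bar\beta}-R_{\beta\bar\alpha\beta\bar\alpha}\right).$$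 The claim means $s_\alpha\ge-\frac{3}{2\pi}$ for all such $\nu_\alpha$ and $K_{\alpha,\beta}\ge-\frac{3}{2\pi}$ for all such pairs. *)

(* Defs.v *)
From HB Require Import structures.
From mathcomp Require Import all_boot all_order all_algebra.
From mathcomp Require Import all_classical all_reals all_analysis.
From mathcomp.real_closed Require Import complex.

Set Implicit Arguments.
Unset Strict Implicit.
Unset Printing Implicit Defensive.

Import Order.TTheory GRing.Theory Num.Theory.
Import numFieldNormedType.Exports.
Import Normc.

Local Open Scope classical_set_scope.
Local Open Scope ring_scope.
Local Open Scope complex_scope.

Section WeilPetersson.
Context {R : realType}.
Local Notation C := R[i].

Implicit Types (f g phi nu q : C -> C) (z : C).

Definition unit_disc : set C := [set z | `|z| < 1].

Definition rho z : R := 4 / (1 - normc z ^+ 2) ^+ 2.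

(* The area measure d^2z is Lebesgue measure on R * R, where (x, y) stands for
   x + iy. *)
Definition of_xy (p : measurableTypeR R * measurableTypeR R) : C :=
  p.1 +i* p.2.

Definition disc_xy := of_xy @^-1` unit_disc.

Definition area_integral (h : C -> R) : \bar R :=
  (\int[lebesgue_measure \x lebesgue_measure]_(p in disc_xy)
     (h (of_xy p))%:E)%E.

Definition area_integralC f : C :=
  fine (area_integral (fun z => complex.Re (f z))) +i*
  fine (area_integral (fun z => complex.Im (f z))).

(** Quadratic differentials and harmonic Beltrami differentials *)

(* A function on the disc is represented by a function on C; its values outside
   the disc are irrelevant. *)
Definition holomorphic_on_disc q :=
  forall z, unit_disc z -> derivable (q : C^o -> C^o) z 1.

Definition A2 q :=
  holomorphic_on_disc q /\
  (area_integral (fun z => normc (q z) ^+ 2 * (rho z)^-1)%R < +oo)%E.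

Definition Hm11 nu :=
  exists2 q, A2 q &
    forall z, unit_disc z -> nu z = ((rho z)^-1)%:C * (q z)^*.

Definition wp_inner nu1 nu2 : C :=
  area_integralC (fun z => nu1 z * (nu2 z)^* * (rho z)%:C).

Definition wp_norm nu : R := Num.sqrt (complex.Re (wp_inner nu nu)).

(** The space L^2(D, rho d^2z) *)

Definition L2_sqnorm f : \bar R :=
  area_integral (fun z => normc (f z) ^+ 2 * rho z).

Definition L2 f :=
  [/\ measurable_fun disc_xy (fun p => complex.Re (f (of_xy p))),
      measurable_fun disc_xy (fun p => complex.Im (f (of_xy p))) &
      (L2_sqnorm f < +oo)%E].

(** The Laplace-Beltrami operator *)

(* derivative of f along the real direction v: v = 1 gives d/dx and
   v = i gives d/dy *)
Definition real_slice f z (v : C) (t : R) : C := f (z + t%:C * v).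

Definition real_derivable f z v :=
  derivable (fun t => complex.Re (real_slice f z v t)) 0 1 /\
  derivable (fun t => complex.Im (real_slice f z v t)) 0 1.

Definition real_partial v f : C -> C := fun z =>
  derive1 (fun t => complex.Re (real_slice f z v t)) 0 +i*
  derive1 (fun t => complex.Im (real_slice f z v t)) 0.

Definition d_z f : C -> C := fun z =>
  2^-1 * (real_partial 1 f z - (0 +i* 1) * real_partial (0 +i* 1) f z).

Definition d_zbar f : C -> C := fun z =>
  2^-1 * (real_partial 1 f z + (0 +i* 1) * real_partial (0 +i* 1) f z).

Definition laplacian f : C -> C := fun z =>
  - ((rho z)^-1)%:C * d_z (d_zbar f) z.

(* C^oo: every iterated partial derivative (a word w of directions, true for x
   and false for y) exists and is continuous *)
Definition iter_partial (w : seq bool) f : C -> C :=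
  foldr (fun b h => real_partial (if b then 1 else 0 +i* 1) h) f w.

Definition smooth f := forall w : seq bool,
  continuous (iter_partial w f : C^o -> C^o) /\
  forall z, real_derivable (iter_partial w f) z 1 /\
            real_derivable (iter_partial w f) z (0 +i* 1).

(* C^oo functions with compact support in the open disc: the support lies in
   a disc of radius r < 1 *)
Definition test_function phi :=
  smooth phi /\
  exists2 r : R, r < 1 & forall z, r%:C <= `|z| -> phi z = 0.

(* [Laplace_Beltrami f g]: f is in the domain of Delta and Delta f = g. Delta
   is the self-adjoint operator on L^2(D, rho d^2z) determined by the
   differential operator above, i.e. its closure from test functions (which
   are an operator core because the hyperbolic metric is complete). *)
Definition Laplace_Beltrami f g :=
  [/\ L2 f, L2 g &
      forall e : R, 0 < e -> exists phi, [/\ test_function phi,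
        (L2_sqnorm (fun z => phi z - f z)%R < e%:E)%E &
        (L2_sqnorm (fun z => laplacian phi z - g z)%R < e%:E)%E]].

(* [resolvent f] is (Delta + 1/2)^-1 f, i.e. the solution u of
   Delta u = f - u / 2, which is unique up to a null set. As -1/2 is in the
   resolvent set of the nonnegative self-adjoint operator Delta, u exists for
   every f in L^2, and the default value 0 matters only for f outside L^2. *)
Definition resolvent f : C -> C :=
  xget (fun=> 0) [set u | Laplace_Beltrami u (fun z => f z - 2^-1 * u z)].

Definition G f : C -> C := fun z => 2^-1 * resolvent f z.

(** Curvatures *)

(* The holomorphic tangent space at every point of T_H(1) is identified with
   H^{-1,1}(D), and the Weil-Petersson curvature tensor has the same expression
   at every point; [curvature a b l d] is its component R_{a bbar l dbar}. *)

Definition curvature (nua nub nul nud : C -> C) : C :=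
  - area_integralC (fun z =>
      G (fun w => nua w * (nub w)^*) z * (nul z * (nud z)^*) * (rho z)%:C)
  - area_integralC (fun z =>
      G (fun w => nua w * (nud w)^*) z * (nul z * (nub z)^*) * (rho z)%:C).

Definition hol_sectional_curvature nu : C := curvature nu nu nu nu.

Definition sectional_curvature (nua nub : C -> C) : C :=
  4^-1 * (curvature nua nub nub nua + curvature nub nua nua nub
          - curvature nua nub nua nub - curvature nub nua nub nua).

End WeilPetersson.

(* Main.v *)
(* Writing q = rho nu^*, the reproducing property of the weighted Bergman kernel
   K_w(z) = (3 / pi) (1 - z w^* )^-4 gives |nu|^2 <= M = 3 / (4 pi) on the disc
   for every unit vector nu.  It is proved by Goursat's bisection applied to
   (q - q w) / (z - w) ((1 - |z|^2) / (1 - w z^* ))^3, whose dbar derivative is a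
   multiple of (q - q w) (1 - |z|^2)^2 / (1 - w z^* )^4.

   The operator G is positive and, by the maximum principle for Delta + 1/2,
   f <= M implies G f <= M; both follow by testing the equation of an
   approximating test function phi against phi, resp. (phi - 2 M)_+.
   For f = nu_a nu_b^* = u + i v this gives s >= - 2 M and
   K = <Gu, u> / 2 - 3 <Gv, v> / 2 - (<G|nu_a|^2, |nu_b|^2> + <G|nu_b|^2, |nu_a|^2>) / 4
     >= - 2 M,
   as the L^1 norms of |nu_a|^2 and v are at most 1.  Where the equation for G f
   has no solution, the default value of the resolvent is 0 and the same
   estimates hold, so that existence is not needed. *)

(* [holomorphic_on_disc] gives complex derivatives without continuity, and the truncated kernel is
   not holomorphic, so the mean value identity comes from a Goursat argument for dbar that uses
   pointwise differentiability of the function. Subtracting [q w] makes the quotient by [z - w]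
   continuous at [w], and [w] becomes an exceptional point of the bisection. The subtracted term
   involves the mean of the kernel, which the same identity computes. As [q] may be unbounded near
   the circle, all this happens on discs of radius r < 1, with weights truncated to 0 outside, and r
   tends to 1 at the end.

   The order of [R[i]] adds a task: the imaginary part of each curvature has to vanish. It does
   because G commutes with conjugation, but [resolvent] is a choice made separately for each
   function. Hence uniqueness of the solution, in the weak form that its pairings with L^2 functions
   are determined, and the fact that the equations for f and for its conjugate are solvable
   together.

   The maximum principle is also used weakly: a function of zero [nrm] is paired with others, and no
   almost-everywhere statement is extracted. *)
Require Import Defs.
From HB Require Import structures.
From mathcomp Require Import all_boot all_order all_algebra.
From mathcomp Require Import all_classical all_reals all_analysis.
From mathcomp Require Import measurable_realfun.
From mathcomp.real_closed Require Import complex.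
From mathcomp Require Import ring lra.

Set Implicit Arguments.
Unset Strict Implicit.
Unset Printing Implicit Defensive.

Import Order.TTheory GRing.Theory Num.Theory.
Import numFieldNormedType.Exports.
Import Normc.

Local Open Scope classical_set_scope.
Local Open Scope ring_scope.
Local Open Scope complex_scope.

(** * Wirtinger derivatives *)

Section ComplexCalculus.
Context {R : realType}.
Local Notation C := R[i].
Implicit Types (F G : C -> C) (z w h A B : C).

Lemma normc_ge0 z : 0 <= normc z.
Proof. by case: z => a b; rewrite sqrtr_ge0. Qed.

Lemma normc_gt0 z : z != 0 -> 0 < normc z.
Proof.
move=> z0; rewrite lt_neqAle normc_ge0 andbT eq_sym.
by apply: contra z0 => /eqP /eq0_normc ->.
Qed.

(* In the arguments of ring operations the notation [z^*] stands for [Num.conj]. *)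
Lemma conjcE z : (z^*)%R = (z^*)%C. Proof. by []. Qed.

Lemma normc_normE z : `|z| = (normc z)%:C. Proof. by case: z. Qed.

Lemma normc_sqE z : normc z ^+ 2 = complex.Re z ^+ 2 + complex.Im z ^+ 2.
Proof. by case: z => a b; rewrite sqr_sqrtr// addr_ge0 ?sqr_ge0. Qed.

Lemma normc_real (x : R) : normc x%:C = `|x|.
Proof. by rewrite /= expr0n /= addr0 sqrtr_sqr. Qed.

Lemma normc_conj z : normc z^* = normc z.
Proof. by case: z => a b /=; rewrite sqrrN. Qed.

Lemma normc_exp z n : normc (z ^+ n) = normc z ^+ n.
Proof.
elim: n => [|n ih]; first by rewrite !expr0 normc1.
by rewrite !exprS normcM ih.
Qed.

Lemma mulcJ z : z * z^* = (normc z ^+ 2)%:C.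
Proof. by case: z => a b; rewrite normc_sqE /=; simpc; congr (_ +i* _); ring. Qed.

Lemma Re_normc z : `|complex.Re z| <= normc z.
Proof.
rewrite -(@ler_sqr _ `|_|) ?nnegrE ?normc_ge0//.
by rewrite normc_sqE real_normK ?num_real// lerDl sqr_ge0.
Qed.

Lemma Im_normc z : `|complex.Im z| <= normc z.
Proof.
rewrite -(@ler_sqr _ `|_|) ?nnegrE ?normc_ge0//.
by rewrite normc_sqE real_normK ?num_real// lerDr sqr_ge0.
Qed.

Lemma normc_ReIm z : normc z <= `|complex.Re z| + `|complex.Im z|.
Proof.
rewrite -(@ler_sqr _ (normc z)) ?nnegrE ?addr_ge0 ?normc_ge0//.
rewrite normc_sqE -(@real_normK _ (complex.Re z)) ?num_real//.
rewrite -(@real_normK _ (complex.Im z)) ?num_real//.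
have := normr_ge0 (complex.Re z); have := normr_ge0 (complex.Im z).
by move: `|_| `|_| => a b; nra.
Qed.

Lemma normcD z w : normc (z + w) <= normc z + normc w.
Proof. exact: le_normcD. Qed.

Lemma normcB_sym z w : normc (z - w) = normc (w - z).
Proof. by rewrite -normcN opprB. Qed.

Lemma normcBD z w : normc z - normc w <= normc (z - w).
Proof. by rewrite lerBlDr -{1}(subrK w z) normcD. Qed.

(** Continuity and differentiability are stated with the real modulus [normc], so that every epsilon
    lives in [R]; the norm of [R[i]] itself takes complex values. *)
Definition cont_at F z := forall e : R, 0 < e ->
  exists2 d : R, 0 < d & forall h, normc h < d -> normc (F (z + h) - F z) < e.

(* [wirtinger F z A B]: F is real-differentiable at z with dF = A dz + B dzbar. *)
Definition wirtinger F z A B := forall e : R, 0 < e ->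
  exists2 d : R, 0 < d & forall h, normc h < d ->
    normc (F (z + h) - F z - (A * h + B * h^*)) <= e * normc h.

Lemma wirtinger_lip F z A B : wirtinger F z A B ->
  exists K d : R, [/\ 0 < K, 0 < d & forall h, normc h < d ->
    normc (F (z + h) - F z) <= K * normc h].
Proof.
move=> /(_ 1 ltr01)[d d0 H]; exists (1 + (normc A + normc B)), d; split=> //.
  by rewrite ltr_wpDr// addr_ge0 ?normc_ge0.
move=> h /H hd.
rewrite -(subrK (A * h + B * h^*) (F _ - _)).
apply: (le_trans (normcD _ _)); rewrite mulrDl; apply: lerD => //.
apply: (le_trans (normcD _ _)).
by rewrite !normcM normc_conj mulrDl.
Qed.

Lemma lip_cont_at F z (K d : R) : 0 < K -> 0 < d ->
  (forall h, normc h < d -> normc (F (z + h) - F z) <= K * normc h) ->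
  cont_at F z.
Proof.
move=> K0 d0 H e e0; exists (Num.min d (e / K)).
  by rewrite lt_min d0 divr_gt0.
move=> h; rewrite lt_min => /andP[/H h1]; rewrite ltr_pdivlMr// mulrC.
exact: le_lt_trans.
Qed.

Lemma wirtinger_cont F z A B : wirtinger F z A B -> cont_at F z.
Proof. by move=> /wirtinger_lip[K [d [K0 d0 H]]]; exact: lip_cont_at H. Qed.

Lemma wirtinger_ext F G z A B (d : R) : 0 < d ->
  (forall h, normc h < d -> F (z + h) = G (z + h)) ->
  wirtinger F z A B -> wirtinger G z A B.
Proof.
move=> d0 FG H e e0; have [d' d'0 {}H] := H _ e0.
exists (Num.min d d'); first by rewrite lt_min d0.
move=> h; rewrite lt_min => /andP[h1 h2]; rewrite -FG//.
by have := FG 0; rewrite addr0 normc0 => <- //; exact: H.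
Qed.

Lemma cont_at_ext F G z (d : R) : 0 < d ->
  (forall h, normc h < d -> F (z + h) = G (z + h)) ->
  cont_at F z -> cont_at G z.
Proof.
move=> d0 FG H e e0; have [d' d'0 {}H] := H _ e0.
exists (Num.min d d'); first by rewrite lt_min d0.
move=> h; rewrite lt_min => /andP[h1 h2]; rewrite -FG//.
by have := FG 0; rewrite addr0 normc0 => <- //; exact: H.
Qed.

Lemma wirtinger_cst (a : C) z : wirtinger (fun=> a) z 0 0.
Proof.
move=> e e0; exists 1 => // h _.
have -> : a - a - (0 * h + 0 * h^*) = 0 by ring.
by rewrite normc0 mulr_ge0 ?normc_ge0// ltW.
Qed.

Lemma wirtinger_id z : wirtinger id z 1 0.
Proof.
move=> e e0; exists 1 => // h _.
have -> : z + h - z - (1 * h + 0 * h^*) = 0 by ring.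
by rewrite normc0 mulr_ge0 ?normc_ge0// ltW.
Qed.

Lemma wirtinger_conj z : wirtinger (@conjc R) z 0 1.
Proof.
move=> e e0; exists 1 => // h _.
have -> : (z + h)^* - z^* - (0 * h + 1 * h^*) = 0 by rewrite rmorphD /=; ring.
by rewrite normc0 mulr_ge0 ?normc_ge0// ltW.
Qed.

Lemma wirtingerD F G z A B A' B' : wirtinger F z A B -> wirtinger G z A' B' ->
  wirtinger (fun z => F z + G z) z (A + A') (B + B').
Proof.
move=> HF HG e e0; have e20 : 0 < e / 2 by rewrite divr_gt0.
have [d d0 {}HF] := HF _ e20; have [d' d'0 {}HG] := HG _ e20.
exists (Num.min d d'); first by rewrite lt_min d0.
move=> h; rewrite lt_min => /andP[/HF h1 /HG h2].
have -> : F (z + h) + G (z + h) - (F z + G z) -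
    ((A + A') * h + (B + B') * h^*) =
  F (z + h) - F z - (A * h + B * h^*) + (G (z + h) - G z - (A' * h + B' * h^*)).
  by ring.
by apply: (le_trans (normcD _ _)); rewrite [e]splitr mulrDl lerD.
Qed.

Lemma wirtingerM F G z A B A' B' : wirtinger F z A B -> wirtinger G z A' B' ->
  wirtinger (fun z => F z * G z) z (A * G z + F z * A') (B * G z + F z * B').
Proof.
move=> HF HG.
have [K [d1 [K0 d10 LF]]] := wirtinger_lip HF.
have CG := wirtinger_cont HG.
move=> e e0; have e30 : 0 < e / 3 by rewrite divr_gt0.
pose g := normc (G z) + 1; pose f := normc (F z) + 1.
have g0 : 0 < g by rewrite ltr_wpDl ?normc_ge0.
have f0 : 0 < f by rewrite ltr_wpDl ?normc_ge0.
have [d2 d20 {}HF] := HF _ (divr_gt0 e30 g0).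
have [d3 d30 {}HG] := HG _ (divr_gt0 e30 f0).
have [d4 d40 {}CG] := CG _ (divr_gt0 e30 K0).
exists (Num.min (Num.min d1 d2) (Num.min d3 d4)).
  by rewrite !lt_min d10 d20 d30.
move=> h; rewrite !lt_min => /andP[/andP[/LF h1 /HF h2] /andP[/HG h3 /CG h4]].
(* The middle term is a product of two increments: that of F is at most linear in h, that of G is
   small by continuity. *)
have -> : F (z + h) * G (z + h) - F z * G z -
    ((A * G z + F z * A') * h + (B * G z + F z * B') * h^*) =
  (F (z + h) - F z - (A * h + B * h^*)) * G z +
  (F (z + h) - F z) * (G (z + h) - G z) +
  F z * (G (z + h) - G z - (A' * h + B' * h^*)) by ring.
apply: (le_trans (normcD _ _)); apply: (le_trans (lerD (normcD _ _) (lexx _))).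
rewrite !normcM.
have -> : e = e / 3 + e / 3 + e / 3 by field.
rewrite !mulrDl; apply: lerD; [apply: lerD|].
- apply: (@le_trans _ _ (e / 3 / g * normc h * g)).
    by apply: ler_pM; rewrite ?normc_ge0// /g lerDl.
  by rewrite mulrAC divfK ?gt_eqF.
- apply: (@le_trans _ _ (K * normc h * (e / 3 / K))).
    by apply: ler_pM; rewrite ?normc_ge0// ltW.
  by rewrite mulrC mulrA divfK ?gt_eqF.
- apply: (@le_trans _ _ (f * (e / 3 / f * normc h))).
    by apply: ler_pM; rewrite ?normc_ge0// /f lerDl.
  by rewrite mulrA [f * _]mulrC divfK ?gt_eqF.
Qed.

Lemma wirtingerZ (a : C) F z A B : wirtinger F z A B ->
  wirtinger (fun z => a * F z) z (a * A) (a * B).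
Proof.
move=> /(wirtingerM (wirtinger_cst a z)); rewrite !mul0r !add0r; exact.
Qed.

Lemma wirtingerB F G z A B A' B' : wirtinger F z A B -> wirtinger G z A' B' ->
  wirtinger (fun z => F z - G z) z (A - A') (B - B').
Proof.
move=> HF /(wirtingerZ (-1)) HG; have := wirtingerD HF HG.
rewrite !mulN1r; apply: (@wirtinger_ext _ _ _ _ _ 1) => // h _.
by rewrite mulN1r.
Qed.

Lemma wirtingerV F z A B : F z != 0 -> wirtinger F z A B ->
  wirtinger (fun z => (F z)^-1) z (- A / F z ^+ 2) (- B / F z ^+ 2).
Proof.
move=> Fz0 HF.
have [K [d1 [K0 d10 LF]]] := wirtinger_lip HF.
have CF := wirtinger_cont HF.
move=> e e0; have e20 : 0 < e / 2 by rewrite divr_gt0.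
pose f := normc (F z); have f0 : 0 < f by exact: normc_gt0.
have f20 : 0 < f / 2 by rewrite divr_gt0.
have [d2 d20 {}HF] := HF _ (mulr_gt0 e20 (exprn_gt0 2 f0)).
have [d3 d30 {}CF] := CF _ f20.
(* Below [d4] the quadratic remainder (K |h|)^2 / (f^2 (f / 2)) is at most (e / 2) |h|. *)
pose d4 := (e / 2) * (f ^+ 3 / 2) / K ^+ 2.
have d40 : 0 < d4 by rewrite divr_gt0 ?exprn_gt0// mulr_gt0// divr_gt0 ?exprn_gt0.
exists (Num.min (Num.min d1 d2) (Num.min d3 d4)).
  by rewrite !lt_min d10 d20 d30.
move=> h; rewrite !lt_min => /andP[/andP[/LF h1 /HF h2] /andP[/CF h3 h4]].
have Ff : f / 2 <= normc (F (z + h)).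
  have := normcBD (F z) (F z - F (z + h)); rewrite subKr normcB_sym -/f.
  by move: h3; move: (normc _) (normc _) => x y; lra.
have Fzh0 : F (z + h) != 0.
  by apply/eqP => E; move: Ff; rewrite E normc0; lra.
have -> : (F (z + h))^-1 - (F z)^-1 - (- A / F z ^+ 2 * h + - B / F z ^+ 2 * h^*)
  = - (F (z + h) - F z - (A * h + B * h^*)) / F z ^+ 2 +
    (F (z + h) - F z) ^+ 2 / (F z ^+ 2 * F (z + h)).
  by field; rewrite Fz0 Fzh0.
apply: (le_trans (normcD _ _)); rewrite [e]splitr mulrDl.
have n1 X : normc (- X / F z ^+ 2) = normc X / f ^+ 2.
  by rewrite normcM normcV normcN normc_exp.
have n2 X Y : normc (X ^+ 2 / (F z ^+ 2 * Y)) = normc X ^+ 2 / (f ^+ 2 * normc Y).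
  by rewrite normcM normcV normc_exp normcM normc_exp.
rewrite n1 n2; apply: lerD.
  rewrite ler_pdivrMr ?exprn_gt0//; apply: (le_trans h2).
  by rewrite mulrAC.
rewrite ler_pdivrMr; last by rewrite mulr_gt0 ?exprn_gt0// (lt_le_trans f20).
apply: (@le_trans _ _ ((K * normc h) ^+ 2)).
  by rewrite ler_sqr ?nnegrE ?normc_ge0// mulr_ge0 ?normc_ge0// ltW.
apply: (@le_trans _ _ (e / 2 * normc h * (f ^+ 2 * (f / 2)))); last first.
  by rewrite ler_wpM2l ?ler_wpM2l ?exprn_ge0 ?mulr_ge0 ?normc_ge0// ltW.
move: h4; rewrite /d4 ltr_pdivlMr ?exprn_gt0// => h4.
have -> : (K * normc h) ^+ 2 = normc h * K ^+ 2 * normc h by ring.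
have -> : e / 2 * normc h * (f ^+ 2 * (f / 2)) = e / 2 * (f ^+ 3 / 2) * normc h.
  by field.
by rewrite ler_wpM2r ?normc_ge0// ltW.
Qed.

Lemma wirtinger_eq F z A B A' B' : wirtinger F z A B -> A = A' -> B = B' ->
  wirtinger F z A' B'.
Proof. by move=> H <- <-. Qed.

Lemma wirtingerX F z A B n : wirtinger F z A B ->
  wirtinger (fun z => F z ^+ n) z (n%:R * F z ^+ n.-1 * A) (n%:R * F z ^+ n.-1 * B).
Proof.
move=> H; elim: n => [|n ih].
  rewrite !mul0r; apply: (@wirtinger_ext _ _ _ _ _ 1) (wirtinger_cst 1 z) => //.
have := wirtingerM H ih => /(@wirtinger_ext _ (fun z => F z ^+ n.+1) _ _ _ 1 ltr01).
move=> H'; apply: wirtinger_eq (H' _) _ _; first by move=> h _; rewrite exprS.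
- case: n {ih H'} => [|n] /=; first by rewrite expr0; ring.
  by rewrite exprS -[in RHS]natr1; ring.
- case: n {ih H'} => [|n] /=; first by rewrite expr0; ring.
  by rewrite exprS -[in RHS]natr1; ring.
Qed.

Lemma holomorphic_wirtinger F z : holomorphic_on_disc F -> normc z < 1 ->
  exists A, wirtinger F z A 0.
Proof.
move=> hF z1; have /hF : unit_disc z by rewrite /unit_disc /= normc_normE ltcR.
move=> /cvg_ex [l] /cvgrPdist_lt H; exists l => e e0.
have /H : (0 : C) < e%:C by rewrite ltcR.
move=> /nbhs_ballP [d d0 {}H].
(* A positive element of [R[i]] is real, so the radius of the ball comes from [R]. *)
have dE : d = (complex.Re d)%:C.
  by move: d0; rewrite /= ltcE /= => /andP[/eqP + _]; case: (d) => a b /= ->.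
have d'0 : 0 < complex.Re d by rewrite -ltcR -dE.
exists (complex.Re d) => // h hd.
have [->|h0] := eqVneq h 0.
  by rewrite addr0 subrr mulr0 mul0r addr0 subrr normc0 mulr0.
have := H h; rewrite /ball /= sub0r normrN normc_normE [in (_ < d)%R]dE ltcR.
move=> /(_ hd h0).
rewrite /= normc_normE ltcR => Hh.
have {}Hh : normc (l - h^-1 * (F (h + z) - F z)) < e.
  by move: Hh; rewrite -[h%:A]/(h * 1) mulr1.
have -> : F (z + h) - F z - (l * h + 0 * h^*) =
   - ((l - h^-1 * (F (h + z) - F z)) * h).
  rewrite [h + z]addrC; by field.
by rewrite normcN normcM ler_wpM2r ?normc_ge0// ltW.
Qed.

Lemma cont_atM F G z : cont_at F z -> cont_at G z ->
  cont_at (fun z => F z * G z) z.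
Proof.
move=> CF CG e e0.
pose g := normc (G z) + 1; pose f := normc (F z) + 1.
have g0 : 0 < g by rewrite ltr_wpDl ?normc_ge0.
have f0 : 0 < f by rewrite ltr_wpDl ?normc_ge0.
have e20 : 0 < e / 2 by rewrite divr_gt0.
have [d1 d10 {}CG1] := CG _ ltr01.
have [d2 d20 {}CF] := CF _ (divr_gt0 e20 g0).
have [d3 d30 {}CG] := CG _ (divr_gt0 e20 f0).
exists (Num.min d1 (Num.min d2 d3)); first by rewrite !lt_min d10 d20.
move=> h; rewrite !lt_min => /andP[/CG1 h1 /andP[/CF h2 /CG h3]].
have -> : F (z + h) * G (z + h) - F z * G z =
  (F (z + h) - F z) * G (z + h) + F z * (G (z + h) - G z) by ring.
apply: (le_lt_trans (normcD _ _)); rewrite [e]splitr !normcM.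
have Gg : normc (G (z + h)) <= g.
  rewrite -(subrK (G z) (G _)) (le_trans (normcD _ _))// /g addrC lerD2l.
  exact: ltW.
apply: ler_ltD.
  rewrite -[e / 2](@divfK _ g) ?gt_eqF//.
  by apply: ler_pM; rewrite ?normc_ge0// ltW.
rewrite -[e / 2](@divfK _ f) ?gt_eqF// mulrC.
apply: (@le_lt_trans _ _ (normc (G (z + h) - G z) * f)).
  by rewrite ler_wpM2l ?normc_ge0// lerDl.
by rewrite ltr_pM2r.
Qed.

Lemma cont_at_cst (a : C) z : cont_at (fun=> a) z.
Proof. exact: wirtinger_cont (wirtinger_cst _ _). Qed.

(** Chain rule with a real outer function. Its differentiability enters as a quadratic Taylor bound
    at the single value [F z], the form in which powers of a positive part satisfy it across 0. *)
Lemma wirtinger_comp_real (th : R -> R) (th' K d : R) F z A B :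
  (forall z, F z = (complex.Re (F z))%:C) ->
  0 < K -> 0 < d ->
  (forall k, `|k| < d -> `|th (complex.Re (F z) + k) - th (complex.Re (F z)) - th' * k|
      <= K * k ^+ 2) ->
  wirtinger F z A B ->
  wirtinger (fun z => (th (complex.Re (F z)))%:C) z (th'%:C * A) (th'%:C * B).
Proof.
move=> Fr K0 d0 Hth HF.
have [L [d1 [L0 d10 LF]]] := wirtinger_lip HF.
have CF := wirtinger_cont HF.
move=> e e0; have e20 : 0 < e / 2 by rewrite divr_gt0.
pose t := `|th'| + 1; have t0 : 0 < t by rewrite ltr_wpDl.
have [d2 d20 {}HF] := HF _ (divr_gt0 e20 t0).
have [d3 d30 {}CF] := CF _ d0.
pose d4 := e / 2 / (K * L ^+ 2).
have KL0 : 0 < K * L ^+ 2 by rewrite mulr_gt0 ?exprn_gt0.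
exists (Num.min (Num.min d1 d2) (Num.min d3 d4)).
  by rewrite !lt_min d10 d20 d30 divr_gt0.
move=> h; rewrite !lt_min => /andP[/andP[/LF h1 /HF h2] /andP[/CF h3 h4]].
have [k kE'] : exists k, k = complex.Re (F (z + h)) - complex.Re (F z) by eexists.
have kE : F (z + h) - F z = k%:C by rewrite (Fr (z + h)) (Fr z) -rmorphB kE'.
have hk : `|k| < d by rewrite -normc_real -kE.
have -> : (th (complex.Re (F (z + h))))%:C - (th (complex.Re (F z)))%:C -
    (th'%:C * A * h + th'%:C * B * h^*) =
  (th (complex.Re (F z) + k) - th (complex.Re (F z)) - th' * k)%:C +
  th'%:C * (F (z + h) - F z - (A * h + B * h^*)).
  rewrite kE kE' [complex.Re (F z) + _]addrC subrK -kE' !rmorphB rmorphM.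
  by ring.
apply: (le_trans (normcD _ _)); rewrite [e]splitr mulrDl normcM !normc_real.
apply: lerD.
  apply: (le_trans (Hth _ hk)).
  have : `|k| <= L * normc h by rewrite -normc_real -kE.
  move=> hk'; apply: (@le_trans _ _ (K * (L * normc h) ^+ 2)).
    rewrite ler_pM2l// -(@real_normK _ k) ?num_real// ler_sqr ?nnegrE//.
    exact: le_trans hk'.
  have -> : K * (L * normc h) ^+ 2 = normc h * (K * L ^+ 2) * normc h by ring.
  rewrite ler_wpM2r ?normc_ge0// ltW//.
  by move: h4; rewrite /d4 ltr_pdivlMr.
apply: (@le_trans _ _ (t * (e / 2 / t * normc h))).
  by apply: ler_pM; rewrite ?normc_ge0// lerDl.
by rewrite mulrA [t * _]mulrC divfK ?gt_eqF.
Qed.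

End ComplexCalculus.

(** * Lebesgue measure in the plane *)

Section PlaneMeasure.
Context {R : realType}.
Local Notation C := R[i].
Implicit Types (f g : C -> R) (z w h : C).

Local Notation plane := (measurableTypeR R * measurableTypeR R)%type.

Definition area := (@lebesgue_measure R \x @lebesgue_measure R)%E.

Definition rcont f := forall z (e : R), 0 < e ->
  exists2 d : R, 0 < d & forall h, normc h < d -> `|f (z + h) - f z| < e.

(** The continuity hypothesis also says that [D] is open, so each superlevel set is open and is the
    countable union of the rational squares that it contains. *)
Lemma cont_on_measurable (D : set C) f : measurable (of_xy @^-1` D : set plane) ->
  (forall z (e : R), D z -> 0 < e -> exists2 d : R, 0 < d &
     forall h, normc h < d -> D (z + h) /\ `|f (z + h) - f z| < e) ->
  measurable_fun (of_xy @^-1` D) (f \o of_xy : plane -> R).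
Proof.
move=> mD cf; apply: (measurability _ (RGenOInfty.measurableE R)).
move=> /= _ [_ [a ->]] <-; rewrite preimage_itvoy.
pose box (r s t : rat) : set plane :=
  `]ratr r - ratr t, ratr r + ratr t[%classic `*`
  `]ratr s - ratr t, ratr s + ratr t[%classic.
pose U := [set p : plane | D (of_xy p) /\ a < f (of_xy p)].
have -> : of_xy @^-1` D `&` [set x | a < (f \o of_xy) x] =
  \bigcup_r \bigcup_s \bigcup_(t in [set t | box r s t `<=` U]) box r s t.
  apply/seteqP; split => [[x y] /= [Dp Up]|p [r _ [s _ [t sub pb]]]]; last exact: sub.
  have fa : 0 < f (x +i* y) - a by rewrite subr_gt0.
  have [d d0 H] := cf (x +i* y) _ Dp fa.
  have d40 : 0 < d / 4 by rewrite divr_gt0.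
  (* A square of half-side [t < d / 4] whose centre is within [t] of the point stays within [d / 2]
     of it in each coordinate. *)
  have [t] := @rat_in_itvoo R (d / 8) (d / 4) ltac:(lra).
  rewrite in_itv /= => /andP[t1 t2].
  have t0 : 0 < (ratr t : R) by lra.
  have [r] := @rat_in_itvoo R (x - ratr t) (x + ratr t) ltac:(lra).
  rewrite in_itv /= => /andP[r1 r2].
  have [s] := @rat_in_itvoo R (y - ratr t) (y + ratr t) ltac:(lra).
  rewrite in_itv /= => /andP[s1 s2].
  exists r => //; exists s => //; exists t => /=; last first.
    by split; rewrite /= in_itv /=; apply/andP; split; lra.
  move=> [x' y'] [] /=; rewrite !in_itv /= => /andP[x1 x2] /andP[y1 y2].
  rewrite /U /of_xy /=.
  have /H : normc ((x' - x) +i* (y' - y)) < d.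
    apply: (le_lt_trans (normc_ReIm _)) => /=.
    have : `|x' - x| < d / 2 by rewrite ltr_distl; apply/andP; split; lra.
    have : `|y' - y| < d / 2 by rewrite ltr_distl; apply/andP; split; lra.
    by move: (`|_|) (`|_|) => u v; lra.
  simpc; rewrite [x + _]addrC subrK [y + _]addrC subrK.
  by rewrite ltr_distl => -[? /andP[+ _]]; split=> //; lra.
apply: bigcupT_measurable_rat => r; apply: bigcupT_measurable_rat => s.
rewrite bigcup_mkcond; apply: bigcupT_measurable_rat => t; case: ifPn => // _.
by apply: measurableX; exact: measurable_itv.
Qed.

Lemma rcont_measurable f : rcont f -> measurable_fun setT (f \o of_xy : plane -> R).
Proof.
move=> cf; apply: (@cont_on_measurable setT) => [|z e _ e0].
  by rewrite preimage_setT; exact: measurableT.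
by have [d d0 H] := cf z _ e0; exists d => // h /H.
Qed.

Lemma rcont_continuous f : rcont f -> continuous (fun p : R * R => f (p.1 +i* p.2)).
Proof.
move=> cf [x y]; apply/cvgrPdist_lt => e e0 /=.
have [d d0 H] := cf (x +i* y) _ e0.
have d20 : 0 < d / 2 by rewrite divr_gt0.
exists (ball x (d / 2), ball y (d / 2)) => /=; first by split; exact: nbhsx_ballx.
move=> [x' y'] /= [hx hy].
have := H ((x' - x) +i* (y' - y)); simpc.
have -> : x + (x' - x) = x' by ring.
have -> : y + (y' - y) = y' by ring.
rewrite distrC; apply; apply: (le_lt_trans (normc_ReIm _)) => /=.
move: hx hy; rewrite /ball /= distrC [in X in _ -> X -> _]distrC; lra.
Qed.

Lemma rcont_bounded f (a : R) : rcont f ->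
  exists M : R, forall x y : R, `|x| <= a -> `|y| <= a -> `|f (x +i* y)| <= M.
Proof.
move=> /rcont_continuous cf.
have cK : compact (`[(- a), a]%classic `*` `[(- a), a]%classic : set (R * R)).
  by apply: compact_setX; exact: segment_compact.
have cfK : {within (`[(- a), a]%classic `*` `[(- a), a]%classic : set (R * R)),
   continuous (fun p : R * R => f (p.1 +i* p.2))} by exact: continuous_subspaceT.
have /compact_bounded [M [_ HM]] := continuous_compact cfK cK.
exists (M + 1) => x y hx hy; apply: (HM (M + 1)); first by rewrite ltrDl.
by exists (x, y) => //; split; rewrite /= in_itv /= -ler_norml.
Qed.

Lemma rcont_integrable f (A : set plane) (a : R) : rcont f ->
  measurable A -> (area A < +oo)%E ->
  (forall p, A p -> `|p.1| <= a /\ `|p.2| <= a) ->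
  area.-integrable A (EFin \o (f \o of_xy)).
Proof.
move=> cf mA finA Aa; apply: measurable_bounded_integrable => //.
  exact: measurable_funS (rcont_measurable cf).
have [M HM] := rcont_bounded a cf.
exists M; split; first exact: num_real.
move=> x Mx [u v] /Aa /= [hu hv]; apply: le_trans (ltW Mx); exact: HM.
Qed.

(** Half-open, so that the four quarters of a square form an exact partition of it. *)
Definition box (a b s : R) : set plane :=
  `[a, a + s[%classic `*` `[b, b + s[%classic.

Lemma boxP a b s (x y : R) :
  box a b s (x, y) <-> (a <= x < a + s) && (b <= y < b + s).
Proof.
rewrite /box; split => [[]|/andP[h1 h2]]; last by split; rewrite /= in_itv.
by rewrite /= !in_itv /= => -> ->.
Qed.

Lemma measurable_box a b s : measurable (box a b s).
Proof. by apply: measurableX; exact: measurable_itv. Qed.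

Lemma measure_seg (a s : R) : 0 <= s -> @lebesgue_measure R `[a, a + s[%classic = s%:E.
Proof.
move=> s0; rewrite lebesgue_measure_itv /= lte_fin ltrDl.
case: ltP => s1; first by rewrite -EFinB; congr (_%:E); ring.
by rewrite (@le_anti _ _ s 0) ?s0 ?s1.
Qed.

Lemma area_box a b s : 0 <= s -> area (box a b s) = (s ^+ 2)%:E.
Proof.
move=> s0; rewrite /area /box product_measure1E; try exact: measurable_itv.
by rewrite [X in (X * _)%E]measure_seg// [X in (_ * X)%E]measure_seg// -EFinM expr2.
Qed.

Lemma box_integrable f a b s : rcont f -> 0 <= s ->
  area.-integrable (box a b s) (EFin \o (f \o of_xy)).
Proof.
move=> cf s0.
apply: (@rcont_integrable _ _ (`|a| + `|b| + s) cf (measurable_box a b s)).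
  by rewrite area_box// ltry.
move=> [x y] [] /=; rewrite !in_itv /= => /andP[x1 x2] /andP[y1 y2].
have := ler_norm a; have := ler_norm b; have := ler_normr (- a) a.
have := lerNnormlW (lexx `|a|); have := lerNnormlW (lexx `|b|) => *.
have := normr_ge0 a; have := normr_ge0 b => *.
by split; rewrite ler_norml; apply/andP; split; lra.
Qed.

End PlaneMeasure.

Section IntegralBounds.
Context d (T : measurableType d) (R : realType).
Variable m : {measure set T -> \bar R}.

Lemma Rintegral_near_cst (D : set T) (f : T -> R) (c e v : R) : measurable D ->
  m D = v%:E -> m.-integrable D (EFin \o f) ->
  (forall x, D x -> `|f x - c| <= e) ->
  `|\int[m]_(x in D) f x - c * v| <= e * v.
Proof.
move=> mD mDv intf H.
have finD : (m D < +oo)%E by rewrite mDv ltry.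
have icst k : m.-integrable D (EFin \o cst k).
  apply: measurable_bounded_integrable => //.
  by exists `|k|; split; [exact: num_real|move=> x kx y _; exact: ltW].
have E k : \int[m]_(_ in D) k = k * v by rewrite Rintegral_cst// mDv.
rewrite -!E -RintegralB//; last exact: icst.
apply: (le_trans (le_normr_Rintegral _ _)) => //.
  by apply: (@integrableB _ _ _ m D mD _ _ intf (icst c)).
apply: le_Rintegral => //; last exact: icst.
exact: (integrable_norm (integrableB mD intf (icst c))).
Qed.

End IntegralBounds.

(** * Goursat's theorem for the dbar operator *)

Section Bisection.
Context {R : realType}.
(** [E a b s] is an additive function of squares, given by the lower left corner and the side. *)
Variable E : R -> R -> R -> R.
Hypothesis E_additive : forall a b s, 0 < s -> E a b (s + s) =
  E a b s + E (a + s) b s + (E a (b + s) s + E (a + s) (b + s) s).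

(** Closed, unlike [box]: the common point of the nested squares may lie on an edge. *)
Definition inside (a b s x y : R) := (a <= x <= a + s) && (b <= y <= b + s).

(** [E] is of smaller order than the area on squares that shrink to the point and contain it, in
    whatever position. *)
Definition negligible_at x y := forall e : R, 0 < e -> exists2 d : R, 0 < d &
  forall a b s, 0 < s < d -> inside a b s x y -> `|E a b s| <= e * s ^+ 2.

(** The last quarter is taken by default: if the other three carry less than a fourth of [E] each,
    additivity forces it to carry more. *)
Let quarter (p : R * R) (s : R) : R * R :=
  let t := s / 2 in
  if `|E p.1 p.2 s| <= 4 * `|E p.1 p.2 t| then p else
  if `|E p.1 p.2 s| <= 4 * `|E (p.1 + t) p.2 t| then (p.1 + t, p.2) else
  if `|E p.1 p.2 s| <= 4 * `|E p.1 (p.2 + t) t| then (p.1, p.2 + t) else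
  (p.1 + t, p.2 + t).

Let quarterP p s : 0 < s ->
  [/\ `|E p.1 p.2 s| <= 4 * `|E (quarter p s).1 (quarter p s).2 (s / 2)|,
      p.1 <= (quarter p s).1 <= p.1 + s / 2 &
      p.2 <= (quarter p s).2 <= p.2 + s / 2].
Proof.
move=> s0; have t0 : 0 < s / 2 by rewrite divr_gt0.
have l (t : R) : 0 < t -> forall u : R, (u <= u <= u + t) && (u <= u + t <= u + t).
  move=> t1 u; have u1 : u <= u + t by rewrite lerDl ltW.
  by rewrite !lexx u1.
rewrite /quarter.
case: ifPn => [?|/negP h1]; first by split=> //=; have /andP[] := l _ t0 p.1; have /andP[] := l _ t0 p.2.
case: ifPn => [?|/negP h2]; first by split=> //=; have /andP[] := l _ t0 p.1; have /andP[] := l _ t0 p.2.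
case: ifPn => [?|/negP h3]; first by split=> //=; have /andP[] := l _ t0 p.1; have /andP[] := l _ t0 p.2.
split=> /=; last 2 first.
- by have /andP[] := l _ t0 p.1.
- by have /andP[] := l _ t0 p.2.
have := E_additive p.1 p.2 t0; rewrite -splitr => Es.
have : `|E p.1 p.2 s| <= `|E p.1 p.2 (s / 2)| + `|E (p.1 + s / 2) p.2 (s / 2)| +
   (`|E p.1 (p.2 + s / 2) (s / 2)| + `|E (p.1 + s / 2) (p.2 + s / 2) (s / 2)|).
  by rewrite {1}Es; apply: (le_trans (ler_normD _ _)); rewrite lerD// ler_normD.
move: h1 h2 h3 => /negP; rewrite -ltNge => h1 /negP; rewrite -ltNge => h2 /negP.
by rewrite -ltNge => h3; lra.
Qed.

Variables (a b s : R).
Hypothesis s_gt0 : 0 < s.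

Let side n : R := s / 2 ^+ n.
Let corner n := nat_rect (fun=> (R * R)%type) (a, b) (fun n p => quarter p (side n)) n.

Let side_gt0 n : 0 < side n. Proof. by rewrite divr_gt0// exprn_gt0. Qed.

Let sideS n : side n / 2 = side n.+1.
Proof. by rewrite /side exprS; field; rewrite expf_neq0. Qed.

Let cornerP n : [/\ `|E (corner n).1 (corner n).2 (side n)| <=
        4 * `|E (corner n.+1).1 (corner n.+1).2 (side n.+1)|,
      (corner n).1 <= (corner n.+1).1 <= (corner n).1 + side n / 2 &
      (corner n).2 <= (corner n.+1).2 <= (corner n).2 + side n / 2].
Proof. by rewrite -sideS; exact: quarterP. Qed.

Let nested (c : nat -> R) :
  (forall n, c n <= c n.+1 <= c n + side n / 2) ->
  exists x, forall n, c n <= x <= c n + side n.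
Proof.
move=> H.
have mono n k : c n <= c (n + k)%N.
  elim: k => [|k ih]; first by rewrite addn0.
  by rewrite addnS (le_trans ih)//; have /andP[] := H (n + k)%N.
have anti n k : c (n + k)%N + side (n + k) <= c n + side n.
  elim: k => [|k ih]; first by rewrite addn0.
  rewrite addnS (le_trans _ ih)// -sideS; have /andP[] := H (n + k)%N.
  by move: (side _) (c _) (c _) => u v w; lra.
have ub n m : c m <= c n + side n.
  have [mn|/ltnW mn] := leqP m n.
    rewrite -(subnKC mn) (le_trans (mono m (n - m)%N))// lerDl ltW//.
  have := anti n (m - n)%N; rewrite subnKC//; apply: le_trans.
  by rewrite lerDl ltW.
exists (sup (range c)) => n; apply/andP; split.
  apply: ub_le_sup; last by exists n.
  by exists (c 0%N + side 0%N) => _ [m _ <-].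
apply: ge_sup; first by exists (c 0%N); exists 0%N.
by move=> _ [m _ <-].
Qed.

Lemma bisection :
  (forall x y, inside a b s x y -> negligible_at x y) -> E a b s = 0.
Proof.
move=> Hloc; apply/eqP; rewrite -normr_le0 leNgt; apply/negP => E0.
have [x Hx] : exists x, forall n, (corner n).1 <= x <= (corner n).1 + side n.
  by apply: nested => n; have [] := cornerP n.
have [y Hy] : exists x, forall n, (corner n).2 <= x <= (corner n).2 + side n.
  by apply: nested => n; have [] := cornerP n.
have sq0 : side 0%N = s by rewrite /side expr0 divr1.
have ins : inside a b s x y.
  by have := Hx 0%N; have := Hy 0%N; rewrite sq0 /= /inside => -> ->.
(* Half of the initial density |E| / s^2. The density never decreases along the chosen squares,
   which contradicts negligibility at their common point. *)
have e0 : 0 < `|E a b s| / s ^+ 2 / 2 by rewrite !divr_gt0 ?exprn_gt0.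
have [d d0 H] := Hloc _ _ ins _ e0.
have grow n : `|E a b s| / s ^+ 2 * side n ^+ 2 <=
    `|E (corner n).1 (corner n).2 (side n)|.
  elim: n => [|n ih]; first by rewrite sq0 divfK ?expf_neq0 ?gt_eqF.
  have [+ _ _] := cornerP n; rewrite -sideS.
  move=> h; move: (le_trans ih h).
  have -> : (side n / 2) ^+ 2 = side n ^+ 2 / 4 by field.
  by move: (`|E (corner n.+1).1 _ _|) => w h2; lra.
have [n nd] : exists n, side n < d.
  exists (Num.bound (s / d)); rewrite /side ltr_pdivrMr ?exprn_gt0//.
  rewrite mulrC -ltr_pdivrMr//; apply: (@lt_le_trans _ _ (Num.bound (s / d))%:R).
    by have := @archi_boundP R (s / d) (ltW (divr_gt0 s_gt0 d0)).
  by rewrite -natrX ler_nat ltnW// ltn_expl.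
have insn : inside (corner n).1 (corner n).2 (side n) x y by rewrite /inside Hx Hy.
have := H _ _ (side n) _ insn; rewrite side_gt0 nd => /(_ isT).
move/(le_trans (grow n)); apply/negP; rewrite -ltNge ltr_pM2r ?exprn_gt0//.
by rewrite gtr_pMr ?divr_gt0 ?exprn_gt0// invf_lt1// ltr1n.
Qed.

End Bisection.

(** * Bisection with one exceptional point *)

Section PuncturedBisection.
Context {R : realType}.
Variable E : R -> R -> R -> R.
Hypothesis E_additive : forall a b s, 0 < s -> E a b (s + s) =
  E a b s + E (a + s) b s + (E a (b + s) s + E (a + s) (b + s) s).
Variables (x0 y0 : R).
Hypothesis E_loc : forall x y, (x, y) != (x0, y0) -> negligible_at E x y.
Hypothesis E_pt : forall e : R, 0 < e -> exists2 d : R, 0 < d &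
  forall a b s, 0 < s < d -> inside a b s x0 y0 -> `|E a b s| <= e.

(** Every point of such a square is negligible, so plain bisection applies. *)
Let E_away a b s : 0 < s -> ~~ inside a b s x0 y0 -> E a b s = 0.
Proof.
move=> s0 /negP H; apply: (bisection E_additive s0) => x y xy; apply: E_loc.
by apply/eqP => -[xx yy]; apply: H; rewrite -xx -yy.
Qed.

(* The four squares of side t with a corner at the exceptional point are
   indexed by two booleans; halving such a square leaves one of the same kind
   and three squares that avoid the point. *)
Let E_corner (i j : bool) t : 0 < t -> E (x0 - i%:R * t) (y0 - j%:R * t) t = 0.
Proof.
have halve s : 0 < s -> E (x0 - i%:R * (s + s)) (y0 - j%:R * (s + s)) (s + s) =
    E (x0 - i%:R * s) (y0 - j%:R * s) s.
  move=> s0; rewrite E_additive//.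
  case: i j => [] [|]; rewrite ?mul0r ?mul1r ?subr0.
  - rewrite (E_away (a := x0 - (s + s)) (b := y0 - (s + s)))//; last first.
      by rewrite /inside; apply/negP => /andP[/andP[? ?] /andP[? ?]]; lra.
    rewrite (E_away (a := x0 - (s + s) + s) (b := y0 - (s + s)))//; last first.
      by rewrite /inside; apply/negP => /andP[/andP[? ?] /andP[? ?]]; lra.
    rewrite (E_away (a := x0 - (s + s)) (b := y0 - (s + s) + s))//; last first.
      by rewrite /inside; apply/negP => /andP[/andP[? ?] /andP[? ?]]; lra.
    by rewrite !add0r; congr E; ring.
  - rewrite (E_away (a := x0 - (s + s)) (b := y0))//; last first.
      by rewrite /inside; apply/negP => /andP[/andP[? ?] /andP[? ?]]; lra.
    rewrite (E_away (a := x0 - (s + s)) (b := y0 + s))//; last first.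
      by rewrite /inside; apply/negP => /andP[/andP[? ?] /andP[? ?]]; lra.
    rewrite (E_away (a := x0 - (s + s) + s) (b := y0 + s))//; last first.
      by rewrite /inside; apply/negP => /andP[/andP[? ?] /andP[? ?]]; lra.
    by rewrite !add0r !addr0; congr E; ring.
  - rewrite (E_away (a := x0) (b := y0 - (s + s)))//; last first.
      by rewrite /inside; apply/negP => /andP[/andP[? ?] /andP[? ?]]; lra.
    rewrite (E_away (a := x0 + s) (b := y0 - (s + s)))//; last first.
      by rewrite /inside; apply/negP => /andP[/andP[? ?] /andP[? ?]]; lra.
    rewrite (E_away (a := x0 + s) (b := y0 - (s + s) + s))//; last first.
      by rewrite /inside; apply/negP => /andP[/andP[? ?] /andP[? ?]]; lra.
    by rewrite !add0r !addr0; congr E; ring.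
  - rewrite (E_away (a := x0 + s) (b := y0))//; last first.
      by rewrite /inside; apply/negP => /andP[/andP[? ?] /andP[? ?]]; lra.
    rewrite (E_away (a := x0) (b := y0 + s))//; last first.
      by rewrite /inside; apply/negP => /andP[/andP[? ?] /andP[? ?]]; lra.
    rewrite (E_away (a := x0 + s) (b := y0 + s))//; last first.
      by rewrite /inside; apply/negP => /andP[/andP[? ?] /andP[? ?]]; lra.
    by rewrite !addr0.
have iterE n : forall s, 0 < s -> E (x0 - i%:R * s) (y0 - j%:R * s) s =
    E (x0 - i%:R * (s / 2 ^+ n)) (y0 - j%:R * (s / 2 ^+ n)) (s / 2 ^+ n).
  elim: n => [|n ih] s s0; first by rewrite expr0 divr1.
  rewrite {1 2 3}[s]splitr halve ?divr_gt0// ih ?divr_gt0//.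
  by have -> : s / 2 / 2 ^+ n = s / 2 ^+ n.+1 by rewrite exprS invfM mulrA.
move=> t0; apply/eqP; rewrite -normr_le0; apply/ler_addgt0Pl => e e0.
rewrite addr0; have [d d0 H] := E_pt e0.
have [n nd] : exists n, t / 2 ^+ n < d.
  exists (Num.bound (t / d)); rewrite ltr_pdivrMr ?exprn_gt0//.
  rewrite mulrC -ltr_pdivrMr//; apply: (@lt_le_trans _ _ (Num.bound (t / d))%:R).
    by have := @archi_boundP R (t / d) (ltW (divr_gt0 t0 d0)).
  by rewrite -natrX ler_nat ltnW// ltn_expl.
have s0 : 0 < t / 2 ^+ n by rewrite divr_gt0 ?exprn_gt0.
rewrite (iterE n)// H ?s0//.
by rewrite /inside; move: (t / _) s0 => u u0; case: i j {halve iterE} => [] [|];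
  rewrite ?mul0r ?mul1r; apply/andP; split; apply/andP; split; lra.
Qed.

(** Cutting the square at its centre leaves four squares with a corner at the exceptional point, and
    [E_corner] disposes of each. *)
Lemma punctured_bisection t : 0 < t -> E (x0 - t) (y0 - t) (t + t) = 0.
Proof.
move=> t0; rewrite E_additive//.
have := E_corner true true t0; rewrite !mul1r => ->.
have := E_corner false true t0; rewrite !mul1r mul0r subr0 !subrK => ->.
have := E_corner true false t0; rewrite !mul1r mul0r subr0 => ->.
have := E_corner false false t0; rewrite !mul0r !subr0 => ->.
by rewrite !addr0.
Qed.

End PuncturedBisection.

(** * Flux through the boundary of a square *)

Section Goursat.
Context {R : realType}.
Local Notation C := R[i].
Local Notation plane := (measurableTypeR R * measurableTypeR R)%type.
Local Notation leb := (@lebesgue_measure R).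
Implicit Types (P Q g : C -> R) (z w h : C) (a b s x y : R).

Definition seg_int (f : R -> R) a s := \int[leb]_(x in `[a, a + s[) f x.

Lemma seg_integrable (f : R -> R) a s : continuous f ->
  leb.-integrable `[a, a + s[ (EFin \o f).
Proof.
move=> cf.
have : leb.-integrable `[a, a + s]%classic (EFin \o f).
  apply: continuous_compact_integrable; first exact: segment_compact.
  exact: continuous_subspaceT.
apply: integrableS => //=.
by move=> x /=; rewrite !in_itv /= => /andP[-> /ltW ->].
Qed.

Lemma seg_int_split (f : R -> R) a s : continuous f -> 0 < s ->
  seg_int f a (s + s) = seg_int f a s + seg_int f (a + s) s.
Proof.
move=> cf s0; rewrite /seg_int.
have E : `[a, a + (s + s)[%classic =
    `[a, a + s[%classic `|` `[a + s, a + s + s[%classic :> set R.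
  apply/seteqP; split => x /=; rewrite !in_itv /=.
    move=> /andP[x1 x2]; have [h|h] := ltP x (a + s); [left|right].
      by rewrite x1.
    by rewrite -addrA.
  by move=> [/andP[x1 x2]|/andP[x1 x2]]; apply/andP; split; lra.
rewrite E Rintegral_setU//.
- by rewrite -E; exact: seg_integrable.
- apply/disj_setPS => x [] /=; rewrite !in_itv /= => /andP[_ x1] /andP[x2 _].
  by move: (lt_le_trans x1 x2); rewrite ltxx.
Qed.

Lemma rcont_vslice P x : rcont P -> continuous (fun y : R => P (x +i* y)).
Proof.
move=> cP y; apply/cvgrPdist_lt => e e0; have [d d0 H] := cP (x +i* y) _ e0.
exists d => //= y' /= yy'; have := H (0 +i* (y' - y)); simpc.
rewrite [y + _]addrC subrK distrC; apply.
apply: (le_lt_trans (normc_ReIm _)) => /=.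
by rewrite normr0 add0r distrC.
Qed.

Lemma rcont_hslice P y : rcont P -> continuous (fun x : R => P (x +i* y)).
Proof.
move=> cP x; apply/cvgrPdist_lt => e e0; have [d d0 H] := cP (x +i* y) _ e0.
exists d => //= x' /= xx'; have := H ((x' - x) +i* 0); simpc.
rewrite [x + _]addrC subrK distrC; apply.
apply: (le_lt_trans (normc_ReIm _)) => /=.
by rewrite normr0 addr0 distrC.
Qed.

Definition rdiff P z (p1 p2 : R) := forall e : R, 0 < e ->
  exists2 d : R, 0 < d & forall h, normc h < d ->
    `|P (z + h) - P z - (p1 * complex.Re h + p2 * complex.Im h)| <= e * normc h.

Variables (P Q g : C -> R).
Hypotheses (cP : rcont P) (cQ : rcont Q) (cg : rcont g).

(* Flux of (P, Q) through the boundary of a square minus the integral of g. *)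
Definition flux_defect a b s :=
  seg_int (fun y => P ((a + s) +i* y) - P (a +i* y)) b s +
  seg_int (fun x => Q (x +i* (b + s)) - Q (x +i* b)) a s -
  \int[area]_(p in box a b s) g (of_xy p).

Let cPv x x' : continuous (fun y : R => P (x +i* y) - P (x' +i* y)).
Proof. by move=> y; apply: cvgB; exact: rcont_vslice. Qed.

Let cQh y y' : continuous (fun x : R => Q (x +i* y) - Q (x +i* y')).
Proof. by move=> y0; apply: cvgB; exact: rcont_hslice. Qed.

Let seg_intD (f f' : R -> R) a s : continuous f -> continuous f' ->
  seg_int (fun x => f x + f' x) a s = seg_int f a s + seg_int f' a s.
Proof. by move=> cf cf'; rewrite /seg_int RintegralD//; exact: seg_integrable. Qed.

Let box_split a b s : 0 < s -> \int[area]_(p in box a b (s + s)) g (of_xy p) =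
  \int[area]_(p in box a b s) g (of_xy p) +
  \int[area]_(p in box (a + s) b s) g (of_xy p) +
  (\int[area]_(p in box a (b + s) s) g (of_xy p) +
   \int[area]_(p in box (a + s) (b + s) s) g (of_xy p)).
Proof.
move=> s0.
have E : box a b (s + s) = (box a b s `|` box (a + s) b s) `|`
    (box a (b + s) s `|` box (a + s) (b + s) s).
  rewrite /box; apply/seteqP; split => -[x y] /=; rewrite !in_itv /=.
    move=> [] /andP[x1 x2] /andP[y1 y2].
    have [hx|hx] := ltP x (a + s); have [hy|hy] := ltP y (b + s).
    - by left; left; split; apply/andP; split; lra.
    - by right; left; split; apply/andP; split; lra.
    - by left; right; split; apply/andP; split; lra.
    - by right; right; split; apply/andP; split; lra.
  by move=> [[|]|[|]] [] /andP[x1 x2] /andP[y1 y2]; split; apply/andP; split; lra.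
have mb := @measurable_box R.
have ib : area.-integrable (box a b (s + s)) (EFin \o (g \o of_xy)).
  by apply: box_integrable => //; rewrite addr_ge0// ltW.
have i1 : area.-integrable (box a b s `|` box (a + s) b s) (EFin \o (g \o of_xy)).
  apply: (integrableS (mb a b (s + s))) => //; first exact: measurableU.
  by rewrite E; exact: subsetUl.
have i2 : area.-integrable (box a (b + s) s `|` box (a + s) (b + s) s)
    (EFin \o (g \o of_xy)).
  apply: (integrableS (mb a b (s + s))) => //; first exact: measurableU.
  by rewrite E; exact: subsetUr.
rewrite E Rintegral_setU; [|exact: measurableU|exact: measurableU|by rewrite -E|].
- rewrite Rintegral_setU//; last first.
    apply/disj_setPS => -[x y] [] /boxP /andP[/andP[? ?] _] /boxP /andP[/andP[? ?] _].
    lra.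
  rewrite Rintegral_setU//.
  apply/disj_setPS => -[x y] [] /boxP /andP[/andP[? ?] _] /boxP /andP[/andP[? ?] _].
  lra.
- apply/disj_setPS => -[x y] [].
  move=> [] /boxP /andP[_ /andP[? ?]] [] /boxP /andP[_ /andP[? ?]]; lra.
Qed.

Lemma flux_defect_additive a b s : 0 < s -> flux_defect a b (s + s) =
  flux_defect a b s + flux_defect (a + s) b s +
  (flux_defect a (b + s) s + flux_defect (a + s) (b + s) s).
Proof.
move=> s0; rewrite /flux_defect box_split// !seg_int_split//.
have EP c : seg_int (fun y => P ((a + (s + s)) +i* y) - P (a +i* y)) c s =
  seg_int (fun y => P ((a + s) +i* y) - P (a +i* y)) c s +
  seg_int (fun y => P ((a + s + s) +i* y) - P ((a + s) +i* y)) c s.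
  rewrite -seg_intD//; congr (seg_int _ c s); apply/funext => y.
  by rewrite addrA; ring.
have EQ c : seg_int (fun x => Q (x +i* (b + (s + s))) - Q (x +i* b)) c s =
  seg_int (fun x => Q (x +i* (b + s)) - Q (x +i* b)) c s +
  seg_int (fun x => Q (x +i* (b + s + s)) - Q (x +i* (b + s))) c s.
  rewrite -seg_intD//; congr (seg_int _ c s); apply/funext => x.
  by rewrite addrA; ring.
by rewrite !EP !EQ; ring.
Qed.

Let seg_near (f : R -> R) c e a s : continuous f -> 0 <= s ->
  (forall x, a <= x <= a + s -> `|f x - c| <= e) ->
  `|seg_int f a s - c * s| <= e * s.
Proof.
move=> cf s0 H; apply: Rintegral_near_cst => //.
- exact: measure_seg.
- exact: seg_integrable.
- by move=> x; rewrite /= in_itv /= => /andP[h1 /ltW h2]; apply: H; rewrite h1.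
Qed.

Let box_near c e a b s : 0 <= s ->
  (forall x y, inside a b s x y -> `|g (x +i* y) - c| <= e) ->
  `|\int[area]_(p in box a b s) g (of_xy p) - c * s ^+ 2| <= e * s ^+ 2.
Proof.
move=> s0 H; apply: Rintegral_near_cst => //.
- exact: measurable_box.
- exact: area_box.
- exact: box_integrable.
- move=> [x y] []; rewrite /= !in_itv /= => /andP[h1 /ltW h2] /andP[h3 /ltW h4].
  by apply: H; rewrite /inside h1 h2 h3.
Qed.

(** The constant and linear parts of P and Q contribute exactly [(p1 + q2) * s ^+ 2] to the flux,
    and the integral of the continuous [g] equals this up to a smaller order. *)
Lemma flux_defect_loc x0 y0 p1 p2 q1 q2 :
  rdiff P (x0 +i* y0) p1 p2 -> rdiff Q (x0 +i* y0) q1 q2 ->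
  g (x0 +i* y0) = p1 + q2 -> negligible_at flux_defect x0 y0.
Proof.
(* Nine shares: each pair of opposite sides costs four, being two sides of length s with increments
   at most 2 s, and the area integral costs one. *)
move=> dP dQ gE e e0; have e9 : 0 < e / 9 by rewrite divr_gt0.
have [d1 d10 {}dP] := dP _ e9; have [d2 d20 {}dQ] := dQ _ e9.
have [d3 d30 Hg] := cg (x0 +i* y0) e9.
exists (Num.min d1 (Num.min d2 d3) / 2).
  by rewrite divr_gt0// !lt_min d10 d20.
move=> a b s /andP[s0]; rewrite ltr_pdivlMr// !lt_min.
move=> /andP[s1 /andP[s2 s3]] /andP[/andP[ax xa] /andP[by_ yb]].
have hn x y : inside a b s x y -> normc ((x - x0) +i* (y - y0)) <= s * 2.
  move=> /andP[/andP[h1 h2] /andP[h3 h4]]; apply: (le_trans (normc_ReIm _)) => /=.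
  have : `|x - x0| <= s by rewrite ler_distl; apply/andP; split; lra.
  have : `|y - y0| <= s by rewrite ler_distl; apply/andP; split; lra.
  by move: (`|_|) (`|_|) => u v; lra.
have shift x y : (x0 +i* y0) + ((x - x0) +i* (y - y0)) = x +i* y.
  by simpc; rewrite [x0 + _]addrC subrK [y0 + _]addrC subrK.
have nP x y : inside a b s x y ->
    `|P (x +i* y) - P (x0 +i* y0) - (p1 * (x - x0) + p2 * (y - y0))| <= e / 9 * (s * 2).
  move=> /hn h; have := dP _ (le_lt_trans h s1); rewrite shift /=.
  by move/le_trans; apply; rewrite ler_pM2l.
have nQ x y : inside a b s x y ->
    `|Q (x +i* y) - Q (x0 +i* y0) - (q1 * (x - x0) + q2 * (y - y0))| <= e / 9 * (s * 2).
  move=> /hn h; have := dQ _ (le_lt_trans h s2); rewrite shift /=.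
  by move/le_trans; apply; rewrite ler_pM2l.
have ng x y : inside a b s x y -> `|g (x +i* y) - (p1 + q2)| <= e / 9.
  by move=> /hn h; have := Hg _ (le_lt_trans h s3); rewrite shift gE => /ltW.
have as_ : a <= a + s by rewrite lerDl ltW.
have bs_ : b <= b + s by rewrite lerDl ltW.
have := @seg_near (fun y => P ((a + s) +i* y) - P (a +i* y)) (p1 * s)
  (e / 9 * (s * 4)) b s (@cPv _ _) (ltW s0) _.
have := @seg_near (fun x => Q (x +i* (b + s)) - Q (x +i* b)) (q2 * s)
  (e / 9 * (s * 4)) a s (@cQh _ _) (ltW s0) _.
have := box_near (ltW s0) ng.
rewrite /flux_defect.
move: (seg_int _ _ _) (seg_int _ _ _) (Rintegral _ _ _) => I1 I2 I3 h3 h2 h1.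
have {}h1 : `|I1 - p1 * s * s| <= e / 9 * (s * 4) * s.
  apply: h1 => y hy.
  have := nP (a + s) y; rewrite /inside as_ lexx hy => /(_ isT).
  have := nP a y; rewrite /inside as_ lexx hy => /(_ isT).
  rewrite !ler_norml => /andP[? ?] /andP[? ?]; apply/andP; split; lra.
have {}h2 : `|I2 - q2 * s * s| <= e / 9 * (s * 4) * s.
  apply: h2 => x hx.
  have := nQ x (b + s); rewrite /inside bs_ lexx hx => /(_ isT).
  have := nQ x b; rewrite /inside bs_ lexx hx => /(_ isT).
  rewrite !ler_norml => /andP[? ?] /andP[? ?]; apply/andP; split; lra.
move: h1 h2 h3; rewrite !ler_norml => /andP[? ?] /andP[? ?] /andP[? ?].
by apply/andP; split; lra.
Qed.

(** Continuity of P and Q alone gives a defect of order s instead of o(s^2); this is the information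
    available at the exceptional point. *)
Lemma flux_defect_pt x0 y0 (e : R) : 0 < e -> exists2 d : R, 0 < d &
  forall a b s, 0 < s < d -> inside a b s x0 y0 -> `|flux_defect a b s| <= e.
Proof.
move=> e0.
have [d1 d10 HP] := cP (x0 +i* y0) ltr01.
have [d2 d20 HQ] := cQ (x0 +i* y0) ltr01.
have [d3 d30 Hg] := cg (x0 +i* y0) ltr01.
(* With oscillations at most 1, each pair of opposite sides contributes 2 s and the area integral at
   most (1 + |g|) s^2, which is below (1 + |g|) s because s < 1. *)
pose M := 5 + `|g (x0 +i* y0)|.
have M0 : 0 < M by rewrite ltr_wpDr.
exists (Num.min (Num.min d1 (Num.min d2 d3) / 2) (Num.min 1 (e / M))).
  by rewrite !lt_min divr_gt0 ?lt_min ?d10 ?d20//= ltr01 divr_gt0.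
move=> a b s /andP[s0]; rewrite lt_min ltr_pdivlMr// !lt_min.
move=> /andP[/andP[s1 /andP[s2 s3]] /andP[sl1 se]] /andP[/andP[ax xa] /andP[by_ yb]].
move: se; rewrite ltr_pdivlMr// => se.
have hn x y : inside a b s x y -> normc ((x - x0) +i* (y - y0)) <= s * 2.
  move=> /andP[/andP[h1 h2] /andP[h3 h4]]; apply: (le_trans (normc_ReIm _)) => /=.
  have : `|x - x0| <= s by rewrite ler_distl; apply/andP; split; lra.
  have : `|y - y0| <= s by rewrite ler_distl; apply/andP; split; lra.
  by move: (`|_|) (`|_|) => u v; lra.
have shift x y : (x0 +i* y0) + ((x - x0) +i* (y - y0)) = x +i* y.
  by simpc; rewrite [x0 + _]addrC subrK [y0 + _]addrC subrK.
have nP x y : inside a b s x y -> `|P (x +i* y) - P (x0 +i* y0)| <= 1.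
  by move=> /hn h; have := HP _ (le_lt_trans h s1); rewrite shift => /ltW.
have nQ x y : inside a b s x y -> `|Q (x +i* y) - Q (x0 +i* y0)| <= 1.
  by move=> /hn h; have := HQ _ (le_lt_trans h s2); rewrite shift => /ltW.
have ng x y : inside a b s x y -> `|g (x +i* y) - g (x0 +i* y0)| <= 1.
  by move=> /hn h; have := Hg _ (le_lt_trans h s3); rewrite shift => /ltW.
have as_ : a <= a + s by rewrite lerDl ltW.
have bs_ : b <= b + s by rewrite lerDl ltW.
have := @seg_near (fun y => P ((a + s) +i* y) - P (a +i* y)) 0 2 b s (@cPv _ _) (ltW s0) _.
have := @seg_near (fun x => Q (x +i* (b + s)) - Q (x +i* b)) 0 2 a s (@cQh _ _) (ltW s0) _.
have := box_near (ltW s0) ng.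
rewrite /flux_defect.
move: (seg_int _ _ _) (seg_int _ _ _) (Rintegral _ _ _) => I1 I2 I3 h3 h2 h1.
have {}h1 : `|I1 - 0 * s| <= 2 * s.
  apply: h1 => y hy.
  have := nP (a + s) y; rewrite /inside as_ lexx hy => /(_ isT).
  have := nP a y; rewrite /inside as_ lexx hy => /(_ isT).
  rewrite !ler_norml => /andP[? ?] /andP[? ?]; apply/andP; split; lra.
have {}h2 : `|I2 - 0 * s| <= 2 * s.
  apply: h2 => x hx.
  have := nQ x (b + s); rewrite /inside bs_ lexx hx => /(_ isT).
  have := nQ x b; rewrite /inside bs_ lexx hx => /(_ isT).
  rewrite !ler_norml => /andP[? ?] /andP[? ?]; apply/andP; split; lra.
move: h1 h2 h3 se; rewrite /M !ler_norml.
have s2s : s ^+ 2 <= s by rewrite expr2 ler_piMl// ltW.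
have := ler_norm (g (x0 +i* y0)); have := ler_norm (- g (x0 +i* y0)).
rewrite normrN; move: (g _) (`|_|) => k nk k1 k2 /andP[? ?] /andP[? ?] /andP[? ?] ?.
have s20 : 0 <= s ^+ 2 by rewrite sqr_ge0.
have nk0 : 0 <= nk by lra.
have k3 : nk * s ^+ 2 <= nk * s by rewrite ler_wpM2l.
have k4 : k * s ^+ 2 <= nk * s ^+ 2 by rewrite ler_wpM2r.
have k5 : - k * s ^+ 2 <= nk * s ^+ 2 by rewrite ler_wpM2r.
by apply/andP; split; lra.
Qed.

(** The divergence theorem in Goursat's form; the square is centred at the one point where P and Q
    may fail to be differentiable. *)
Theorem goursat_flux x0 y0 t : 0 < t ->
  (forall z, z != x0 +i* y0 -> exists p1 p2 q1 q2,
     [/\ rdiff P z p1 p2, rdiff Q z q1 q2 & g z = p1 + q2]) ->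
  flux_defect (x0 - t) (y0 - t) (t + t) = 0.
Proof.
move=> t0 H; apply: punctured_bisection => //.
- exact: flux_defect_additive.
- move=> x y xy; have [|p1 [p2 [q1 [q2 [dP dQ gE]]]]] := H (x +i* y).
    by apply: contra xy; rewrite eq_complex /= => /andP[/eqP -> /eqP ->].
  exact: flux_defect_loc dP dQ gE.
- exact: flux_defect_pt.
Qed.

End Goursat.

(** * The Bergman kernel of a disc *)

Section BergmanKernel.
Context {R : realType}.
Local Notation C := R[i].
Local Notation plane := (measurableTypeR R * measurableTypeR R)%type.
Implicit Types (F q : C -> C) (f g : C -> R) (z w h c : C).

Lemma unit_discE z : unit_disc z = (normc z < 1) :> Prop.
Proof. by rewrite /unit_disc /= normc_normE ltcR. Qed.

Lemma disc_xyE p : @disc_xy R p = (normc (of_xy p) < 1) :> Prop.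
Proof. exact: unit_discE. Qed.

Lemma cont_at_rcont_Re F : (forall z, cont_at F z) -> rcont (fun z => complex.Re (F z)).
Proof.
move=> cF z e e0; have [d d0 H] := cF z _ e0; exists d => // h /H hd.
by rewrite -raddfB (le_lt_trans (Re_normc _)).
Qed.

Lemma cont_at_rcont_Im F : (forall z, cont_at F z) -> rcont (fun z => complex.Im (F z)).
Proof.
move=> cF z e e0; have [d d0 H] := cF z _ e0; exists d => // h /H hd.
by rewrite -raddfB (le_lt_trans (Im_normc _)).
Qed.

Lemma rcont_cont_at f z : rcont f -> cont_at (fun z => (f z)%:C) z.
Proof.
move=> cf e e0; have [d d0 H] := cf z _ e0; exists d => // h /H hd.
by rewrite -rmorphB normc_real.
Qed.

Lemma rcont_normc_sq : rcont (fun z : C => normc z ^+ 2).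
Proof.
have -> : (fun z : C => normc z ^+ 2) = (fun z => complex.Re (z * z^*)).
  by apply/funext => u; rewrite mulcJ.
apply: cont_at_rcont_Re => {}z.
by apply: cont_atM; [exact: wirtinger_cont (wirtinger_id z)|
  exact: wirtinger_cont (wirtinger_conj z)].
Qed.

Lemma measurable_disc : measurable (@disc_xy R).
Proof.
have -> : @disc_xy R =
    setT `&` ((fun z : C => normc z ^+ 2) \o of_xy) @^-1` `]-oo, 1[%classic.
  rewrite setTI; apply/funext => p; rewrite disc_xyE /= in_itv /=.
  by rewrite expr_lt1 ?normc_ge0.
by apply: rcont_measurable; [exact: rcont_normc_sq|exact: measurableT|exact: measurable_itv].
Qed.

Lemma disc_coord p : @disc_xy R p -> `|p.1| <= 1 /\ `|p.2| <= 1.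
Proof.
rewrite disc_xyE => /ltW h.
by split; [exact: le_trans (Re_normc _) h|exact: le_trans (Im_normc _) h].
Qed.

Lemma disc_sub_box a b s : a <= -1 -> b <= -1 -> 1 < a + s -> 1 < b + s ->
  @disc_xy R `<=` box a b s.
Proof.
move=> a1 b1 as1 bs1 [x y] /disc_coord [] /=; rewrite !ler_norml.
by move=> /andP[x1 x2] /andP[y1 y2]; apply/boxP; lra.
Qed.

Lemma area_disc : (area (@disc_xy R) < +oo)%E.
Proof.
have : (area (@disc_xy R) <= area (box (-1) (-1) 3 : set plane))%E.
  apply: le_measure; rewrite ?inE; [exact: measurable_disc|exact: measurable_box|].
  by apply: disc_sub_box; lra.
by move/le_lt_trans; apply; rewrite area_box ?ltry.
Qed.

Lemma disc_integrable f : rcont f -> area.-integrable disc_xy (EFin \o (f \o of_xy)).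
Proof.
move=> cf; apply: (rcont_integrable cf measurable_disc area_disc).
by move=> p; exact: disc_coord.
Qed.

Definition disc_int f : R := \int[area]_(p in disc_xy) f (of_xy p).

Lemma disc_intE f (A : set plane) : disc_xy `<=` A ->
  (forall z, 1 <= normc z -> f z = 0) ->
  \int[area]_(p in A) f (of_xy p) = disc_int f.
Proof.
move=> sA f0; rewrite /disc_int Rintegral_mkcond [RHS]Rintegral_mkcond.
congr (Rintegral _ _ _); apply/funext => p; rewrite /patch.
case: ifPn => pA; case: ifPn => //; rewrite ?notin_setE ?inE ?disc_xyE.
  by move=> /negP; rewrite -leNgt => /f0.
by rewrite -disc_xyE => /sA pA'; move: pA; rewrite notin_setE.
Qed.

(** The square of the positive part is C^1 with derivative of Lipschitz constant 2, which gives the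
    quadratic bound across 0. *)
Lemma pos_part_sq_taylor (t k : R) :
  `|Num.max 0 (t + k) ^+ 2 - Num.max 0 t ^+ 2 - 2 * Num.max 0 t * k| <= k ^+ 2.
Proof.
rewrite ler_norml; have [h1|h1] := leP 0 t; have [h2|h2] := leP 0 (t + k);
  apply/andP; split; nra.
Qed.

(** Unlike the square, the cube has an unbounded second derivative, hence the restriction to bounded
    [t] and [k]. *)
Lemma pos_part_cube_taylor (t k : R) : `|t| <= 1 -> `|k| < 1 ->
  `|Num.max 0 (t + k) ^+ 3 - Num.max 0 t ^+ 3 - 3 * Num.max 0 t ^+ 2 * k| <= 4 * k ^+ 2.
Proof.
rewrite ler_norml ltr_norml => /andP[t1 t2] /andP[k1 k2].
have k20 : 0 <= k ^+ 2 by rewrite sqr_ge0.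
have k3a : k ^+ 3 <= k ^+ 2 by rewrite exprS ler_piMl// ltW.
have k3b : - k ^+ 2 <= k ^+ 3 by rewrite exprS -mulN1r ler_wpM2r// ltW.
have [h1|h1] := leP 0 t; have [h2|h2] := leP 0 (t + k).
- have -> : (t + k) ^+ 3 - t ^+ 3 - 3 * t ^+ 2 * k = 3 * (t * k ^+ 2) + k ^+ 3 by ring.
  have : t * k ^+ 2 <= k ^+ 2 by rewrite ler_piMl.
  have : 0 <= t * k ^+ 2 by rewrite mulr_ge0.
  by rewrite ler_norml => ? ?; apply/andP; split; lra.
- have -> : 0 ^+ 3 - t ^+ 3 - 3 * t ^+ 2 * k = t ^+ 2 * (- t - 3 * k) by ring.
  have tk : t ^+ 2 <= k ^+ 2 by rewrite -(sqrrN k) ler_sqr ?nnegrE; lra.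
  rewrite ger0_norm; last by rewrite mulr_ge0 ?sqr_ge0//; lra.
  apply: (@le_trans _ _ (k ^+ 2 * 4)); last by rewrite mulrC.
  by apply: ler_pM; rewrite ?sqr_ge0//; lra.
- have -> : (t + k) ^+ 3 - 0 ^+ 3 - 3 * 0 ^+ 2 * k = (t + k) ^+ 3 by ring.
  have : (t + k) ^+ 3 <= k ^+ 3 by rewrite lerXn2r ?nnegrE; lra.
  by rewrite ger0_norm ?exprn_ge0//; lra.
- have -> : 0 ^+ 3 - 0 ^+ 3 - 3 * 0 ^+ 2 * k = 0 by ring.
  by rewrite normr0; lra.
Qed.

(** The divergence theorem for P = Re F and Q = Re (i F), whose divergence is twice the real part of
    dbar F; the boundary terms vanish because [F] is 0 outside the disc. *)
Lemma goursat_dbar F g w : normc w < 1 -> (forall z, cont_at F z) -> rcont g ->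
  (forall z, 1 <= normc z -> F z = 0) -> (forall z, 1 <= normc z -> g z = 0) ->
  (forall z, z != w -> exists A B, wirtinger F z A B /\ g z = complex.Re B) ->
  disc_int g = 0.
Proof.
move=> w1 cF cg F0 g0 dF.
pose P z := complex.Re (F z); pose Q z := complex.Re (F z * 'i).
have cP : rcont P by exact: cont_at_rcont_Re.
have cQ : rcont Q.
  by apply: cont_at_rcont_Re => z; apply: cont_atM => //; exact: cont_at_cst.
have cg2 : rcont (fun z => 2 * g z).
  move=> z e e0; have [d d0 H] := cg z _ (divr_gt0 e0 (ltr0Sn R 1)).
  exists d => // h /H; rewrite -mulrBr normrM ger0_norm// ltr_pdivlMr//.
  by rewrite mulrC.
have wE : w = complex.Re w +i* complex.Im w by case: (w).
(* The square is centred at the exceptional point; as |w| < 1, half-side 2 puts its boundary outside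
   the disc. *)
have := @goursat_flux _ P Q _ cP cQ cg2 (complex.Re w) (complex.Im w) 2 (ltr0Sn R 1).
rewrite /flux_defect -wE => H.
have w1' : `|complex.Re w| < 1 by exact: le_lt_trans (Re_normc _) w1.
have w2' : `|complex.Im w| < 1 by exact: le_lt_trans (Im_normc _) w1.
move: w1' w2'; rewrite !ltr_norml => /andP[w1' w2'] /andP[w3' w4'].
have bigl x y : x < -1 -> F (x +i* y) = 0.
  by move=> hx; apply: F0; apply: le_trans (Re_normc _) => /=; rewrite ler0_norm; lra.
have bigr x y : 1 < x -> F (x +i* y) = 0.
  by move=> hx; apply: F0; apply: le_trans (Re_normc _) => /=; rewrite ger0_norm; lra.
have bigb x y : y < -1 -> F (x +i* y) = 0.
  by move=> hx; apply: F0; apply: le_trans (Im_normc _) => /=; rewrite ler0_norm; lra.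
have bigt x y : 1 < y -> F (x +i* y) = 0.
  by move=> hx; apply: F0; apply: le_trans (Im_normc _) => /=; rewrite ger0_norm; lra.
have z0 a s : seg_int (fun=> 0 - 0 : R) a s = 0.
  by rewrite /seg_int subrr /Rintegral integral0.
have {}H : \int[area]_(p in box (complex.Re w - 2) (complex.Im w - 2) (2 + 2))
    (2 * g (of_xy p)) = 0.
  have H1 := H _; apply/eqP; rewrite -oppr_eq0; apply/eqP.
  rewrite -[RHS]H1 => [|z zw]; last first.
    have [A [B [dF' ->]]] := dF _ zw.
    exists (complex.Re (A + B)), (complex.Re ((A - B) * 'i)),
      (complex.Re ((A + B) * 'i)), (complex.Re (B - A)); split.
    - move=> e e0; have [d d0 {}dF'] := dF' _ e0; exists d => // h /dF'.
      apply: le_trans; apply: le_trans (Re_normc _); rewrite le_eqVlt.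
      apply/orP; left; apply/eqP; congr `|_|; rewrite /P.
      by move: (F _) (F _) => [? ?] [? ?]; case: h A B {dF'} => [? ?] [? ?] [? ?] /=; ring.
    - move=> e e0; have [d d0 {}dF'] := dF' _ e0; exists d => // h /dF'.
      apply: le_trans; apply: le_trans (Im_normc _); rewrite -normrN le_eqVlt.
      apply/orP; left; apply/eqP; congr `|_|; rewrite /Q.
      by move: (F _) (F _) => [? ?] [? ?]; case: h A B {dF'} => [? ?] [? ?] [? ?] /=; ring.
    - by case: A B {dF'} => [? ?] [? ?] /=; ring.
  have -> : (fun y => P ((complex.Re w - 2 + (2 + 2)) +i* y) -
      P ((complex.Re w - 2) +i* y)) = fun=> 0 - 0.
    by apply/funext => y; rewrite /P bigr ?bigl//; lra.
  have -> : (fun x => Q (x +i* (complex.Im w - 2 + (2 + 2))) -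
      Q (x +i* (complex.Im w - 2))) = fun=> 0 - 0.
    by apply/funext => y; rewrite /Q bigt ?bigb ?mul0r//; lra.
  by rewrite !z0 !add0r.
move: H; rewrite RintegralZl; last 2 first.
- exact: measurable_box.
- by apply: box_integrable => //; lra.
move/eqP; rewrite mulf_eq0 pnatr_eq0 /= => /eqP; rewrite disc_intE//.
by apply: disc_sub_box; lra.
Qed.

Section Kernel.
Variables (r : R) (w : C).
Hypotheses (r0 : 0 < r) (r1 : r < 1) (wr : normc w < r).

(** The truncation makes the kernel and its primitive vanish outside the disc of radius r, so that
    both are functions on the whole plane. *)
Definition gap z : R := Num.max 0 (r ^+ 2 - normc z ^+ 2).

Let den z : C := 1 - (w / (r ^+ 2)%:C) * z^*.

(** The weight times the conjugate of the weighted Bergman kernel at [w] of the disc of radius r, up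
    to the normalising constant. A zero of [den] can only occur outside that disc, where [gap] is
    0. *)
Definition bergman z : C := (gap z ^+ 2)%:C * (den z)^-1 ^+ 4.

Lemma gap_out z : r <= normc z -> gap z = 0.
Proof.
move=> h; apply/max_idPl; rewrite subr_le0 ler_sqr ?nnegrE ?normc_ge0//.
exact: ltW.
Qed.

Let gapE z : (gap z)%:C = 0 \/ (gap z)%:C = (r ^+ 2)%:C - z * z^*.
Proof.
rewrite mulcJ -rmorphB /gap; case: leP => _; [by right|by left].
Qed.

Let r2_neq0 : (r ^+ 2)%:C != 0.
Proof. by rewrite -(rmorph0 (real_complex R)) (inj_eq (@complexI R)) expf_neq0 ?gt_eqF. Qed.

Let den_neq0 z : normc z <= r -> den z != 0.
Proof.
move=> zr; rewrite subr_eq0; apply/eqP => /(congr1 (@normc R)).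
rewrite normc1 !normcM normcV normc_real normc_conj ger0_norm ?sqr_ge0//.
move/eqP; rewrite eq_sym mulrAC => /eqP E.
have : normc w * normc z < r ^+ 2.
  by rewrite expr2 (le_lt_trans (y := normc w * r))// ?ler_wpM2l ?normc_ge0 ?ltr_pM2r.
by rewrite -[_ * _](@divfK _ (r ^+ 2)) ?expf_neq0 ?gt_eqF// E mul1r ltxx.
Qed.

Let wirtinger_den z : wirtinger den z 0 (- (w / (r ^+ 2)%:C)).
Proof.
have := wirtingerB (wirtinger_cst 1 z)
  (wirtingerZ (w / (r ^+ 2)%:C) (wirtinger_conj z)).
by rewrite mulr0 mulr1 subrr sub0r.
Qed.

Let wirtinger_gap_base z :
  wirtinger (fun z : C => (r ^+ 2)%:C - z * z^*) z (- z^*) (- z).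
Proof.
have := wirtingerB (wirtinger_cst (r ^+ 2)%:C z)
  (wirtingerM (wirtinger_id z) (wirtinger_conj z)).
by rewrite !mul1r !mulr0 !mul0r !mulr1 !sub0r addr0 add0r.
Qed.

Let gap_baseE z : (r ^+ 2)%:C - z * z^* = (r ^+ 2 - normc z ^+ 2)%:C.
Proof. by rewrite mulcJ -rmorphB. Qed.

Let wirtinger_gap_sq z : wirtinger (fun z => (gap z ^+ 2)%:C) z
    ((2 * gap z)%:C * (- z^*)) ((2 * gap z)%:C * (- z)).
Proof.
have := @wirtinger_comp_real _ (fun t => Num.max 0 t ^+ 2) (2 * gap z) 1 1 _ z _ _ _
  ltr01 ltr01 _ (wirtinger_gap_base z).
set F := (X in wirtinger X); have -> : F = (fun z => (gap z ^+ 2)%:C).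
  by apply/funext => u; rewrite /F gap_baseE.
apply => [u|k _]; first by rewrite gap_baseE.
by rewrite gap_baseE mul1r; exact: pos_part_sq_taylor.
Qed.

Let wirtinger_gap_cube z : normc z <= r -> wirtinger (fun z => (gap z ^+ 3)%:C) z
    ((3 * gap z ^+ 2)%:C * (- z^*)) ((3 * gap z ^+ 2)%:C * (- z)).
Proof.
move=> zr.
have := @wirtinger_comp_real _ (fun t => Num.max 0 t ^+ 3) (3 * gap z ^+ 2) 4 1 _ z _ _ _
  (ltr0Sn R 3) ltr01 _ (wirtinger_gap_base z).
set F := (X in wirtinger X); have -> : F = (fun z => (gap z ^+ 3)%:C).
  by apply/funext => u; rewrite /F gap_baseE.
apply => [u|k k1]; first by rewrite gap_baseE.
rewrite gap_baseE; apply: pos_part_cube_taylor => //=.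
have z2 : normc z ^+ 2 <= r ^+ 2 by rewrite ler_sqr ?nnegrE ?normc_ge0// ltW.
have r21 : r ^+ 2 <= 1 by rewrite expr_le1// ltW.
by have := sqr_ge0 (normc z); rewrite ler_norml => ?; apply/andP; split; lra.
Qed.

Let v := w / (r ^+ 2)%:C.

Let S z := (gap z ^+ 3)%:C * (den z)^-1 ^+ 3.

(** Since dbar gap = - z and dbar den = - w / r^2, the terms in w |z|^2 cancel and dbar (gap / den)
    = (w - z) / den^2. The factor [w - z] later cancels the denominator of the difference
    quotient. *)
Let wirtinger_S z : normc z <= r ->
  exists A, wirtinger S z A (3 * (w - z) * bergman z).
Proof.
move=> zr; have d0 := den_neq0 zr.
have := wirtingerM (wirtinger_gap_cube zr)
  (wirtingerX 3 (wirtingerV d0 (wirtinger_den z))).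
move=> H; eexists; apply: wirtinger_eq H _ _; first by reflexivity.
have c3 (x : R) : (3 * x ^+ 2)%:C = 3 * x%:C ^+ 2 :> C.
  by rewrite rmorphM rmorphXn rmorph_nat.
have cX n (x : R) : (x ^+ n)%:C = x%:C ^+ n :> C by rewrite rmorphXn.
rewrite /bergman c3 !(cX _ (gap _)) /=.
have [->|E] := gapE z; first by ring.
have rr : (r : R)%:C != 0.
  by rewrite -(rmorph0 (real_complex R)) (inj_eq (@complexI R)) gt_eqF.
have dE : den z = ((r ^+ 2)%:C - w * z^*) / (r ^+ 2)%:C.
  by rewrite /den mulrBl divff// mulrAC.
have d0' : (r%:C) ^+ 2 - w * z^* != 0.
  by move: d0; rewrite dE mulf_eq0 negb_or cX => /andP[].
rewrite E dE cX; field.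
by rewrite d0' rr.
Qed.

Let cont_bergman z : normc z <= r -> cont_at bergman z.
Proof.
move=> zr; apply: wirtinger_cont.
exact: wirtingerM (wirtinger_gap_sq z)
  (wirtingerX 4 (wirtingerV (den_neq0 zr) (wirtinger_den z))).
Qed.

Let outside z : r < normc z -> exists2 d : R, 0 < d &
  forall h, normc h < d -> gap (z + h) = 0.
Proof.
move=> rz; exists (normc z - r); first by rewrite subr_gt0.
move=> h hd; apply: gap_out; have := normcBD z (- h).
by rewrite opprK normcN; lra.
Qed.

(** Off the closed disc of radius r, where [q] is arbitrary, the product is locally 0. *)
Lemma cont_bergman_mul q c z : (forall z, normc z <= r -> cont_at q z) ->
  cont_at (fun z => c * q z * bergman z) z.
Proof.
move=> hq; have [zr|rz] := leP (normc z) r.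
  apply: cont_atM; last exact: cont_bergman.
  apply: cont_atM; first exact: cont_at_cst.
  exact: hq.
have [d d0 H] := outside rz.
apply: (@cont_at_ext _ (fun=> 0) _ _ d d0); last exact: cont_at_cst.
by move=> h /H g0; rewrite /bergman g0 expr0n /= mul0r mulr0.
Qed.

(* With p = (q - q w) / (z - w) one has
   dbar (- p / 3 * (gap / den)^3) = (q - q w) * bergman. *)
Lemma bergman_mean q c :
  (forall z, normc z <= r -> exists A, wirtinger q z A 0) ->
  disc_int (fun z => complex.Re (c * (q z - q w) * bergman z)) = 0.
Proof.
move=> hq; have w1 := lt_trans wr r1.
have [q' dq'] := hq w (ltW wr).
(* Filled in by the derivative, the quotient is continuous at [w]; there [w] serves as the
   exceptional point of [goursat_dbar]. *)
pose P z := if z == w then q' else (q z - q w) / (z - w).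
have dP z : normc z <= r -> z != w -> exists A, wirtinger P z A 0.
  move=> zr zw; have zw0 : z - w != 0 by rewrite subr_eq0.
  have [A dq] := hq z zr.
  have dzw : wirtinger (fun z => z - w) z 1 0.
    by have := wirtingerB (wirtinger_id z) (wirtinger_cst w z); rewrite !subr0.
  have dqw : wirtinger (fun z => q z - q w) z A 0.
    by have := wirtingerB dq (wirtinger_cst (q w) z); rewrite !subr0.
  have := wirtingerM dqw (@wirtingerV _ (fun z => z - w) _ _ _ zw0 dzw).
  rewrite mul0r oppr0 mul0r mulr0 addr0 => H.
  eexists; apply: wirtinger_ext H; first exact: (normc_gt0 zw0).
  move=> h hd; rewrite /P; case: eqVneq => // E.
  by move: hd; rewrite -E opprD addrA subrr sub0r normcN ltxx.
have cP z : normc z <= r -> cont_at P z.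
  move=> zr; have [->|zw] := eqVneq z w.
    move=> e e0; have [d d0 H] := dq' _ (divr_gt0 e0 (ltr0Sn R 1)).
    exists d => // h /H hd; rewrite /P eqxx.
    case: eqVneq => [|hw]; first by rewrite subrr normc0.
    have h0 : h != 0 by apply: contra hw => /eqP ->; rewrite addr0.
    have -> : (q (w + h) - q w) / (w + h - w) - q' =
        (q (w + h) - q w - (q' * h + 0 * h^*)) / h.
      by rewrite [w + h]addrC addrK; field.
    rewrite normcM normcV ltr_pdivrMr ?normc_gt0//.
    apply: (le_lt_trans hd); rewrite ltr_pM2r ?normc_gt0//; lra.
  by have [A /wirtinger_cont] := dP _ zr zw.
have cF z : cont_at (fun z => (- c / 3) * (P z * S z)) z.
  have [zr|rz] := leP (normc z) r.
    apply: cont_atM; first exact: cont_at_cst.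
    apply: cont_atM; first exact: cP.
    by have [A /wirtinger_cont] := wirtinger_S zr.
  have [d d0 H] := outside rz.
  apply: (@cont_at_ext _ (fun=> 0) _ _ d d0); last exact: cont_at_cst.
  by move=> h /H g0; rewrite /S g0 expr0n /= mul0r !mulr0.
apply: (@goursat_dbar _ _ w w1 cF).
- apply: cont_at_rcont_Re => z.
  apply: (@cont_bergman_mul (fun z => q z - q w) c z) => u u1.
  have [A dq] := hq u u1.
  exact: wirtinger_cont (wirtingerB dq (wirtinger_cst _ _)).
- by move=> z z1; rewrite /S gap_out ?expr0n /= ?mul0r ?mulr0// (le_trans _ z1)// ltW.
- move=> z z1; rewrite /bergman gap_out ?expr0n /= ?mul0r ?mulr0//.
  by rewrite (le_trans _ z1)// ltW.
move=> z zw; have [zr|rz] := leP (normc z) r.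
  have zw0 : z - w != 0 by rewrite subr_eq0.
  have [A dPz] := dP _ zr zw; have [A' dS] := wirtinger_S zr.
  have H := wirtingerZ (- c / 3) (wirtingerM dPz dS).
  eexists; eexists; split; first exact: H.
  by congr complex.Re; rewrite /P (negbTE zw); field.
exists 0, 0; have [d d0 H] := outside rz; split.
  apply: (@wirtinger_ext _ (fun=> 0) _ _ _ _ d d0); last exact: wirtinger_cst.
  by move=> h /H g0; rewrite /S g0 expr0n /= mul0r !mulr0.
by rewrite /bergman gap_out ?expr0n /= ?mul0r ?mulr0// ltW.
Qed.

End Kernel.

End BergmanKernel.

(** * The integral of the weight over the disc *)

Section GapIntegral.
Context {R : realType}.
Local Notation C := R[i].
Local Notation plane := (measurableTypeR R * measurableTypeR R)%type.
Local Notation leb := (@lebesgue_measure R).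

Lemma is_derive_continuous (F : R -> R) (x l : R) : is_derive x 1 F l -> {for x, continuous F}.
Proof. by move=> dF; apply: differentiable_continuous; apply/derivable1_diffP. Qed.

Lemma FTC2_everywhere (f F : R -> R) (a b : R) : a <= b -> continuous f ->
  (forall x : R, is_derive x 1 F (f x)) ->
  (\int[leb]_(x in `[a, b]) (f x)%:E)%E = (F b - F a)%:E.
Proof.
rewrite le_eqVlt => /predU1P[->|ab] cf dF.
  by rewrite set_itv1 integral_set1 subrr.
have cF x : {for x, continuous F} by exact: is_derive_continuous.
rewrite (@continuous_FTC2 _ _ F) ?EFinB//.
- exact: continuous_subspaceT.
- split; first by move=> x _; exact: ex_derive.
  + by apply: cvg_at_right_filter; exact: cF.
  + by apply: cvg_at_left_filter; exact: cF.
- by move=> x _; rewrite derive1E; exact: derive_val.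
Qed.

Let gap_slice (s : R) : 0 <= s ->
  (\int[leb]_(y in `[(- s)%R, s]) ((s ^+ 2 - y ^+ 2) ^+ 2)%R%:E)%E = (16 / 15 * s ^+ 5)%:E.
Proof.
move=> s0.
pose F (y : R) := s ^+ 4 * y - s ^+ 2 * 2 / 3 * y ^+ 3 + 5^-1 * y ^+ 5.
transitivity (F s - F (- s))%:E; last by rewrite /F; congr (_%:E); field.
apply: (@FTC2_everywhere _ F); first by lra.
- move=> y; apply: (@is_derive_continuous _ _ (2 * (s ^+ 2 - y ^+ 2) * (- (2 * y)))).
  apply: is_derive_eq.
  rewrite /GRing.scale /=; ring.
- move=> y; apply: is_derive_eq.
  by rewrite /GRing.scale /=; field.
Qed.

Let cos6_integral :
  (\int[leb]_(t in `[(- (pi / 2))%R, (pi / 2)%R]) (cos t ^+ 6)%R%:E)%E = (5 / 16 * pi)%:E.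
Proof.
(* The reduction formula for powers of the cosine, applied three times. *)
pose F (t : R) := 6^-1 * (cos t ^+ 5 * sin t) +
  5 / 24 * (cos t ^+ 3 * sin t) + 5 / 16 * (cos t * sin t) + 5 / 16 * t.
transitivity (F (pi / 2) - F (- (pi / 2)))%:E; last first.
  by rewrite /F cosN cos_pihalf; congr (_%:E); field.
apply: (@FTC2_everywhere _ F).
- by have := pi_gt0 R; lra.
- move=> y; apply: (@is_derive_continuous _ _ (6 * cos y ^+ 5 * - sin y)).
  apply: is_derive_eq.
  rewrite /GRing.scale /=; ring.
- move=> y; apply: is_derive_eq.
  have E : sin y ^+ 2 = 1 - cos y ^+ 2 by rewrite -(cos2Dsin2 y); ring.
  rewrite /GRing.scale /=.
  transitivity (6^-1 * cos y ^+ 6 - 5 / 6 * cos y ^+ 4 * sin y ^+ 2 +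
    5 / 24 * cos y ^+ 4 - 5 / 8 * cos y ^+ 2 * sin y ^+ 2 +
    5 / 16 * cos y ^+ 2 - 5 / 16 * sin y ^+ 2 + 5 / 16); first by field.
  by rewrite E; field.
Qed.

(** If |x| > r the root is 0 by convention and the segment shrinks to y = 0, where the formula gives
    0 as well, so it holds for all x. *)
Let gap_sqrt (r x y : R) :
  gap r (x +i* y) ^+ 2 = (if y \in `[- Num.sqrt (r ^+ 2 - x ^+ 2), Num.sqrt (r ^+ 2 - x ^+ 2)]
    then (Num.sqrt (r ^+ 2 - x ^+ 2) ^+ 2 - y ^+ 2) ^+ 2 else 0).
Proof.
rewrite /gap normc_sqE /= in_itv /= -ler_norml.
have [h|h] := leP 0 (r ^+ 2 - x ^+ 2).
  rewrite sqr_sqrtr//; case: ifPn.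
    rewrite -(@ler_sqr _ `|y|) ?nnegrE ?sqrtr_ge0// sqr_sqrtr// real_normK ?num_real//.
    by move=> h2; rewrite max_r; [congr (_ ^+ 2); ring|lra].
  rewrite -ltNge -(@ltr_sqr _ _ `|y|) ?nnegrE ?sqrtr_ge0// sqr_sqrtr//.
  rewrite real_normK ?num_real// => h2.
  by rewrite max_l ?expr0n//=; lra.
have y20 := sqr_ge0 y.
rewrite max_l; last by lra.
rewrite ltr0_sqrtr// expr0n /= normr_le0 sub0r sqrrN.
by case: eqP => // ->; rewrite !expr0n.
Qed.

Let sqrt_sin (r t : R) : 0 <= r -> 0 <= cos t ->
  Num.sqrt (r ^+ 2 - (r * sin t) ^+ 2) = r * cos t.
Proof.
move=> r0 c0; have -> : r ^+ 2 - (r * sin t) ^+ 2 = (r * cos t) ^+ 2.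
  transitivity (r ^+ 2 * (1 - sin t ^+ 2)); first by ring.
  by rewrite -(cos2Dsin2 t); ring.
by rewrite sqrtr_sqr ger0_norm// mulr_ge0.
Qed.

(** The substitution x = r sin t turns the integrand into (16 / 15) r^6 cos^6 t. *)
Let sqrt_integral (r : R) : 0 < r ->
  (\int[leb]_(x in `[(- r)%R, r]) (16 / 15 * Num.sqrt (r ^+ 2 - x ^+ 2) ^+ 5)%R%:E)%E =
  (pi * r ^+ 6 / 3)%:E.
Proof.
move=> r0.
have dF x : is_derive x (1 : R) (fun t => r * sin t) (r * cos x).
  by apply: is_derive_eq; rewrite /GRing.scale /=.
have F'E : derive1 (fun t : R => r * sin t) = fun t => r * cos t.
  by apply/funext => x; rewrite derive1E; exact: derive_val.
have ccos : continuous (fun t : R => r * cos t).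
  by move=> x; apply: cvgM; [exact: cvg_cst|exact: continuous_cos].
have csin x : {for x, continuous (fun t : R => r * sin t)}.
  by apply: cvgM; [exact: cvg_cst|exact: continuous_sin].
have Ea : - r = r * sin (- (pi / 2)) by rewrite sinN sin_pihalf; ring.
have Eb : r = r * sin (pi / 2) by rewrite sin_pihalf mulr1.
rewrite {1}Ea {2}Eb.
rewrite (@integration_by_substitution_increasing _ (fun t => r * sin t)
  (fun x => 16 / 15 * Num.sqrt (r ^+ 2 - x ^+ 2) ^+ 5)).
- rewrite F'E.
  transitivity (\int[leb]_(t in `[(- (pi / 2))%R, (pi / 2)%R])
      ((16 / 15 * r ^+ 6)%R%:E * (cos t ^+ 6)%R%:E))%E.
    apply: eq_integral => t; rewrite inE /= => ht.
    rewrite -[LHS]/((16 / 15 * Num.sqrt (r ^+ 2 - (r * sin t) ^+ 2) ^+ 5 * (r * cos t))%R%:E).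
    have c0 : 0 <= cos t by apply: cos_ge0_pihalf; move: ht; rewrite /= in_itv.
    rewrite (sqrt_sin (ltW r0) c0).
    by rewrite -EFinM; congr (_%:E); ring.
  rewrite integralZl//; last first.
    apply: continuous_compact_integrable; first exact: segment_compact.
    apply: continuous_subspaceT => t.
    apply: (@is_derive_continuous _ _ (6 * cos t ^+ 5 * - sin t)).
    by apply: is_derive_eq; rewrite /GRing.scale /=; ring.
  by rewrite cos6_integral -EFinM; congr (_%:E); field.
- by have := pi_gt0 R; lra.
- move=> x y hx hy xy; rewrite ltr_pM2l//.
  by rewrite ltr_sin.
- by move=> x _; rewrite F'E; exact: ccos.
- by rewrite F'E; apply/cvg_ex; eexists; apply: cvg_at_right_filter; exact: ccos.
- by rewrite F'E; apply/cvg_ex; eexists; apply: cvg_at_left_filter; exact: ccos.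
- split; first by move=> x _; exact: ex_derive.
  + by apply: cvg_at_right_filter; exact: csin.
  + by apply: cvg_at_left_filter; exact: csin.
- apply: continuous_subspaceT => x.
  apply: cvgM; first exact: cvg_cst.
  have c1 : {for x, continuous (fun x : R => r ^+ 2 - x ^+ 2)}.
    apply: (@is_derive_continuous _ _ (- (2 * x))).
    by apply: is_derive_eq; rewrite /GRing.scale /=; ring.
  have c2 : {for x, continuous (Num.sqrt \o (fun x : R => r ^+ 2 - x ^+ 2))}.
    by apply: continuous_comp => //; exact: sqrt_continuous.
  exact: (@continuous_comp _ _ _ _ (fun s : R => s ^+ 5) x c2 (@exprn_continuous _ _ _)).
Qed.

(** Tonelli over vertical slices. The limit pi / 3 at r = 1 is the inverse of the constant 3 / pi of
    the kernel. *)
Lemma gap_integral (r : R) : 0 < r -> r < 1 ->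
  disc_int (fun z => gap r z ^+ 2) = pi * r ^+ 6 / 3.
Proof.
move=> r0 r1.
have cg : rcont (fun z => gap r z ^+ 2).
  (* For centre 0 the denominator of [bergman] is 1, so the weight inherits the continuity already
     proved. *)
  rewrite (_ : (fun z => _) = (fun z => complex.Re (1 * 1 * bergman r 0 z))).
    apply: cont_at_rcont_Re => z.
    have w0 : normc (0 : C) < r by rewrite normc0.
    apply: (cont_bergman_mul r0 w0 (q := fun=> 1)) => u _.
    exact: cont_at_cst.
  apply/funext => u.
  by rewrite /bergman mul0r mul0r subr0 invr1 expr1n !mulr1 mul1r.
have g0 z : 1 <= normc z -> gap r z ^+ 2 = 0.
  by move=> h; rewrite (gap_out r0) ?expr0n// (le_trans _ h)// ltW.
rewrite -(@disc_intE _ (fun z => gap r z ^+ 2) setT)//.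
rewrite /Rintegral /area fubini_tonelli1/=; last 2 first.
- by apply/measurable_EFinP; exact: rcont_measurable cg.
- by move=> p; rewrite lee_fin sqr_ge0.
have inner x : (\int[leb]_y (gap r (x +i* y) ^+ 2)%:E)%E =
    (16 / 15 * Num.sqrt (r ^+ 2 - x ^+ 2) ^+ 5)%:E.
  rewrite -gap_slice ?sqrtr_ge0// [RHS]integral_mkcond; apply: eq_integral => y _.
  by rewrite gap_sqrt /patch mem_setE; case: ifP.
under eq_integral do rewrite /fubini_F /= inner.
rewrite -[RHS]/(fine (pi * r ^+ 6 / 3)%:E) -sqrt_integral//; congr fine.
rewrite [RHS]integral_mkcond; apply: eq_integral => x _.
rewrite /patch mem_setE; case: ifPn => //; rewrite in_itv /= -ler_norml -ltNge => h.
congr (_%:E); rewrite ler0_sqrtr ?expr0n ?mulr0// subr_le0.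
by rewrite -(real_normK (num_real x)) ler_sqr ?nnegrE ?(ltW r0) ?(ltW h).
Qed.

End GapIntegral.

(** * The pointwise bound from the reproducing property *)

Section BergmanBound.
Context {R : realType}.
Local Notation C := R[i].
Implicit Types (f g : C -> R) (q : C -> C) (z w : C).

Definition dintegrable f := area.-integrable disc_xy (EFin \o (f \o of_xy)).

Lemma rcont_dintegrable f : rcont f -> dintegrable f.
Proof. exact: disc_integrable. Qed.

Lemma dintegrableD f g : dintegrable f -> dintegrable g ->
  dintegrable (fun z => f z + g z).
Proof. by move=> If Ig; exact: (integrableD measurable_disc If Ig). Qed.

Lemma dintegrableB f g : dintegrable f -> dintegrable g ->
  dintegrable (fun z => f z - g z).
Proof. by move=> If Ig; exact: (integrableB measurable_disc If Ig). Qed.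

Lemma dintegrableZ (c : R) f : dintegrable f -> dintegrable (fun z => c * f z).
Proof. by move=> If; exact: (integrableZl measurable_disc c If). Qed.

Lemma disc_intD f g : dintegrable f -> dintegrable g ->
  disc_int (fun z => f z + g z) = disc_int f + disc_int g.
Proof. by move=> If Ig; rewrite /disc_int RintegralD//; exact: measurable_disc. Qed.

Lemma disc_intB f g : dintegrable f -> dintegrable g ->
  disc_int (fun z => f z - g z) = disc_int f - disc_int g.
Proof. by move=> If Ig; rewrite /disc_int RintegralB//; exact: measurable_disc. Qed.

Lemma disc_intZ (c : R) f : dintegrable f ->
  disc_int (fun z => c * f z) = c * disc_int f.
Proof. by move=> If; rewrite /disc_int RintegralZl//; exact: measurable_disc. Qed.

Lemma eq_disc_int f g : (forall z, unit_disc z -> f z = g z) ->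
  disc_int f = disc_int g.
Proof. by move=> fg; apply: eq_Rintegral => p; rewrite inE => pD; exact: fg. Qed.

Lemma le_disc_int f g : dintegrable f -> dintegrable g ->
  (forall z, unit_disc z -> f z <= g z) -> disc_int f <= disc_int g.
Proof.
move=> If Ig fg; apply: le_Rintegral => //; first exact: measurable_disc.
by move=> p pD; exact: fg.
Qed.

Lemma disc_int_ge0 f : (forall z, unit_disc z -> 0 <= f z) -> 0 <= disc_int f.
Proof. by move=> f0; apply: Rintegral_ge0 => p pD; exact: f0. Qed.

Lemma cont_at_conj q z : cont_at q z -> cont_at (fun z => (q z)^*) z.
Proof.
move=> cq e /cq [d d0 H]; exists d => // h /H.
by rewrite -rmorphB normc_conj.
Qed.

Lemma Re_conjc z : complex.Re z^* = complex.Re z.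
Proof. by case: z. Qed.

Section FixedRadius.
Variables (r : R) (w : C).
Hypotheses (r0 : 0 < r) (r1 : r < 1) (wr : normc w < r).

Let D z : C := 1 - w / (r ^+ 2)%:C * z^*.
Let E z : C := 1 - w^* / (r ^+ 2)%:C * z.

Let conjD z : (D z)^* = E z.
Proof.
have cM (a b : C) : ((a * b)^* = a^* * b^*)%R by exact: rmorphM.
have cB (a b : C) : ((a - b)^* = a^* - b^*)%R by exact: rmorphB.
rewrite /D /E -conjcE cB cM cM conjCK conjC1 fmorphV.
by congr (_ - _ * _^-1 * _); exact: conjc_real.
Qed.

Let w0 : normc (0 : C) < r. Proof. by rewrite normc0. Qed.

Let E_neq0 z : normc z <= r -> E z != 0.
Proof.
move=> zr; rewrite subr_eq0; apply/eqP => /(congr1 (@normc R)).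
rewrite normc1 !normcM normcV normc_real normc_conj ger0_norm ?sqr_ge0//.
rewrite mulrAC => EE.
have : normc w * normc z < r ^+ 2.
  by rewrite expr2 (le_lt_trans (y := normc w * r))// ?ler_wpM2l ?normc_ge0 ?ltr_pM2r.
by rewrite -[_ * _](@divfK _ (r ^+ 2)) ?expf_neq0 ?gt_eqF// -EE mul1r ltxx.
Qed.

(** The holomorphic factor of the conjugate of [bergman r w]. Inserted in the mean value identity at
    0 and at [w], it yields the integrals of the kernel and of its square. *)
Let q1 z := (E z)^-1 ^+ 4.

Let dq1 z : normc z <= r -> exists A, wirtinger q1 z A 0.
Proof.
move=> zr.
have dE : wirtinger E z (- (w^* / (r ^+ 2)%:C)) 0.
  have := wirtingerB (wirtinger_cst 1 z)
    (wirtingerZ (w^* / (r ^+ 2)%:C) (wirtinger_id z)).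
  by rewrite mulr0 mulr1 subrr sub0r.
have := wirtingerX 4 (wirtingerV (E_neq0 zr) dE).
by rewrite oppr0 mul0r mulr0 => H; eexists; exact: H.
Qed.

Let cq1 z : normc z <= r -> cont_at q1 z.
Proof. by move=> /dq1 [A /wirtinger_cont]. Qed.

Let bergman0 z : bergman r 0 z = (gap r z ^+ 2)%:C.
Proof. by rewrite /bergman mul0r mul0r subr0 invr1 expr1n mulr1. Qed.

Let bergman_mul_dintegrable c q : (forall z, normc z <= r -> cont_at q z) ->
  dintegrable (fun z => complex.Re (c * q z * bergman r w z)).
Proof.
move=> cq; apply: rcont_dintegrable; apply: cont_at_rcont_Re => z.
exact: cont_bergman_mul.
Qed.

Let gap_mul_dintegrable q : (forall z, normc z <= r -> cont_at q z) ->
  dintegrable (fun z => complex.Re (q z) * gap r z ^+ 2).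
Proof.
move=> cq; rewrite (_ : (fun z => _) = (fun z => complex.Re (1 * q z * bergman r 0 z))).
  apply: rcont_dintegrable; apply: cont_at_rcont_Re => z.
  exact: (cont_bergman_mul r0 w0).
apply/funext => z; rewrite bergman0 mul1r.
by case: (q z) => a b /=; rewrite mulr0 subr0.
Qed.

Let gap_int : dintegrable (fun z => gap r z ^+ 2).
Proof.
have := gap_mul_dintegrable (fun z _ => cont_at_cst 1 z).
by rewrite /=; under eq_fun do rewrite mul1r.
Qed.

Let A := disc_int (fun z => gap r z ^+ 2).

(** The unnormalised kernel on the diagonal. *)
Let tau : R := (1 - normc w ^+ 2 / r ^+ 2)^-1 ^+ 4.

Let wr2 : 0 < 1 - normc w ^+ 2 / r ^+ 2.
Proof.
rewrite subr_gt0 ltr_pdivrMr ?exprn_gt0// mul1r.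
by rewrite ltr_sqr ?nnegrE ?normc_ge0// ltW.
Qed.

Let tau_gt0 : 0 < tau. Proof. by rewrite exprn_gt0 ?invr_gt0. Qed.

Let q1w : q1 w = tau%:C.
Proof.
rewrite /q1 /tau rmorphXn fmorphV; congr (_ ^-1 ^+ 4).
by rewrite /E rmorphB rmorph1 mulrAC [w^* * w]mulrC mulcJ fmorph_div.
Qed.

Let conj_bergman z : (bergman r w z)^*%C = (gap r z ^+ 2)%:C * q1 z.
Proof.
transitivity (((gap r z ^+ 2)%:C)^* * ((D z)^-1 ^+ 4)^*)%R; first exact: rmorphM.
congr (_ * _); first exact: conjc_real.
transitivity (((D z)^*)%R^-1 ^+ 4); first by rewrite rmorphXn fmorphV.
by rewrite /q1 -conjD.
Qed.

(** The mean value identity at 0 for [q1]: [q1 0 = 1], and the real part is unchanged by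
    conjugation. *)
Let Re_bergman_int : disc_int (fun z => complex.Re (bergman r w z)) = A.
Proof.
have Ib : dintegrable (fun z => complex.Re (bergman r w z)).
  have := bergman_mul_dintegrable 1 (fun z _ => cont_at_cst 1 z).
  by under eq_fun do rewrite !mul1r.
have := bergman_mean r0 r1 w0 1 dq1.
have -> : (fun z => complex.Re (1 * (q1 z - q1 0) * bergman r 0 z)) =
    (fun z => complex.Re (bergman r w z) - gap r z ^+ 2).
  apply/funext => z; rewrite bergman0 mul1r mulrBl raddfB /=.
  have -> : q1 0 = 1 by rewrite /q1 /E mulr0 subr0 invr1 expr1n.
  rewrite mul1r /= -[in RHS]Re_conjc; congr (complex.Re _ - _).
  by rewrite conj_bergman mulrC.
rewrite disc_intB// => /eqP; rewrite subr_eq0 => /eqP; exact.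
Qed.

(** The kernel reproduces itself: [q1 * bergman] is the weighted squared modulus of the kernel, and
    its integral is [q1 w = tau] times that of the kernel. *)
Let bergman_sq_int :
  dintegrable (fun z => gap r z ^+ 2 * normc (D z)^-1 ^+ 8) /\
  disc_int (fun z => gap r z ^+ 2 * normc (D z)^-1 ^+ 8) = tau * A.
Proof.
have EE z : complex.Re (1 * q1 z * bergman r w z) = gap r z ^+ 2 * normc (D z)^-1 ^+ 8.
  have -> : 1 * q1 z * bergman r w z = (gap r z ^+ 2)%:C * ((D z)^-1 * ((D z)^-1)^*) ^+ 4.
    have -> : q1 z = (((D z)^-1)^*)%R ^+ 4 by rewrite fmorphV /q1 -conjD.
    by rewrite /bergman -/(D z); ring.
  by rewrite mulcJ -rmorphXn -rmorphM /= -exprM.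
have I1 := bergman_mul_dintegrable 1 cq1.
have I2 := bergman_mul_dintegrable tau%:C (fun z _ => cont_at_cst 1 z).
have FE : (fun z => complex.Re (1 * q1 z * bergman r w z)) =
   (fun z => gap r z ^+ 2 * normc (D z)^-1 ^+ 8) by apply/funext => z; exact: EE.
split; first by rewrite -FE.
have Ib : dintegrable (fun z => complex.Re (bergman r w z)).
  have := bergman_mul_dintegrable 1 (fun z _ => cont_at_cst 1 z).
  by under eq_fun do rewrite !mul1r.
rewrite -Re_bergman_int -disc_intZ// -FE; apply/eqP; rewrite -subr_eq0.
rewrite -disc_intB//; last exact: dintegrableZ.
apply/eqP; rewrite -[RHS](bergman_mean r0 r1 wr 1 dq1).
congr disc_int; apply/funext => z; rewrite mulrBr mulrBl raddfB /=.
congr (_ - _); rewrite mul1r q1w.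
by case: (bergman r w z) => a b /=; rewrite mul0r subr0.
Qed.

(* |q w|^2 is the pairing of (q w)^* q with the kernel, bounded by AM-GM. *)
Lemma bergman_bound_radius q : holomorphic_on_disc q ->
  dintegrable (fun z => normc (q z) ^+ 2 * gap r z ^+ 2) /\
  normc (q w) ^+ 2 * (r ^+ 2 - normc w ^+ 2) ^+ 4 * (pi / 3) <=
    r ^+ 2 * disc_int (fun z => normc (q z) ^+ 2 * gap r z ^+ 2).
Proof.
move=> hq.
have dq z : normc z <= r -> exists A, wirtinger q z A 0.
  by move=> zr; apply: holomorphic_wirtinger hq _; exact: le_lt_trans r1.
have cq z : normc z <= r -> cont_at q z by move=> /dq [B /wirtinger_cont].
have Iq : dintegrable (fun z => normc (q z) ^+ 2 * gap r z ^+ 2).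
  rewrite (_ : (fun z => _) = (fun z => complex.Re (q z * (q z)^*) * gap r z ^+ 2)).
    apply: (@gap_mul_dintegrable (fun z => q z * (q z)^*)) => z zr.
    exact: (cont_atM (cq z zr) (cont_at_conj (cq z zr))).
  by apply/funext => z; rewrite mulcJ.
split=> //.
have [Ik kE] := bergman_sq_int.
have Ib : dintegrable (fun z => complex.Re (bergman r w z)).
  have := bergman_mul_dintegrable 1 (fun z _ => cont_at_cst 1 z).
  by under eq_fun do rewrite !mul1r.
have mean : disc_int (fun z => complex.Re ((q w)^* * q z * bergman r w z)) =
    normc (q w) ^+ 2 * A.
  rewrite -Re_bergman_int -disc_intZ//; apply/eqP; rewrite -subr_eq0.
  rewrite -disc_intB//; [|exact: bergman_mul_dintegrable|exact: dintegrableZ].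
  apply/eqP; rewrite -[RHS](bergman_mean r0 r1 wr (q w)^* dq).
  congr disc_int; apply/funext => z; rewrite mulrBr mulrBl raddfB /=.
  congr (_ - _); rewrite [_ * q w]mulrC mulcJ.
  by case: (bergman r w z) => a b /=; rewrite mul0r subr0.
(* With these weights the second term integrates, by [bergman_sq_int], to half of the left-hand side
   and is absorbed there. *)
have bound : disc_int (fun z => complex.Re ((q w)^* * q z * bergman r w z)) <=
    disc_int (fun z => tau / 2 * (normc (q z) ^+ 2 * gap r z ^+ 2) +
      normc (q w) ^+ 2 / tau / 2 * (gap r z ^+ 2 * normc (D z)^-1 ^+ 8)).
  apply: le_disc_int; first exact: bergman_mul_dintegrable.
    by apply: dintegrableD; exact: dintegrableZ.
  move=> z _; apply: (le_trans (ler_norm _)); apply: (le_trans (Re_normc _)).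
  have nb : normc (bergman r w z) = gap r z ^+ 2 * normc (D z)^-1 ^+ 4.
    by rewrite /bergman normcM normc_real normc_exp ger0_norm ?sqr_ge0.
  rewrite normcM nb normcM normc_conj.
  move: (normc (q w)) (normc (q z)) (normc (D z)^-1) => a b d.
  have -> : tau / 2 * (b ^+ 2 * gap r z ^+ 2) +
      a ^+ 2 / tau / 2 * (gap r z ^+ 2 * d ^+ 8) =
      a * b * (gap r z ^+ 2 * d ^+ 4) +
      (2 * tau)^-1 * gap r z ^+ 2 * (tau * b - a * d ^+ 4) ^+ 2.
    by field; rewrite gt_eqF.
  rewrite lerDl; apply: mulr_ge0; last exact: sqr_ge0.
  by apply: mulr_ge0; [rewrite invr_ge0 mulr_ge0// ltW|exact: sqr_ge0].
move: bound; rewrite mean disc_intD; try exact: dintegrableZ.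
rewrite !disc_intZ// kE.
set N := disc_int _ => bound.
have {bound} : normc (q w) ^+ 2 * A <= tau * N.
  have e1 : normc (q w) ^+ 2 / tau / 2 * (tau * A) = normc (q w) ^+ 2 * A / 2.
    by field; rewrite gt_eqF.
  by move: bound; rewrite e1; lra.
rewrite /A gap_integral// /tau.
set x := 1 - _ => H.
have xE : r ^+ 2 - normc w ^+ 2 = r ^+ 2 * x by rewrite /x; field; rewrite gt_eqF.
(* [A = pi * r ^+ 6 / 3], so the multiplier x^4 r^2 completes (r^2 x)^4 on the left and cancels
   [tau] on the right. *)
have x4 : 0 <= x ^+ 4 * r ^+ 2 by rewrite mulr_ge0 ?exprn_ge0 ?ltW.
have := ler_wpM2l x4 H.
have x0 : x != 0 by rewrite gt_eqF.
have -> : x ^+ 4 * r ^+ 2 * (x^-1 ^+ 4 * N) = r ^+ 2 * N by field.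
congr (_ <= _); rewrite xE; by field.
Qed.

End FixedRadius.

(** [gap r] lies below 1 - |z|^2, so the right-hand side for radius r is at most N; the left-hand
    side is continuous in r, and r tends to 1. *)
Theorem bergman_bound q w : holomorphic_on_disc q -> unit_disc w ->
  dintegrable (fun z => normc (q z) ^+ 2 * (1 - normc z ^+ 2) ^+ 2) ->
  normc (q w) ^+ 2 * (1 - normc w ^+ 2) ^+ 4 * (pi / 3) <=
    disc_int (fun z => normc (q z) ^+ 2 * (1 - normc z ^+ 2) ^+ 2).
Proof.
rewrite unit_discE => hq w1 Iq; set N := disc_int _.
have N0 : 0 <= N.
  by apply: disc_int_ge0 => z _; rewrite mulr_ge0 ?sqr_ge0.
pose a := normc (q w) ^+ 2 * (pi / 3); pose b := normc w ^+ 2.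
have a0 : 0 <= a by rewrite mulr_ge0 ?sqr_ge0// divr_ge0 ?pi_ge0.
have b0 : 0 <= b by rewrite sqr_ge0.
have b1 : b < 1 by rewrite expr_lt1 ?normc_ge0.
have key (r : R) : normc w < r -> r < 1 -> a * (r ^+ 2 - b) ^+ 4 <= N.
  move=> wr r1; have r0 : 0 < r := le_lt_trans (normc_ge0 w) wr.
  have [Ir] := bergman_bound_radius r0 r1 wr hq.
  have -> : normc (q w) ^+ 2 * (r ^+ 2 - normc w ^+ 2) ^+ 4 * (pi / 3) =
    a * (r ^+ 2 - b) ^+ 4 by rewrite /a /b; ring.
  move/le_trans; apply.
  apply: (@le_trans _ _ (disc_int (fun z => normc (q z) ^+ 2 * gap r z ^+ 2))).
    rewrite ler_piMl//; last by rewrite expr_le1 ?(ltW r0) ?(ltW r1).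
    by apply: disc_int_ge0 => z _; rewrite mulr_ge0 ?sqr_ge0.
  apply: le_disc_int => // z; rewrite unit_discE => z1.
  rewrite ler_wpM2l ?sqr_ge0// ler_sqr ?nnegrE /gap ?le_max ?lexx//.
    have r2 : r ^+ 2 <= 1 by rewrite expr_le1 ?(ltW r0) ?(ltW r1).
    by rewrite ge_max; apply/andP; split; [rewrite subr_ge0 expr_le1 ?normc_ge0 ?(ltW z1)|lra].
  by rewrite subr_ge0 expr_le1 ?normc_ge0 ?(ltW z1).
have -> : normc (q w) ^+ 2 * (1 - normc w ^+ 2) ^+ 4 * (pi / 3) = a * (1 - b) ^+ 4.
  by rewrite /a /b; ring.
apply/ler_addgt0Pr => e e0.
(* For r >= 1 - d one has 1 - r^2 <= 2 d, a difference of fourth powers in [0, 1] costs a factor 4,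
   and 8 a d <= e. *)
pose d := e / (8 * (a + 1)).
have d0 : 0 < d by rewrite divr_gt0// mulr_gt0// ltr_wpDl.
pose r := Num.max ((1 + normc w) / 2) (1 - d).
have r1 : r < 1 by rewrite gt_max; apply/andP; split; lra.
have wr : normc w < r by rewrite lt_max; apply/orP; left; lra.
have r0 : 0 < r := le_lt_trans (normc_ge0 w) wr.
have rd : 1 - d <= r by rewrite le_max lexx orbT.
have := key r wr r1.
have bw : b < r ^+ 2 by rewrite ltr_sqr ?nnegrE ?normc_ge0// ltW.
have s1 : 1 - 2 * d <= r ^+ 2 by nra.
have s2 : r ^+ 2 < 1 by rewrite expr_lt1 ?ltW.
move: (r ^+ 2) s1 s2 bw => s s1 s2 bw H.
have : (1 - b) ^+ 4 - (s - b) ^+ 4 <= 4 * (1 - s).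
  have -> : (1 - b) ^+ 4 - (s - b) ^+ 4 = (1 - s) * ((1 - b) ^+ 3 +
    (1 - b) ^+ 2 * (s - b) + (1 - b) * (s - b) ^+ 2 + (s - b) ^+ 3) by ring.
  rewrite mulrC ler_wpM2r//; first by lra.
  have u1 : 0 <= 1 - b <= 1 by lra.
  have u2 : 0 <= s - b <= 1 by lra.
  move: (1 - b) (s - b) u1 u2 => u t /andP[u0 u1] /andP[t0 t1].
  have : u ^+ 3 <= 1 by rewrite exprn_ile1.
  have : t ^+ 3 <= 1 by rewrite exprn_ile1.
  have : u ^+ 2 * t <= 1 by rewrite mulr_ile1 ?exprn_ile1 ?sqr_ge0.
  have : u * t ^+ 2 <= 1 by rewrite mulr_ile1 ?exprn_ile1 ?sqr_ge0.
  by lra.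
move=> H2.
have : a * ((1 - b) ^+ 4 - (s - b) ^+ 4) <= a * (8 * d).
  by rewrite ler_wpM2l//; lra.
have : a * (8 * d) <= e.
  have -> : a * (8 * d) = e * (a / (a + 1)).
    by rewrite /d; field; rewrite gt_eqF// ltr_wpDl.
  by rewrite ler_piMr ?(ltW e0)// ler_pdivrMr ?ltr_wpDl// mul1r; lra.
by rewrite mulrBr; lra.
Qed.

End BergmanBound.

(** * Test functions and the energy inequality *)

Section TestFunctions.
Context {R : realType}.
Local Notation C := R[i].
Local Notation leb := (@lebesgue_measure R).
Implicit Types (f g u : C -> R) (phi q : C -> C) (z w v : C).

Lemma rcontD f g : rcont f -> rcont g -> rcont (fun z => f z + g z).
Proof.
move=> cf cg z e e0; have e20 : 0 < e / 2 by rewrite divr_gt0.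
have [d d0 {}cf] := cf z _ e20; have [d' d'0 {}cg] := cg z _ e20.
exists (Num.min d d'); first by rewrite lt_min d0.
move=> h; rewrite lt_min => /andP[/cf h1 /cg h2].
have -> : f (z + h) + g (z + h) - (f z + g z) =
  (f (z + h) - f z) + (g (z + h) - g z) by ring.
by rewrite (le_lt_trans (ler_normD _ _))// [e]splitr ltrD.
Qed.

Lemma rcontM f g : rcont f -> rcont g -> rcont (fun z => f z * g z).
Proof.
move=> cf cg.
have -> : (fun z => f z * g z) = (fun z => complex.Re ((f z)%:C * (g z)%:C)).
  by apply/funext => z /=; rewrite mulr0 subr0.
by apply: cont_at_rcont_Re => z; apply: cont_atM; exact: rcont_cont_at.
Qed.

Lemma rcont_comp (th : R -> R) f : continuous th -> rcont f -> rcont (th \o f).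
Proof.
move=> cth cf z e e0.
have /cvgrPdist_lt /(_ _ e0) /nbhs_ballP [d d0 H] := cth (f z).
have [d' d'0 {}cf] := cf z _ d0; exists d' => // h /cf hd.
by rewrite distrC; apply: H; rewrite /ball /= distrC.
Qed.

Definition dx_slice f f' := forall x y : R,
  is_derive x 1 (fun t : R => f (t +i* y)) (f' (x +i* y)).
Definition dy_slice f f' := forall x y : R,
  is_derive y 1 (fun t : R => f (x +i* t)) (f' (x +i* y)).

Let MVT_slice (h h' : R -> R) (a s : R) : 0 < s ->
  (forall x : R, is_derive x 1 h (h' x)) ->
  exists2 c, a <= c <= a + s & h (a + s) - h a = s * h' c.
Proof.
move=> s0 dh.
have ab : a < a + s by rewrite ltrDl.
have [|c] := MVT ab (fun x _ => dh x).
  by apply: continuous_subspaceT => x; exact: is_derive_continuous (dh x).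
rewrite in_itv /= => /andP[/ltW c1 /ltW c2] E; exists c; first by rewrite c1.
by rewrite E mulrC; congr (_ * _); ring.
Qed.

(** The second difference over a square of side s is, by two mean value theorems in either order,
    s^2 times a nearby value of [fxy] and s^2 times a nearby value of [fyx]. *)
Lemma schwarz f fx fy fxy fyx : dx_slice f fx -> dy_slice f fy ->
  dy_slice fx fxy -> dx_slice fy fyx -> rcont fxy -> rcont fyx ->
  forall z, fxy z = fyx z.
Proof.
move=> dfx dfy dfxy dfyx cxy cyx [x y]; apply/eqP; rewrite -subr_eq0 -normr_le0.
apply/ler_addgt0Pl => e e0; rewrite addr0; have e20 : 0 < e / 2 by rewrite divr_gt0.
have [d1 d10 H1] := cxy (x +i* y) _ e20; have [d2 d20 H2] := cyx (x +i* y) _ e20.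
pose s := Num.min d1 d2 / 4.
have s0 : 0 < s by rewrite divr_gt0// lt_min d10.
have s1 : s * 4 <= d1 by rewrite divfK// ge_min lexx.
have s2 : s * 4 <= d2 by rewrite divfK// ge_min lexx orbT.
have close a b : x <= a <= x + s -> y <= b <= y + s ->
    normc ((a - x) +i* (b - y)) < s * 4.
  move=> /andP[? ?] /andP[? ?]; apply: (le_lt_trans (normc_ReIm _)) => /=.
  by rewrite !ger0_norm; lra.
have shift a b : (x +i* y) + ((a - x) +i* (b - y)) = a +i* b.
  by simpc; rewrite [x + _]addrC subrK [y + _]addrC subrK.
have D1 (t : R) : is_derive t 1 (fun t : R => f (t +i* (y + s)) - f (t +i* y))
    (fx (t +i* (y + s)) - fx (t +i* y)).
  by have := dfx t (y + s); have := dfx t y => ? ?; exact: is_deriveB.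
have D2 (t : R) : is_derive t 1 (fun t : R => f ((x + s) +i* t) - f (x +i* t))
    (fy ((x + s) +i* t) - fy (x +i* t)).
  by have := dfy (x + s) t; have := dfy x t => ? ?; exact: is_deriveB.
have [a1 ha1 E1] := @MVT_slice (fun t => f (t +i* (y + s)) - f (t +i* y))
  (fun t => fx (t +i* (y + s)) - fx (t +i* y)) x s s0 D1.
have [b1 hb1 F1] := @MVT_slice (fun t => fx (a1 +i* t)) (fun t => fxy (a1 +i* t)) y s s0
  (fun t => dfxy _ _).
have [b2 hb2 E2] := @MVT_slice (fun t => f ((x + s) +i* t) - f (x +i* t))
  (fun t => fy ((x + s) +i* t) - fy (x +i* t)) y s s0 D2.
have [a2 ha2 F2] := @MVT_slice (fun t => fy (t +i* b2)) (fun t => fyx (t +i* b2)) x s s0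
  (fun t => dfyx _ _).
have E : fxy (a1 +i* b1) = fyx (a2 +i* b2).
  have : s * (s * fxy (a1 +i* b1)) = s * (s * fyx (a2 +i* b2)).
    by rewrite -F1 -F2 -E1 -E2; ring.
  by do 2 (move/(mulfI (lt0r_neq0 s0))).
have := H1 _ (lt_le_trans (close _ _ ha1 hb1) s1).
have := H2 _ (lt_le_trans (close _ _ ha2 hb2) s2).
rewrite !shift E => h1 h2.
have -> : fxy (x +i* y) - fyx (x +i* y) = (fyx (a2 +i* b2) - fyx (x +i* y)) -
  (fyx (a2 +i* b2) - fxy (x +i* y)) by ring.
by rewrite (le_trans (ler_normB _ _))// [e]splitr lerD// ltW.
Qed.

(* u is a C^2 function supported in the closed unit disc and L = - rho^-1 d dbar u. *)
Definition test_real u (L : C -> R) := exists ux uy uxx uyy : C -> R,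
  [/\ [/\ rcont u, rcont ux, rcont uy, rcont uxx & rcont uyy],
      [/\ dx_slice u ux, dy_slice u uy, dx_slice ux uxx & dy_slice uy uyy],
      forall z, 1 <= normc z -> [/\ u z = 0, ux z = 0, uy z = 0, uxx z = 0 & uyy z = 0] &
      forall z, unit_disc z -> L z * rho z = - (4^-1 * (uxx z + uyy z))].

(** The Laplacian has real coefficients, so the analysis is done on real functions; [part] ranges
    over the two real-linear coordinates to treat both at once. *)
Definition is_part (part : C -> R) := part = @complex.Re R \/ part = @complex.Im R.

Lemma partZ (part : C -> R) (k : R) z : is_part part -> part (k%:C * z) = k * part z.
Proof. by case=> ->; case: z => a b /=; ring. Qed.

Lemma partD (part : C -> R) z w : is_part part -> part (z + w) = part z + part w.
Proof. by case=> ->; case: z w => [a b] [c d]. Qed.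

Lemma partB (part : C -> R) z w : is_part part -> part (z - w) = part z - part w.
Proof. by case=> ->; case: z w => [a b] [c d]. Qed.

Lemma invnC (n : nat) : (n%:R^-1 : C) = (n%:R^-1 : R)%:C.
Proof. by rewrite fmorphV rmorph_nat. Qed.

(** Moves the base point: a derivative at 0 along the line through [z] becomes one at [t0] along a
    coordinate line. *)
Let slice_derive (k : C -> R) (v : C) (K : R -> R) (t0 : R) z :
  (forall t : R, k (z + t%:C * v) = K (t + t0)) ->
  derivable (fun t : R => k (z + t%:C * v)) 0 1 ->
  is_derive t0 1 K (derive1 (fun t : R => k (z + t%:C * v)) 0).
Proof.
move=> kK; have -> : (fun t : R => k (z + t%:C * v)) = (fun t : R => K (t + t0)).
  exact/funext.
have E : (fun h : R => h^-1 *: (((fun t : R => K (t + t0)) \o shift 0) (h *: (1 : R)) - K (0 + t0)))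
    = (fun h : R => h^-1 *: ((K \o shift t0) (h *: (1 : R)) - K t0)).
  by apply/funext => h /=; rewrite addr0 add0r.
rewrite derive1E; move=> dK; apply: DeriveDef.
  by move: dK; rewrite /derivable E.
by rewrite /derive E.
Qed.

Lemma partial_x_slice (part : C -> R) phi : is_part part ->
  (forall z, real_derivable phi z 1) ->
  dx_slice (part \o phi) (part \o real_partial 1 phi).
Proof.
move=> hp dphi x y.
have kK t : (x +i* y) + t%:C * 1 = (t + x) +i* y by simpc; rewrite addrC.
have kK' k t : k (phi ((x +i* y) + t%:C * 1)) = k (phi ((t + x) +i* y)) :> R by rewrite kK.
by case: hp => ->; [exact: (@slice_derive (fun w => complex.Re (phi w)) 1 (fun t => complex.Re (phi (t +i* y))) x (x +i* y)
    (kK' _) (dphi (x +i* y)).1)|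
  exact: (@slice_derive (fun w => complex.Im (phi w)) 1 (fun t => complex.Im (phi (t +i* y))) x (x +i* y)
    (kK' _) (dphi (x +i* y)).2)].
Qed.

Lemma partial_y_slice (part : C -> R) phi : is_part part ->
  (forall z, real_derivable phi z (0 +i* 1)) ->
  dy_slice (part \o phi) (part \o real_partial (0 +i* 1) phi).
Proof.
move=> hp dphi x y.
have kK t : (x +i* y) + t%:C * (0 +i* 1) = x +i* (t + y) by simpc; rewrite addrC.
have kK' k t : k (phi ((x +i* y) + t%:C * (0 +i* 1))) = k (phi (x +i* (t + y))) :> R by rewrite kK.
by case: hp => ->; [exact: (@slice_derive (fun w => complex.Re (phi w)) (0 +i* 1) (fun t => complex.Re (phi (x +i* t))) y (x +i* y)
    (kK' _) (dphi (x +i* y)).1)|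
  exact: (@slice_derive (fun w => complex.Im (phi w)) (0 +i* 1) (fun t => complex.Im (phi (x +i* t))) y (x +i* y)
    (kK' _) (dphi (x +i* y)).2)].
Qed.

Lemma continuous_cont_at q : continuous (q : C^o -> C^o) -> forall z, cont_at q z.
Proof.
move=> cq z e e0; have /cvgrPdist_lt := cq z.
have e0' : (0 : C) < e%:C by rewrite ltcR.
move=> /(_ _ e0') /nbhs_ballP [d d0 H].
have dE : d = (complex.Re d)%:C.
  by move: d0; rewrite /= ltcE /= => /andP[/eqP + _]; case: (d) => a b /= ->.
have d'0 : 0 < complex.Re d by rewrite -ltcR -dE.
exists (complex.Re d) => // h hd.
have := H (z + h); rewrite /ball /= opprD addrA subrr sub0r normrN.
rewrite normc_normE [in X in X -> _]dE ltcR => /(_ hd).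
by rewrite normc_normE ltcR normcB_sym.
Qed.

Lemma real_partial_out phi v (r : R) z : normc v = 1 ->
  (forall z, r < normc z -> phi z = 0) -> r < normc z -> real_partial v phi z = 0.
Proof.
move=> v1 phi0 rz.
have near0 (part : C -> R) : part 0 = 0 ->
    derive1 (fun t => part (real_slice phi z v t)) 0 = 0.
  move=> p0; rewrite derive1E.
  rewrite (@near_eq_derive _ _ _ _ (cst 0)) ?oner_eq0// ?derive_cst//.
  have d0 : 0 < normc z - r by rewrite subr_gt0.
  exists (normc z - r) => // t /=; rewrite sub0r normrN => td.
  rewrite /real_slice phi0 ?p0//.
  have := normcBD z (- (t%:C * v)); rewrite opprK normcN normcM v1 mulr1 normc_real.
  by lra.
by rewrite /real_partial !near0.
Qed.

Let ci : C := 0 +i* 1.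

Let derive1_lin (A B : R -> R) (a b x : R) : derivable A x 1 -> derivable B x 1 ->
  derive1 (fun t => a * A t + b * B t) x = a * derive1 A x + b * derive1 B x.
Proof.
move=> dA dB; rewrite !derive1E.
have iA : is_derive x 1 A ('D_1 A x) by exact: (DeriveDef dA erefl).
have iB : is_derive x 1 B ('D_1 B x) by exact: (DeriveDef dB erefl).
have iZ := is_deriveD (is_deriveZ a iA) (is_deriveZ b iB).
exact: (@derive_val _ _ _ _ _ _ _ iZ).
Qed.

Lemma partial_d_zbar phi v z : (forall z, real_derivable (real_partial 1 phi) z v) ->
  (forall z, real_derivable (real_partial ci phi) z v) ->
  real_partial v (d_zbar phi) z =
  2^-1 * (real_partial v (real_partial 1 phi) z + ci * real_partial v (real_partial ci phi) z).
Proof.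
move=> dX dY.
have two := invnC 2.
have RE w : complex.Re (d_zbar phi w) =
    2^-1 * complex.Re (real_partial 1 phi w) + - 2^-1 * complex.Im (real_partial ci phi w).
  rewrite /d_zbar two -/ci; move: (real_partial 1 phi w) (real_partial ci phi w).
  by move=> [a b] [c d]; rewrite /ci /=; ring.
have IM w : complex.Im (d_zbar phi w) =
    2^-1 * complex.Im (real_partial 1 phi w) + 2^-1 * complex.Re (real_partial ci phi w).
  rewrite /d_zbar two -/ci; move: (real_partial 1 phi w) (real_partial ci phi w).
  by move=> [a b] [c d]; rewrite /ci /=; ring.
have [dX1 dX2] := dX z; have [dY1 dY2] := dY z.
transitivity (derive1 (fun t => 2^-1 * complex.Re (real_slice (real_partial 1 phi) z v t) +
      - 2^-1 * complex.Im (real_slice (real_partial ci phi) z v t)) 0 +i*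
    derive1 (fun t => 2^-1 * complex.Im (real_slice (real_partial 1 phi) z v t) +
      2^-1 * complex.Re (real_slice (real_partial ci phi) z v t)) 0).
  by congr (derive1 _ 0 +i* derive1 _ 0); apply/funext => t; [exact: RE|exact: IM].
rewrite (derive1_lin _ _ dX1 dY2) (derive1_lin _ _ dX2 dY1) two.
rewrite [real_partial v (real_partial 1 phi) z]/real_partial.
rewrite [real_partial v (real_partial ci phi) z]/real_partial /ci.
move: (derive1 _ 0) (derive1 _ 0) (derive1 _ 0) (derive1 _ 0) => a b c d.
by simpc; congr (_ +i* _); ring.
Qed.

Section Smooth.
Variable phi : C -> C.
Hypothesis sphi : smooth phi.
Let X := real_partial (1 : C).
Let Y := real_partial ci.

Let dx0 (u : C) : real_derivable phi u 1. Proof. exact: ((sphi [::]).2 u).1. Qed.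
Let dy0 (u : C) : real_derivable phi u ci. Proof. exact: ((sphi [::]).2 u).2. Qed.
Let dxX (u : C) : real_derivable (X phi) u 1. Proof. exact: ((sphi [:: true]).2 u).1. Qed.
Let dyX (u : C) : real_derivable (X phi) u ci. Proof. exact: ((sphi [:: true]).2 u).2. Qed.
Let dxY (u : C) : real_derivable (Y phi) u 1. Proof. exact: ((sphi [:: false]).2 u).1. Qed.
Let dyY (u : C) : real_derivable (Y phi) u ci. Proof. exact: ((sphi [:: false]).2 u).2. Qed.

Let c_ (w : seq bool) (z : C) : cont_at (iter_partial w phi) z.
Proof. exact: continuous_cont_at (sphi w).1 z. Qed.

Let cpart (part : C -> R) q : is_part part ->
  (forall z, cont_at q z) -> rcont (part \o q).
Proof. by case=> ->; [exact: cont_at_rcont_Re|exact: cont_at_rcont_Im]. Qed.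

Let mixed (part : C -> R) z : is_part part ->
  part (Y (X phi) z) = part (X (Y phi) z).
Proof.
move=> hp.
exact: (@schwarz (part \o phi) (part \o X phi) (part \o Y phi)
  (part \o Y (X phi)) (part \o X (Y phi))
  (partial_x_slice hp dx0) (partial_y_slice hp dy0)
  (partial_y_slice hp dyX) (partial_x_slice hp dxY)
  (cpart hp (c_ [:: false; true])) (cpart hp (c_ [:: true; false])) z).
Qed.

Let factor (a b c j : C) : j * j = -1 ->
  2^-1 * (2^-1 * (a + j * b) - j * (2^-1 * (b + j * c))) = 4^-1 * (a + c).
Proof.
move=> jj; transitivity (4^-1 * (a - (j * j) * c)); first by field.
by rewrite jj; field.
Qed.

(** The mixed second derivatives cancel by [schwarz], applied to the real and to the imaginary
    part. *)
Lemma laplacianE z : laplacian phi z =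
  - ((rho z)^-1)%:C * (4^-1 * (X (X phi) z + Y (Y phi) z)).
Proof.
have S : Y (X phi) z = X (Y phi) z.
  apply/eqP; rewrite eq_complex; apply/andP.
  by split; apply/eqP; apply: mixed; [left|right].
rewrite /laplacian {1}/d_z -/ci (partial_d_zbar z dxX dxY) (partial_d_zbar z dyX dyY).
rewrite -/(X _) -/(Y _) -/(X _) -/(Y _) S; congr (_ * _).
have ci2 : ci * ci = -1 by rewrite /ci; simpc.
exact: (factor _ _ _ ci2).
Qed.

(** Beyond radius r the function is locally 0, hence so are its derivatives; the margin r < 1
    extends this to the unit circle. *)
Lemma smooth_real (part : C -> R) (r : R) :
  is_part part -> r < 1 ->
  (forall z, r < normc z -> phi z = 0) ->
  test_real (part \o phi) (part \o laplacian phi).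
Proof.
move=> hp r1 z0.
have p0 : part 0 = 0 by case: hp => ->.
have n1 : normc (1 : C) = 1 by rewrite normc1.
have ni : normc ci = 1 by rewrite /ci /= expr0n expr1n add0r sqrtr1.
have outX := real_partial_out n1 z0; have outY := real_partial_out ni z0.
have outXX := real_partial_out n1 outX; have outYY := real_partial_out ni outY.
exists (part \o X phi), (part \o Y phi), (part \o X (X phi)), (part \o Y (Y phi)).
split.
- split; [exact: cpart hp (c_ [::])|exact: cpart hp (c_ [:: true])|
    exact: cpart hp (c_ [:: false])|exact: cpart hp (c_ [:: true; true])|
    exact: cpart hp (c_ [:: false; false])].
- split; [exact: partial_x_slice hp dx0|exact: partial_y_slice hp dy0|
    exact: partial_x_slice hp dxX|exact: partial_y_slice hp dyY].
- move=> z z1; have rz := lt_le_trans r1 z1.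
  by rewrite /comp /X /Y z0// outX// outY// outXX// outYY.
- move=> z; rewrite unit_discE => z1; rewrite /comp laplacianE.
  have rho0 : rho z != 0.
    rewrite /rho mulf_neq0 ?invr_eq0 ?expf_neq0//.
    by rewrite subr_eq0 eq_sym lt_eqF// expr_lt1 ?normc_ge0.
  rewrite (invnC 4) -rmorphN !partZ// partD// mulrC !mulrA mulrN divff//.
  by rewrite !mulNr mul1r.
Qed.

End Smooth.

Lemma test_function_real (part : C -> R) phi :
  is_part part -> test_function phi ->
  test_real (part \o phi) (part \o laplacian phi).
Proof.
move=> hp [sphi [r r1 phi0]]; apply: (smooth_real sphi hp r1) => z /ltW rz.
by apply: phi0; rewrite normc_normE lecR.
Qed.

End TestFunctions.

(** * Integration by parts *)

Section Energy.
Context {R : realType}.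
Local Notation C := R[i].
Local Notation leb := (@lebesgue_measure R).
Implicit Types (f g u : C -> R) (z w : C).

Let slice_int0 (h h' : R -> R) : continuous h' ->
  (forall x : R, is_derive x 1 h (h' x)) -> (forall x, 1 <= `|x| -> h x = 0 /\ h' x = 0) ->
  (\int[leb]_x (h' x)%:E = 0)%E.
Proof.
move=> ch dh h0.
have -> : (\int[leb]_x (h' x)%:E = \int[leb]_(x in `[(- 1)%R, 1%R]) (h' x)%:E)%E.
  rewrite [RHS]integral_mkcond; apply: eq_integral => x _.
  rewrite /patch mem_setE; case: ifPn => //; rewrite in_itv /= -ler_norml -ltNge => x1.
  by rewrite (h0 _ (ltW x1)).2.
rewrite (FTC2_everywhere _ ch dh); last by lra.
by rewrite (h0 1 _).1 ?(h0 (-1) _).1 ?normrN ?normr1// subrr.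
Qed.

Let full_integrable f : rcont f -> (forall z, 1 <= normc z -> f z = 0) ->
  area.-integrable setT (EFin \o (f \o of_xy)).
Proof.
move=> cf f0; have := disc_integrable cf.
move/(integrable_mkcond _ measurable_disc).
apply: eq_integrable => // p _; rewrite /patch; case: ifPn => //.
by rewrite notin_setE disc_xyE => /negP; rewrite -leNgt => /f0 /= ->.
Qed.

Let disc_int_full f : (forall z, 1 <= normc z -> f z = 0) ->
  disc_int f = fine (\int[(leb \x leb)%E]_p (f (of_xy p))%:E).
Proof. by move=> f0; rewrite -(@disc_intE _ f setT). Qed.

Lemma disc_int_dx f f' : rcont f' -> dx_slice f f' ->
  (forall z, 1 <= normc z -> f z = 0 /\ f' z = 0) -> disc_int f' = 0.
Proof.
move=> cf' df f0; have f'0 z : 1 <= normc z -> f' z = 0 by move/f0 => [].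
rewrite disc_int_full// -integral21_prod_meas1 /=; last exact: full_integrable.
rewrite (_ : fubini_G _ _ = fun=> 0%E) ?integral0//.
apply/funext => y; rewrite /fubini_G /=.
apply: (slice_int0 (rcont_hslice cf') (fun x => df x y)) => x x1.
by apply: f0; apply: le_trans (Re_normc _).
Qed.

Lemma disc_int_dy f f' : rcont f' -> dy_slice f f' ->
  (forall z, 1 <= normc z -> f z = 0 /\ f' z = 0) -> disc_int f' = 0.
Proof.
move=> cf' df f0; have f'0 z : 1 <= normc z -> f' z = 0 by move/f0 => [].
rewrite disc_int_full// -integral12_prod_meas1 /=; last exact: full_integrable.
rewrite (_ : fubini_F _ _ = fun=> 0%E) ?integral0//.
apply/funext => x; rewrite /fubini_F /=.
apply: (slice_int0 (rcont_vslice cf') (fun y => df x y)) => y y1.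
by apply: f0; apply: le_trans (Im_normc _).
Qed.

Let is_derive_mul_comp (a a' b b' th th' : R -> R) (x : R) :
  is_derive x 1 a (a' x) -> is_derive x 1 b (b' x) ->
  is_derive (b x) 1 th (th' (b x)) ->
  is_derive x 1 (fun t => a t * th (b t)) (a' x * th (b x) + a x * (th' (b x) * b' x)).
Proof.
move=> da db dth; have dc : is_derive x 1 (th \o b) (th' (b x) * b' x).
  exact: is_derive1_comp.
have dm := is_deriveM da dc.
apply: is_derive_eq dm _.
by rewrite /GRing.scale /=; ring.
Qed.

(* Integration by parts: -4 L rho = uxx + uyy, so that the left-hand side is
   the integral of (ux^2 + uy^2) th'(u) / 4. *)
Lemma energy_ge0 u L (th th' : R -> R) : test_real u L ->
  (forall s : R, is_derive s 1 th (th' s)) -> continuous th' -> (forall s, 0 <= th' s) ->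
  0 <= disc_int (fun z => L z * rho z * th (u z)).
Proof.
move=> [ux [uy [uxx [uyy [[cu cux cuy cuxx cuyy] [dux duy duxx duyy] out LE]]]]].
move=> dth cth' th'0.
have cth : continuous th by move=> s; exact: is_derive_continuous (dth s).
have cthu : rcont (th \o u) by exact: rcont_comp.
have cth'u : rcont (th' \o u) by exact: rcont_comp.
have cDx : rcont (fun z => uxx z * th (u z) + ux z * (th' (u z) * ux z)).
  by apply: rcontD; apply: rcontM => //; exact: rcontM.
have cDy : rcont (fun z => uyy z * th (u z) + uy z * (th' (u z) * uy z)).
  by apply: rcontD; apply: rcontM => //; exact: rcontM.
have Ix : disc_int (fun z => uxx z * th (u z) + ux z * (th' (u z) * ux z)) = 0.
  apply: (@disc_int_dx (fun z => ux z * th (u z))) => //.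
    move=> x y; exact: (@is_derive_mul_comp (fun t => ux (t +i* y)) (fun t => uxx (t +i* y))
      (fun t => u (t +i* y)) (fun t => ux (t +i* y)) th th' x (duxx x y) (dux x y) (dth _)).
  by move=> z /out [_ ux0 _ uxx0 _]; rewrite ux0 uxx0 !mul0r addr0.
have Iy : disc_int (fun z => uyy z * th (u z) + uy z * (th' (u z) * uy z)) = 0.
  apply: (@disc_int_dy (fun z => uy z * th (u z))) => //.
    move=> x y; exact: (@is_derive_mul_comp (fun t => uy (x +i* t)) (fun t => uyy (x +i* t))
      (fun t => u (x +i* t)) (fun t => uy (x +i* t)) th th' y (duyy x y) (duy x y) (dth _)).
  by move=> z /out [_ _ uy0 _ uyy0]; rewrite uy0 uyy0 !mul0r addr0.
have -> : disc_int (fun z => L z * rho z * th (u z)) =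
  disc_int (fun z => 4^-1 * (ux z ^+ 2 * th' (u z) + uy z ^+ 2 * th' (u z)) -
    4^-1 * ((uxx z * th (u z) + ux z * (th' (u z) * ux z)) +
            (uyy z * th (u z) + uy z * (th' (u z) * uy z)))).
  by apply: eq_disc_int => z /LE ->; ring.
have csq f : rcont f -> rcont (fun z => f z ^+ 2).
  by move=> cf; under eq_fun do rewrite expr2; exact: rcontM.
have I1 : dintegrable (fun z => ux z ^+ 2 * th' (u z) + uy z ^+ 2 * th' (u z)).
  by apply: rcont_dintegrable; apply: rcontD; apply: rcontM => //; exact: csq.
have J1 := rcont_dintegrable cDx; have J2 := rcont_dintegrable cDy.
have J := dintegrableD J1 J2.
rewrite (disc_intB (dintegrableZ 4^-1 I1) (dintegrableZ 4^-1 J)).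
rewrite (disc_intZ 4^-1 I1) (disc_intZ 4^-1 J) (disc_intD J1 J2) Ix Iy.
rewrite addr0 mulr0 subr0 mulr_ge0 ?invr_ge0//.
apply: disc_int_ge0 => z _.
by apply: addr_ge0; apply: mulr_ge0; rewrite ?sqr_ge0 ?th'0.
Qed.

Lemma energy_id_ge0 u L : test_real u L -> 0 <= disc_int (fun z => L z * rho z * u z).
Proof.
move=> tu; apply: (@energy_ge0 u L id (fun=> 1)) => //.
by move=> s; exact: cst_continuous.
Qed.

Definition pos_part (c s : R) : R := Num.max 0 (s - c).

Lemma pos_part_lip (c s t : R) : `|pos_part c s - pos_part c t| <= `|s - t|.
Proof.
have := ler_norm (s - t); have := ler_norm (- (s - t)); have := normr_ge0 (s - t).
rewrite normrN /pos_part; move: `|s - t| => d d0 h1 h2.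
have [k1|k1] := leP 0 (s - c); have [k2|k2] := leP 0 (t - c);
  rewrite ler_norml; apply/andP; split; lra.
Qed.

(* A C^1 nondecreasing function at distance at most e from pos_part c. *)
Let smooth_pos (c e s : R) : R := 2^-1 * (Num.sqrt ((s - c) ^+ 2 + e ^+ 2) + (s - c)).

Let smooth_pos' (c e s : R) : R := 2^-1 * ((s - c) / Num.sqrt ((s - c) ^+ 2 + e ^+ 2) + 1).

Let base_gt0 (c e s : R) : 0 < e -> 0 < (s - c) ^+ 2 + e ^+ 2.
Proof. by move=> e0; rewrite ltr_wpDl ?sqr_ge0 ?exprn_gt0. Qed.

Let smooth_pos_close (c e s : R) : 0 < e -> `|smooth_pos c e s - pos_part c s| <= e.
Proof.
move=> e0; rewrite /smooth_pos /pos_part; move: (s - c) (base_gt0 c s e0) => a a0.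
set r := Num.sqrt _.
have r0 : 0 <= r by exact: sqrtr_ge0.
have r2 : r ^+ 2 = a ^+ 2 + e ^+ 2 by rewrite sqr_sqrtr// ltW.
have ra : `|a| <= r.
  rewrite -(@ler_sqr _ `|a|) ?nnegrE// real_normK ?num_real// r2 lerDl sqr_ge0//.
have re : r <= `|a| + e.
  rewrite -(@ler_sqr _ r) ?nnegrE ?addr_ge0 ?(ltW e0)// r2.
  by have := real_normK (num_real a) => <-; have := normr_ge0 a; move: (`|a|) => b; nra.
have [h|h] := leP 0 a.
  by move: ra re; rewrite ger0_norm// => ra re; rewrite ler_norml; apply/andP; split; lra.
by move: ra re; rewrite ltr0_norm// => ra re; rewrite ler_norml; apply/andP; split; lra.
Qed.

Let smooth_pos'_ge0 (c e s : R) : 0 < e -> 0 <= smooth_pos' c e s.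
Proof.
move=> e0; rewrite /smooth_pos'; move: (s - c) (base_gt0 c s e0) => a a0.
set r := Num.sqrt _.
have r0 : 0 < r by rewrite sqrtr_gt0.
have r2 : r ^+ 2 = a ^+ 2 + e ^+ 2 by rewrite sqr_sqrtr// ltW.
have ra : `|a| <= r.
  rewrite -(@ler_sqr _ `|a|) ?nnegrE ?(ltW r0)// real_normK ?num_real// r2 lerDl sqr_ge0//.
rewrite mulr_ge0 ?invr_ge0// -(divff (lt0r_neq0 r0)) -mulrDl divr_ge0 ?(ltW r0)//.
by move: ra; rewrite ler_norml => /andP[? ?]; lra.
Qed.

Let smooth_pos_derive (c e s : R) : 0 < e ->
  is_derive s 1 (smooth_pos c e) (smooth_pos' c e s).
Proof.
move=> e0.
have d1 : is_derive s 1 (fun s : R => (s - c) ^+ 2 + e ^+ 2) (2 * (s - c)).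
  by apply: is_derive_eq; rewrite /GRing.scale /=; ring.
have d2 := is_derive1_sqrt (base_gt0 c s e0).
have d3 := @is_derive1_comp _ Num.sqrt (fun s : R => (s - c) ^+ 2 + e ^+ 2) s _ _ d2 d1.
have d4 : is_derive s 1 (fun s : R => s - c) 1.
  by apply: is_derive_eq; rewrite subr0.
have d5 := is_deriveZ 2^-1 (is_deriveD d3 d4).
apply: is_derive_eq d5 _; rewrite /smooth_pos' /GRing.scale /=.
have : Num.sqrt ((s - c) ^+ 2 + e ^+ 2) != 0 by rewrite sqrtr_eq0 -ltNge base_gt0.
by move: (Num.sqrt _) => r r0; field.
Qed.

Let smooth_pos'_cont (c e : R) : 0 < e -> continuous (smooth_pos' c e).
Proof.
move=> e0 s; have b0 := base_gt0 c s e0.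
have c1 : {for s, continuous (fun s : R => (s - c) ^+ 2 + e ^+ 2)}.
  apply: (@is_derive_continuous _ _ _ (2 * (s - c))).
  by apply: is_derive_eq; rewrite /GRing.scale /=; ring.
have c2 : {for s, continuous (Num.sqrt \o (fun s : R => (s - c) ^+ 2 + e ^+ 2))}.
  by apply: continuous_comp => //; exact: sqrt_continuous.
have r0 : Num.sqrt ((s - c) ^+ 2 + e ^+ 2) != 0 by rewrite sqrtr_eq0 -ltNge.
apply: cvgM; first exact: cvg_cst.
apply: cvgD; last exact: cvg_cst.
apply: cvgM; first by apply: cvgB; [exact: cvg_id|exact: cvg_cst].
exact: cvgV.
Qed.

(** [pos_part c] is not C^1, so [energy_ge0] is applied to [smooth_pos]. The error is at most the
    uniform distance of the two times the L^1 norm [K] of [L rho], finite because the second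
    derivatives are continuous. *)
Lemma energy_pos_part_ge0 u L (c : R) : test_real u L ->
  0 <= disc_int (fun z => L z * rho z * pos_part c (u z)).
Proof.
move=> tu; have := tu => -[ux [uy [uxx [uyy [[cu _ _ cuxx cuyy] _ _ LE]]]]].
have cD : rcont (fun z => - 4^-1 * (uxx z + uyy z)).
  by apply: rcontM; [move=> z e e0; exists 1 => // h _; rewrite subrr normr0|exact: rcontD].
have IN : dintegrable (fun z => `|- 4^-1 * (uxx z + uyy z)|).
  by apply: rcont_dintegrable; apply: rcont_comp cD; exact: norm_continuous.
have cont_int th : continuous th -> dintegrable (fun z => - 4^-1 * (uxx z + uyy z) * th (u z)).
  by move=> cth; apply: rcont_dintegrable; apply: rcontM => //; exact: rcont_comp.
have eqL th : disc_int (fun z => L z * rho z * th (u z)) =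
    disc_int (fun z => - 4^-1 * (uxx z + uyy z) * th (u z)).
  by apply: eq_disc_int => z /LE ->; rewrite !mulNr.
have cpp : continuous (pos_part c).
  by move=> s; apply/cvgrPdist_lt => e e0; exists e => // t /=; exact/le_lt_trans/pos_part_lip.
pose K := disc_int (fun z => `|- 4^-1 * (uxx z + uyy z)|).
have K0 : 0 <= K by exact: disc_int_ge0.
apply/ler_addgt0Pr => e e0.
have d0 : 0 < e / (K + 1) by rewrite divr_gt0// ltr_wpDl.
have csp : continuous (smooth_pos c (e / (K + 1))).
  by move=> s; exact: (is_derive_continuous (@smooth_pos_derive c _ s d0)).
have := energy_ge0 tu (fun s => @smooth_pos_derive c _ s d0) (@smooth_pos'_cont c _ d0)
  (fun s => @smooth_pos'_ge0 c _ s d0).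
rewrite !eqL => H; apply: (le_trans H); rewrite -lerBlDl.
have I1 := cont_int _ csp; have I2 := cont_int _ cpp.
rewrite -(disc_intB I1 I2).
apply: (@le_trans _ _ (e / (K + 1) * K)).
  rewrite /K -disc_intZ//; apply: le_disc_int.
  - exact: dintegrableB.
  - exact: dintegrableZ.
  move=> z _; rewrite -mulrBr (le_trans (ler_norm _))// normrM mulrC.
  by rewrite ler_wpM2r// smooth_pos_close.
by rewrite mulrAC ler_pdivrMr ?ltr_wpDl// ler_pM2l//; lra.
Qed.

End Energy.

(** * The space L^2(D, rho d^2z) *)

Section WeightedL2.
Context {R : realType}.
Local Notation C := R[i].
Implicit Types (f g h u L : C -> R) (z w : C).

Definition dmeasurable f := measurable_fun (@disc_xy R) (f \o of_xy).

Lemma rcont_dmeasurable f : rcont f -> dmeasurable f.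
Proof. by move=> cf; apply: measurable_funS (rcont_measurable cf). Qed.

Lemma eq_dmeasurable f g : (forall z, unit_disc z -> f z = g z) ->
  dmeasurable f -> dmeasurable g.
Proof. by move=> fg; apply: eq_measurable_fun => p; rewrite inE => pD; exact: fg. Qed.

Lemma dmeasurableM f g : dmeasurable f -> dmeasurable g ->
  dmeasurable (fun z => f z * g z).
Proof. by move=> mf mg; exact: (measurable_funM mf mg). Qed.

Lemma dmeasurableD f g : dmeasurable f -> dmeasurable g ->
  dmeasurable (fun z => f z + g z).
Proof. by move=> mf mg; exact: (measurable_funD mf mg). Qed.

Lemma dmeasurable_cst (c : R) : dmeasurable (fun=> c).
Proof. exact: measurable_cst. Qed.

Lemma dmeasurableZ (c : R) f : dmeasurable f -> dmeasurable (fun z => c * f z).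
Proof. by apply: dmeasurableM; exact: dmeasurable_cst. Qed.

Lemma disc_gap_gt0 z : unit_disc z -> 0 < 1 - normc z ^+ 2.
Proof. by rewrite unit_discE subr_gt0 => z1; rewrite expr_lt1 ?normc_ge0. Qed.

Lemma rho_gt0 z : unit_disc z -> 0 < rho z.
Proof. by move=> /disc_gap_gt0 h; rewrite /rho divr_gt0// exprn_gt0. Qed.

Lemma dmeasurable_rho : dmeasurable rho.
Proof.
have cg : rcont (fun z : C => 1 + -1 * normc z ^+ 2).
  have cc (c : R) : rcont (fun _ : C => c).
    by move=> z e e0; exists 1 => // h _; rewrite subrr normr0.
  by apply: rcontD => //; apply: rcontM => //; exact: rcont_normc_sq.
have m1 : dmeasurable (fun z => (1 + -1 * normc z ^+ 2) `^ (-1)).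
  exact: (measurableT_comp (measurable_powR (-1)) (rcont_dmeasurable cg)).
apply: (eq_dmeasurable _ (dmeasurableM (dmeasurable_cst 4) (dmeasurableM m1 m1))).
move=> z /disc_gap_gt0 h; rewrite mulN1r powR_inv1 ?ltW//.
by rewrite /rho -expr2 exprVn.
Qed.

Lemma dintegrable_le f g : dmeasurable f -> dintegrable g ->
  (forall z, unit_disc z -> `|f z| <= g z) -> dintegrable f.
Proof.
move=> mf Ig fg; apply: (le_integrable measurable_disc _ _ Ig).
  exact/measurable_EFinP.
move=> p pD /=; rewrite lee_fin; apply: (le_trans (fg _ pD)); exact: ler_norm.
Qed.

Lemma eq_dintegrable f g : (forall z, unit_disc z -> f z = g z) ->
  dintegrable f -> dintegrable g.
Proof.
move=> fg; apply: eq_integrable; first exact: measurable_disc.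
by move=> p; rewrite inE => pD; rewrite /= fg.
Qed.

Definition rL2 f := dmeasurable f /\ dintegrable (fun z => f z ^+ 2 * rho z).

Definition ip f g := disc_int (fun z => f z * g z * rho z).

Definition nrm f := Num.sqrt (ip f f).

Lemma rL2_le f g : dmeasurable f -> rL2 g ->
  (forall z, unit_disc z -> `|f z| <= `|g z|) -> rL2 f.
Proof.
move=> mf [_ Ig] fg; split => //; apply: dintegrable_le Ig _.
  apply: dmeasurableM dmeasurable_rho.
  by under eq_fun do rewrite expr2; exact: dmeasurableM.
move=> z zD; have r0 := rho_gt0 zD.
rewrite normrM (gtr0_norm r0) ler_pM2r// normrX.
by rewrite -(real_normK (num_real (g z))) ler_sqr ?nnegrE// fg.
Qed.

Lemma ip_integrable f g : rL2 f -> rL2 g -> dintegrable (fun z => f z * g z * rho z).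
Proof.
move=> [mf If] [mg Ig]; apply: dintegrable_le (dintegrableD If Ig) _.
  by apply: dmeasurableM dmeasurable_rho; exact: dmeasurableM.
move=> z zD; have r0 := rho_gt0 zD.
rewrite normrM (gtr0_norm r0) -mulrDl ler_pM2r// normrM.
rewrite -(real_normK (num_real (f z))) -(real_normK (num_real (g z))).
by move: (`|f z|) (`|g z|) (normr_ge0 (f z)) (normr_ge0 (g z)) => a b a0 b0; nra.
Qed.

Lemma rL2Z (c : R) f : rL2 f -> rL2 (fun z => c * f z).
Proof.
move=> [mf If]; split; first exact: dmeasurableZ.
apply: eq_dintegrable (dintegrableZ (c ^+ 2) If) => z _; ring.
Qed.

Lemma rL2D f g : rL2 f -> rL2 g -> rL2 (fun z => f z + g z).
Proof.
move=> Lf Lg; have [mf If] := Lf; have [mg Ig] := Lg.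
split; first exact: dmeasurableD.
have I2 := dintegrableZ 2 (ip_integrable Lf Lg).
apply: eq_dintegrable (dintegrableD (dintegrableD If Ig) I2) => z _; ring.
Qed.

Lemma rL2B f g : rL2 f -> rL2 g -> rL2 (fun z => f z - g z).
Proof.
move=> Lf Lg; have := rL2D Lf (rL2Z (-1) Lg).
by under eq_fun do rewrite mulN1r.
Qed.

Lemma ipC f g : ip f g = ip g f.
Proof. by congr disc_int; apply/funext => z; rewrite [f z * _]mulrC. Qed.

Lemma ipDl f g h : rL2 f -> rL2 g -> rL2 h ->
  ip (fun z => f z + g z) h = ip f h + ip g h.
Proof.
move=> Lf Lg Lh; rewrite /ip -(disc_intD (ip_integrable Lf Lh) (ip_integrable Lg Lh)).
by congr disc_int; apply/funext => z; rewrite !mulrDl.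
Qed.

Lemma ipBl f g h : rL2 f -> rL2 g -> rL2 h ->
  ip (fun z => f z - g z) h = ip f h - ip g h.
Proof.
move=> Lf Lg Lh; rewrite /ip -(disc_intB (ip_integrable Lf Lh) (ip_integrable Lg Lh)).
by congr disc_int; apply/funext => z; rewrite !mulrBl.
Qed.

Lemma ipZl (c : R) f h : rL2 f -> rL2 h -> ip (fun z => c * f z) h = c * ip f h.
Proof.
move=> Lf Lh; rewrite /ip -(disc_intZ c (ip_integrable Lf Lh)).
by congr disc_int; apply/funext => z; rewrite !mulrA.
Qed.

Lemma ip_ge0 f g : (forall z, unit_disc z -> 0 <= f z * g z) -> 0 <= ip f g.
Proof.
by move=> fg; apply: disc_int_ge0 => z zD; rewrite mulr_ge0 ?fg// ltW// rho_gt0.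
Qed.

Lemma le_ip f f' g g' : rL2 f -> rL2 g -> rL2 f' -> rL2 g' ->
  (forall z, unit_disc z -> f z * g z <= f' z * g' z) -> ip f g <= ip f' g'.
Proof.
move=> Lf Lg Lf' Lg' H; apply: le_disc_int; [exact: ip_integrable..|].
by move=> z zD; rewrite ler_wpM2r ?H// ltW// rho_gt0.
Qed.

Lemma nrm_ge0 f : 0 <= nrm f. Proof. exact: sqrtr_ge0. Qed.

Lemma nrm_sq f : nrm f ^+ 2 = ip f f.
Proof. by rewrite sqr_sqrtr// ip_ge0// => z _; rewrite -expr2 sqr_ge0. Qed.

Lemma ip_CS f g : rL2 f -> rL2 g -> `|ip f g| <= nrm f * nrm g.
Proof.
move=> Lf Lg; rewrite -(@ler_sqr _ `|_|) ?nnegrE ?mulr_ge0 ?nrm_ge0//.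
rewrite exprMn !nrm_sq real_normK ?num_real//.
have quad t : 0 <= ip f f + 2 * t * ip f g + t ^+ 2 * ip g g.
  have Lt := rL2D Lf (rL2Z t Lg).
  have : 0 <= ip (fun z => f z + t * g z) (fun z => f z + t * g z).
    by apply: ip_ge0 => z _; rewrite -expr2 sqr_ge0.
  rewrite ipDl//; last exact: rL2Z.
  rewrite ![ip _ (fun z => f z + t * g z)]ipC !ipDl//; try exact: rL2Z.
  rewrite !ipZl//; try exact: rL2Z.
  rewrite [ip f (fun z => t * g z)]ipC ![ip g (fun z => t * g z)]ipC !ipZl// (ipC g f).
  move=> H; apply: (le_trans H); rewrite le_eqVlt; apply/orP; left; apply/eqP; ring.
have g0 : 0 <= ip g g by apply: ip_ge0 => z _; rewrite -expr2 sqr_ge0.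
have [gg|gg] := eqVneq (ip g g) 0.
  rewrite gg mulr0; have [->|fg] := eqVneq (ip f g) 0; first by rewrite expr0n.
  (* The quadratic is affine here; this argument gives it the value -1, a contradiction. *)
  have := quad (- (ip f f + 1) / (2 * ip f g)); rewrite gg mulr0 addr0.
  have -> : 2 * (- (ip f f + 1) / (2 * ip f g)) * ip f g = - (ip f f + 1) by field.
  by lra.
have {}g0 : 0 < ip g g by rewrite lt_neqAle eq_sym gg.
have := quad (- ip f g / ip g g).
have -> : ip f f + 2 * (- ip f g / ip g g) * ip f g + (- ip f g / ip g g) ^+ 2 * ip g g =
  ip f f - ip f g ^+ 2 / ip g g by field.
by rewrite subr_ge0 ler_pdivrMr.
Qed.

Lemma nrm_triangle f g : rL2 f -> rL2 g -> nrm (fun z => f z + g z) <= nrm f + nrm g.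
Proof.
move=> Lf Lg; rewrite -(@ler_sqr _ (nrm _)) ?nnegrE ?addr_ge0 ?nrm_ge0//.
have Ls := rL2D Lf Lg.
rewrite nrm_sq ipDl// [ip f _]ipC [ip g (fun z => _)]ipC !ipDl// (ipC g f).
have := ip_CS Lf Lg; have := ler_norm (ip f g).
rewrite -!nrm_sq; move=> h1 h2.
have -> : (nrm f + nrm g) ^+ 2 = nrm f ^+ 2 + 2 * (nrm f * nrm g) + nrm g ^+ 2 by ring.
lra.
Qed.

Lemma nrmZ (c : R) f : rL2 f -> nrm (fun z => c * f z) = `|c| * nrm f.
Proof.
move=> Lf; rewrite /nrm ipZl//; last exact: rL2Z.
rewrite ipC ipZl// mulrA -expr2 sqrtrM ?sqr_ge0// sqrtr_sqr//.
Qed.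

Lemma le_nrm f g : rL2 f -> rL2 g -> (forall z, unit_disc z -> `|f z| <= `|g z|) ->
  nrm f <= nrm g.
Proof.
move=> Lf Lg fg; rewrite ler_wsqrtr// le_ip// => z /fg h.
rewrite -!expr2 -(real_normK (num_real (f z))) -(real_normK (num_real (g z))).
by rewrite ler_sqr ?nnegrE.
Qed.

(** Stands in for vanishing almost everywhere, [nrm] being only a seminorm on functions. *)
Lemma nrm0_ip f g : rL2 f -> rL2 g -> nrm f = 0 -> ip f g = 0.
Proof.
by move=> Lf Lg f0; have := ip_CS Lf Lg; rewrite f0 mul0r normr_le0 => /eqP.
Qed.

End WeightedL2.

(** * Maximum principle and uniqueness for Delta + 1/2 *)

Section RealLaplace.
Context {R : realType}.
Local Notation C := R[i].
Implicit Types (f g h u L : C -> R) (z w : C).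

(** Real counterpart of [Laplace_Beltrami] with C^2 approximants, a class that contains the real and
    imaginary parts of test functions and is closed under differences. *)
Definition Laplace_real u g := [/\ rL2 u, rL2 g & forall e : R, 0 < e -> exists phi L,
  [/\ test_real phi L, rL2 phi, rL2 L, nrm (fun z => phi z - u z) < e &
      nrm (fun z => L z - g z) < e]].

Let test_ip_ge0 L (th : C -> R) : 0 <= disc_int (fun z => L z * rho z * th z) ->
  0 <= ip L th.
Proof.
by rewrite /ip; under eq_fun do rewrite mulrAC.
Qed.

Lemma Laplace_real_positive u g : Laplace_real u g -> 0 <= ip g u.
Proof.
move=> [Lu Lg H]; apply/ler_addgt0Pl => e0 e00.
(* Replacing [L] by [g] costs at most e (|u| + 1), as |phi| <= |u| + 1, and replacing [phi] by [u]
   costs at most e |g|. *)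
pose K := nrm u + 1 + nrm g.
have K0 : 0 < K by rewrite /K ltr_wpDr ?nrm_ge0// ltr_wpDl ?nrm_ge0.
pose e := Num.min 1 (e0 / K).
have ep : 0 < e by rewrite lt_min ltr01 divr_gt0.
have e1 : e <= 1 by rewrite ge_min lexx.
have eK : e * K <= e0 by rewrite -ler_pdivlMr// ge_min lexx orbT.
have [phi [L [tp Lp LL d1 d2]]] := H _ ep.
have Ldp := rL2B Lp Lu; have LdL := rL2B LL Lg.
have p0 := test_ip_ge0 (energy_id_ge0 tp).
have E1 := ipBl LL Lg Lp; have E2 := ipBl Lp Lu Lg.
rewrite [ip phi g]ipC [ip u g]ipC in E2.
have b1 := ip_CS LdL Lp; have b2 := ip_CS Ldp Lg.
have b3 : nrm phi <= nrm u + e.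
  have := nrm_triangle Ldp Lu; under [X in nrm X <= _]eq_fun do rewrite subrK.
  by move/le_trans; apply; rewrite addrC lerD2l ltW.
have c1 : `|ip (fun z => L z - g z) phi| <= e * (nrm u + 1).
  apply: (le_trans b1); apply: ler_pM; rewrite ?nrm_ge0 ?(ltW d2)//.
  by apply: (le_trans b3); rewrite lerD2l.
have c2 : `|ip (fun z => phi z - u z) g| <= e * nrm g.
  by apply: (le_trans b2); rewrite ler_wpM2r ?nrm_ge0// ltW.
have E3 : e * K = e * (nrm u + 1) + e * nrm g by rewrite /K; ring.
move: c1 c2; rewrite !ler_norml => /andP[_ c1] /andP[_ c2]; lra.
Qed.

Lemma dmeasurable_pos_part (c : R) u : dmeasurable u -> dmeasurable (fun z => pos_part c (u z)).
Proof.
move=> mu; apply: measurable_maxr; first exact: measurable_cst.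
exact: (dmeasurableD mu (dmeasurable_cst (- c))).
Qed.

Lemma pos_part_le (c s : R) : 0 <= c -> `|pos_part c s| <= `|s|.
Proof.
move=> c0; rewrite /pos_part; have [h|h] := leP 0 (s - c); last by rewrite normr0.
by rewrite !ger0_norm; lra.
Qed.

(** The hyperbolic area is infinite, so nonzero constants are not in L^2; for c >= 0 the truncation
    is dominated by |u|. *)
Lemma rL2_pos_part (c : R) u : 0 <= c -> rL2 u -> rL2 (fun z => pos_part c (u z)).
Proof.
move=> c0 Lu; apply: (rL2_le _ Lu); first by apply: dmeasurable_pos_part; case: Lu.
by move=> z _; exact: pos_part_le.
Qed.

(* Testing the equation of an approximant phi against w = (phi - 2M)_+ gives
   |w|^2 / 2 <= <L phi + phi / 2 - f, w>, which tends to 0. *)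
Lemma Laplace_real_max u f (M : R) : rL2 f -> 0 <= M -> (forall z, unit_disc z -> f z <= M) ->
  Laplace_real u (fun z => f z - 2^-1 * u z) -> nrm (fun z => pos_part (2 * M) (u z)) = 0.
Proof.
move=> Lf M0 fM [Lu Lg H]; apply/eqP; rewrite eq_le nrm_ge0 andbT.
apply/ler_addgt0Pl => e0 e00; rewrite addr0.
have c0 : 0 <= 2 * M by rewrite mulr_ge0.
have e40 : 0 < e0 / 4 by rewrite divr_gt0.
have [phi [L [tp Lp LL d1 d2]]] := H _ e40.
set e := e0 / 4 in d1 d2 e40.
pose w z := pos_part (2 * M) (phi z).
have Lw : rL2 w by exact: rL2_pos_part.
have Lup : rL2 (fun z => pos_part (2 * M) (u z)) by exact: rL2_pos_part.
have Ldp := rL2B Lp Lu; have LdL := rL2B LL Lg.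
have p0 := test_ip_ge0 (energy_pos_part_ge0 (2 * M) tp).
have Lh := rL2B (rL2Z 2^-1 Lp) Lf.
(* Where w > 0, phi / 2 - f >= phi / 2 - M = w / 2. *)
have half : 2^-1 * ip w w <= ip (fun z => 2^-1 * phi z - f z) w.
  rewrite -ipZl//; apply: le_ip => //; first exact: rL2Z.
  move=> z /fM fz; rewrite /w /pos_part.
  have [k|k] := leP 0 (phi z - 2 * M); last by rewrite !mulr0.
  by rewrite ler_wpM2r//; lra.
have split_h : ip (fun z => 2^-1 * phi z - f z) w + ip L w =
    ip (fun z => L z - (f z - 2^-1 * u z)) w + 2^-1 * ip (fun z => phi z - u z) w.
  rewrite -(ipZl 2^-1 Ldp Lw) -(ipDl Lh LL Lw) -(ipDl LdL (rL2Z 2^-1 Ldp) Lw).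
  by congr ip; apply/funext => z; ring.
have b1 := ip_CS LdL Lw; have b2 := ip_CS Ldp Lw.
have w0 := nrm_ge0 w.
have c1 : `|ip (fun z => L z - (f z - 2^-1 * u z)) w| <= e * nrm w.
  by apply: (le_trans b1); rewrite ler_wpM2r// ltW.
have c2 : `|ip (fun z => phi z - u z) w| <= e * nrm w.
  by apply: (le_trans b2); rewrite ler_wpM2r// ltW.
(* From |w|^2 / 2 <= e |w| + e |w| / 2. Passing from [phi] back to [u] costs one more [e], whence
   the quarter of [e0]. *)
have nw : nrm w <= 3 * e.
  move: half p0 split_h c1 c2; rewrite -nrm_sq -/w !ler_norml => half p0 sh.
  move=> /andP[_ c1] /andP[_ c2].
  have {}c1 : nrm w ^+ 2 <= 3 * e * nrm w by lra.
  have [->|wn] := eqVneq (nrm w) 0; first by rewrite mulr_ge0// ltW.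
  by move: c1; rewrite expr2 ler_pM2r// lt_neqAle eq_sym wn.
have Ld := rL2B Lup Lw.
have := nrm_triangle Ld Lw; under [X in nrm X <= _]eq_fun do rewrite subrK.
move/le_trans; apply.
have -> : e0 = e + 3 * e by rewrite /e; field.
apply: lerD => //; apply: (@le_trans _ _ (nrm (fun z => phi z - u z))); last exact: ltW.
by apply: le_nrm => // z _; rewrite /w [in leRHS]distrC; exact: pos_part_lip.
Qed.

Lemma test_realB u u' L L' : test_real u L -> test_real u' L' ->
  test_real (fun z => u z - u' z) (fun z => L z - L' z).
Proof.
move=> [ux [uy [uxx [uyy [[cu cux cuy cuxx cuyy] [dux duy duxx duyy] out LE]]]]].
move=> [vx [vy [vxx [vyy [[cv cvx cvy cvxx cvyy] [dvx dvy dvxx dvyy] out' LE']]]]].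
have cB (f g : C -> R) : rcont f -> rcont g -> rcont (fun z => f z - g z).
  have c1 : rcont (fun _ : C => -1 : R).
    by move=> z e e0; exists 1 => // h _; rewrite subrr normr0.
  by move=> cf cg; have := rcontD cf (rcontM c1 cg); under eq_fun do rewrite mulN1r.
have dxB (f f' g g' : C -> R) : dx_slice f f' -> dx_slice g g' ->
    dx_slice (fun z => f z - g z) (fun z => f' z - g' z).
  by move=> df dg x y; have := df x y; have := dg x y => ? ?; exact: is_deriveB.
have dyB (f f' g g' : C -> R) : dy_slice f f' -> dy_slice g g' ->
    dy_slice (fun z => f z - g z) (fun z => f' z - g' z).
  by move=> df dg x y; have := df x y; have := dg x y => ? ?; exact: is_deriveB.
exists (fun z => ux z - vx z), (fun z => uy z - vy z), (fun z => uxx z - vxx z),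
  (fun z => uyy z - vyy z); split.
- by split; exact: cB.
- by split; [exact: dxB|exact: dyB|exact: dxB|exact: dyB].
- by move=> z z1; have [-> -> -> -> ->] := out z z1;
    have [-> -> -> -> ->] := out' z z1; rewrite !subrr.
- by move=> z zD; rewrite mulrBl LE// LE'//; ring.
Qed.

Lemma Laplace_realB u u' g g' : Laplace_real u g -> Laplace_real u' g' ->
  Laplace_real (fun z => u z - u' z) (fun z => g z - g' z).
Proof.
move=> [Lu Lg H] [Lu' Lg' H']; split; [exact: rL2B|exact: rL2B|move=> e e0].
have e20 : 0 < e / 2 by rewrite divr_gt0.
have [phi [L [tp Lp LL d1 d2]]] := H _ e20.
have [phi' [L' [tp' Lp' LL' d1' d2']]] := H' _ e20.
have nB (f f' k k' : C -> R) : rL2 f -> rL2 f' -> rL2 k -> rL2 k' ->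
    nrm (fun z => f z - k z) < e / 2 -> nrm (fun z => f' z - k' z) < e / 2 ->
    nrm (fun z => f z - f' z - (k z - k' z)) < e.
  move=> Lf Lf' Lk Lk' h h'.
  have LB := rL2B Lf' Lk'.
  have := nrm_triangle (rL2B Lf Lk) (rL2Z (-1) LB); rewrite nrmZ// normrN normr1 mul1r.
  have -> : (fun z => f z - k z + -1 * (f' z - k' z)) = (fun z => f z - f' z - (k z - k' z)).
    by apply/funext => z; ring.
  by move/le_lt_trans; apply; rewrite [e]splitr ltrD.
exists (fun z => phi z - phi' z), (fun z => L z - L' z); split.
- exact: test_realB.
- exact: rL2B.
- exact: rL2B.
- exact: nB.
- exact: nB.
Qed.

Lemma Laplace_real0 : Laplace_real (fun=> 0) (fun=> 0).
Proof.
have r0 : rL2 (fun _ : C => 0 : R).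
  split; first exact: dmeasurable_cst.
  under eq_fun do rewrite expr0n mul0r.
  by apply: rcont_dintegrable => z e e0; exists 1 => // h _; rewrite subrr normr0.
have c0 : rcont (fun _ : C => 0 : R).
  by move=> z e e0; exists 1 => // h _; rewrite subrr normr0.
split=> // e e0; exists (fun=> 0), (fun=> 0); split=> //.
- exists (fun=> 0), (fun=> 0), (fun=> 0), (fun=> 0); split=> //.
  + by split=> x y; exact: is_derive_cst.
  + by move=> z _; rewrite mul0r addr0 mulr0 oppr0.
- by rewrite /nrm /ip subr0 mul0r; under eq_fun do rewrite mul0r;
    rewrite /disc_int /Rintegral integral0 sqrtr0.
- by rewrite /nrm /ip subr0 mul0r; under eq_fun do rewrite mul0r;
    rewrite /disc_int /Rintegral integral0 sqrtr0.
Qed.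

Lemma Laplace_real_ext u u' g g' : (forall z, u z = u' z) -> (forall z, g z = g' z) ->
  Laplace_real u g -> Laplace_real u' g'.
Proof. by move=> /funext -> /funext ->. Qed.

Lemma Laplace_realN u g : Laplace_real u g -> Laplace_real (fun z => - u z) (fun z => - g z).
Proof. by move=> /(Laplace_realB Laplace_real0); apply: Laplace_real_ext => z; rewrite sub0r. Qed.

Lemma rL2_normr h : rL2 h -> rL2 (fun z => `|h z|).
Proof.
move=> Lh; apply: (rL2_le _ Lh) => [|z _]; last by rewrite normr_id.
by have [mh _] := Lh; exact: (measurableT_comp (@normr_measurable R setT) mh).
Qed.

(** Pointwise, u h is at most |h| times 2 M + (u - 2 M)_+ + (- u - 2 M)_+, and the maximum principle
    for u and for - u makes the last two terms integrate to 0. *)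
Lemma Laplace_real_bound u f h (M : R) : rL2 f -> 0 <= M ->
  (forall z, unit_disc z -> `|f z| <= M) ->
  Laplace_real u (fun z => f z - 2^-1 * u z) -> rL2 h -> dintegrable (fun z => `|h z| * rho z) ->
  ip u h <= 2 * M * disc_int (fun z => `|h z| * rho z).
Proof.
move=> Lf M0 fM Hu Lh Ih; have [Lu _ _] := Hu.
have HuN : Laplace_real (fun z => - u z) (fun z => - f z - 2^-1 * - u z).
  by apply: Laplace_real_ext (Laplace_realN Hu) => // z; rewrite mulrN opprB opprK addrC.
have fM1 z : unit_disc z -> f z <= M by move=> /fM; exact/le_trans/ler_norm.
have fM2 z : unit_disc z -> - f z <= M.
  by move=> /fM; apply/le_trans; rewrite -normrN ler_norm.
have LfN : rL2 (fun z => - f z).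
  by have := rL2Z (-1) Lf; under eq_fun do rewrite mulN1r.
have [LuN _ _] := HuN; have c0 : 0 <= 2 * M by rewrite mulr_ge0.
have La := rL2_normr Lh.
have Lup := rL2_pos_part c0 Lu; have Lum := rL2_pos_part c0 LuN.
have E1 := nrm0_ip Lup La (Laplace_real_max Lf M0 fM1 Hu).
have E2 := nrm0_ip Lum La (Laplace_real_max LfN M0 fM2 HuN).
rewrite -[leRHS]addr0 -[X in _ + X]addr0 -{1}E1 -E2 -(disc_intZ _ Ih).
have I1 := dintegrableZ (2 * M) Ih.
have I2 := ip_integrable Lup La; have I3 := ip_integrable Lum La.
rewrite -(disc_intD I2 I3) -(disc_intD I1 (dintegrableD I2 I3)).
apply: le_disc_int; first exact: ip_integrable.
  by apply: dintegrableD => //; exact: dintegrableD.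
move=> z zD.
have -> : 2 * M * (`|h z| * rho z) + (pos_part (2 * M) (u z) * `|h z| * rho z +
    pos_part (2 * M) (- u z) * `|h z| * rho z) =
  (2 * M + (pos_part (2 * M) (u z) + pos_part (2 * M) (- u z))) * `|h z| * rho z by ring.
apply: ler_wpM2r; first by rewrite ltW// rho_gt0.
apply: (le_trans (ler_norm _)); rewrite normrM; apply: ler_wpM2r => //.
rewrite /pos_part; move: (u z) => t.
have [k1|k1] := leP 0 (t - 2 * M); have [k2|k2] := leP 0 (- t - 2 * M);
  rewrite ler_norml; apply/andP; split; lra.
Qed.

(** The difference d satisfies Delta d = - d / 2, so positivity of Delta forces |d| = 0. *)
Lemma Laplace_real_unique u u' f f' h : (forall z, unit_disc z -> f z = f' z) ->
  Laplace_real u (fun z => f z - 2^-1 * u z) -> Laplace_real u' (fun z => f' z - 2^-1 * u' z) ->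
  rL2 h -> ip u h = ip u' h.
Proof.
move=> ff' Hu Hu' Lh; have [Lu _ _] := Hu; have [Lu' _ _] := Hu'.
have HB := Laplace_realB Hu Hu'; have [Ld _ _] := HB.
have := Laplace_real_positive HB; set d := fun z => u z - u' z in Ld *.
have -> : ip (fun z => f z - 2^-1 * u z - (f' z - 2^-1 * u' z)) d = - 2^-1 * ip d d.
  rewrite -(ipZl _ Ld Ld); apply: eq_disc_int => z /ff' ->; rewrite /d; ring.
rewrite -nrm_sq => d0.
have {}d0 : nrm d = 0 by have := sqr_ge0 (nrm d) => ?; apply/eqP; rewrite -sqrf_eq0; apply/eqP; lra.
by apply/eqP; rewrite -subr_eq0 -(ipBl Lu Lu' Lh); apply/eqP; exact: nrm0_ip.
Qed.

End RealLaplace.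

(** * From complex test functions to real functions *)

Section ComplexLaplace.
Context {R : realType}.
Local Notation C := R[i].
Implicit Types (f U phi q : C -> C) (z w v : C).

Lemma part_le (part : C -> R) z : is_part part -> `|part z| <= normc z.
Proof. by case=> ->; [exact: Re_normc|exact: Im_normc]. Qed.

Lemma L2_dmeasurable (part : C -> R) f : is_part part -> L2 f -> dmeasurable (part \o f).
Proof. by case=> -> []. Qed.

Lemma L2_normc_dintegrable f : L2 f -> dintegrable (fun z => normc (f z) ^+ 2 * rho z).
Proof.
move=> [mRe mIm ff]; apply/integrableP; split.
  apply/measurable_EFinP.
  have -> : (fun z => normc (f z) ^+ 2 * rho z) = (fun z =>
    (complex.Re (f z) * complex.Re (f z) + complex.Im (f z) * complex.Im (f z)) * rho z).
    by apply/funext => z; rewrite normc_sqE !expr2.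
  apply: dmeasurableM dmeasurable_rho.
  apply: dmeasurableD; apply: dmeasurableM; [exact: mRe|exact: mRe|exact: mIm|exact: mIm].
apply: le_lt_trans ff; rewrite /L2_sqnorm /area_integral le_eqVlt; apply/orP; left.
apply/eqP; apply: eq_integral => p; rewrite inE => pD.
by rewrite /= ger0_norm// mulr_ge0 ?sqr_ge0// ltW// rho_gt0.
Qed.

Lemma L2_rL2 (part : C -> R) f : is_part part -> L2 f -> rL2 (part \o f).
Proof.
move=> hp Lf; have mf := L2_dmeasurable hp Lf; split=> //.
apply: dintegrable_le (L2_normc_dintegrable Lf) _.
  apply: dmeasurableM dmeasurable_rho.
  by under eq_fun do rewrite expr2; exact: dmeasurableM.
move=> z zD; have r0 := rho_gt0 zD.
rewrite normrM (gtr0_norm r0) ler_pM2r// normrX ler_sqr ?nnegrE ?normc_ge0//.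
exact: (part_le (f z) hp).
Qed.

Lemma L2_sqnormE f : L2 f ->
  L2_sqnorm f = (disc_int (fun z => normc (f z) ^+ 2 * rho z))%:E.
Proof.
move=> Lf; have If := L2_normc_dintegrable Lf.
rewrite /disc_int /Rintegral fineK//.
by apply: integrable_fin_num If; exact: measurable_disc.
Qed.

Lemma L2_nrm_lt (part : C -> R) f (e : R) : is_part part -> 0 < e -> L2 f ->
  (L2_sqnorm f < (e ^+ 2)%:E)%E -> nrm (part \o f) < e.
Proof.
move=> hp e0 Lf; rewrite L2_sqnormE// lte_fin => fe.
rewrite -(@ltr_sqr _ (nrm _)) ?nnegrE ?nrm_ge0 ?(ltW e0)// nrm_sq.
have Lp := L2_rL2 hp Lf.
apply: le_lt_trans fe; apply: le_disc_int.
- exact: ip_integrable.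
- exact: L2_normc_dintegrable.
move=> z zD; rewrite ler_wpM2r//; first by rewrite ltW// rho_gt0.
rewrite -expr2 -(real_normK (num_real (part _))) ler_sqr ?nnegrE ?normc_ge0//.
exact: (part_le (f z) hp).
Qed.

(** On the disc [L] is a continuous function divided by [rho]. *)
Lemma test_real_dmeasurable (u L : C -> R) : test_real u L -> dmeasurable u /\ dmeasurable L.
Proof.
move=> [ux [uy [uxx [uyy [[cu _ _ cuxx cuyy] _ _ LE]]]]].
split; first exact: rcont_dmeasurable.
have mr : dmeasurable (fun z => (rho z)^-1).
  have mg : dmeasurable (fun z : C => 1 + -1 * normc z ^+ 2).
    apply: dmeasurableD; first exact: dmeasurable_cst.
    by apply: dmeasurableZ; apply: rcont_dmeasurable; exact: rcont_normc_sq.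
  apply: (eq_dmeasurable _ (dmeasurableZ 4^-1 (dmeasurableM mg mg))) => z _.
  by rewrite /rho invf_div mulN1r expr2 mulrC.
have mD : dmeasurable (fun z => -1 * (4^-1 * (uxx z + uyy z))).
  by do 2 apply: dmeasurableZ; apply: rcont_dmeasurable; exact: rcontD.
apply: (eq_dmeasurable _ (dmeasurableM mD mr)) => z zD.
by rewrite mulN1r -(LE z zD) mulfK// gt_eqF// rho_gt0.
Qed.

Lemma L2_sub f q : (forall part, is_part part -> dmeasurable (part \o f)) -> L2 q ->
  (L2_sqnorm (fun z => f z - q z)%R < +oo)%E -> L2 (fun z => f z - q z).
Proof.
move=> mf Lq fin; split=> //.
- have := dmeasurableD (mf _ (or_introl erefl)) (dmeasurableZ (-1) (L2_dmeasurable (or_introl erefl) Lq)).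
  apply: (@eq_dmeasurable _ _ (fun z => complex.Re (f z - q z))) => z _ /=.
  rewrite mulN1r.
  by case: (f z) (q z) => [a b] [c d].
- have := dmeasurableD (mf _ (or_intror erefl)) (dmeasurableZ (-1) (L2_dmeasurable (or_intror erefl) Lq)).
  apply: (@eq_dmeasurable _ _ (fun z => complex.Im (f z - q z))) => z _ /=.
  rewrite mulN1r.
  by case: (f z) (q z) => [a b] [c d].
Qed.

(** That [phi] and its Laplacian have parts in L^2 is deduced from measurability and from their
    finite distance to [U] and [q], by adding the limits back. *)
Lemma Laplace_Beltrami_real (part : C -> R) U q : is_part part ->
  Laplace_Beltrami U q -> Laplace_real (part \o U) (part \o q).
Proof.
move=> hp [LU Lq H]; split; [exact: L2_rL2|exact: L2_rL2|move=> e e0].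
have [phi [tphi d1 d2]] := H _ (exprn_gt0 2 e0).
have mphi part' (hp' : is_part part') := test_real_dmeasurable (test_function_real hp' tphi).
have LdU : L2 (fun z => phi z - U z).
  apply: L2_sub => //; first by move=> part' /mphi [].
  exact: lt_trans d1 (ltry _).
have Ldq : L2 (fun z => laplacian phi z - q z).
  apply: L2_sub => //; first by move=> part' /mphi [].
  exact: lt_trans d2 (ltry _).
have EU : part \o (fun z => phi z - U z) = (fun z => (part \o phi) z - (part \o U) z).
  by apply/funext => z; exact: partB.
have Eq : part \o (fun z => laplacian phi z - q z) =
    (fun z => (part \o laplacian phi) z - (part \o q) z).
  by apply/funext => z; exact: partB.
exists (part \o phi), (part \o laplacian phi); split.
- exact: test_function_real.
- have := rL2D (L2_rL2 hp LdU) (L2_rL2 hp LU); rewrite EU.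
  by under eq_fun do rewrite subrK.
- have := rL2D (L2_rL2 hp Ldq) (L2_rL2 hp Lq); rewrite Eq.
  by under eq_fun do rewrite subrK.
- by rewrite -EU; exact: L2_nrm_lt d1.
- by rewrite -Eq; exact: L2_nrm_lt d2.
Qed.

Let cj f : C -> C := fun z => (f z)^*%C.

Let derive1_opp (h : R -> R) (x : R) : derivable h x 1 ->
  derive1 (fun t => - h t) x = - derive1 h x.
Proof. by move=> dh; rewrite !derive1E; exact: deriveN. Qed.

Let real_partial_conj phi v z : real_derivable phi z v ->
  real_partial v (cj phi) z = (real_partial v phi z)^*%C.
Proof.
move=> [dRe dIm]; rewrite /real_partial /=; congr (_ +i* _).
  by congr (derive1 _ 0); apply/funext => t; rewrite /real_slice Re_conjc.
rewrite -(derive1_opp dIm); congr (derive1 _ 0); apply/funext => t.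
by rewrite /real_slice /cj; case: (phi _).
Qed.

Let real_derivable_conj phi v z : real_derivable phi z v -> real_derivable (cj phi) z v.
Proof.
move=> [dRe dIm]; split.
  rewrite (_ : (fun t => _) = (fun t => complex.Re (real_slice phi z v t)))//.
  by apply/funext => t; rewrite /real_slice Re_conjc.
rewrite (_ : (fun t => _) = - (fun t => complex.Im (real_slice phi z v t))).
  exact: derivableN.
apply/funext => t; rewrite -[RHS]/(- complex.Im (real_slice phi z v t)).
by rewrite /real_slice /cj; case: (phi _).
Qed.

Let iter_partial_conj phi (w : seq bool) : smooth phi ->
  iter_partial w (cj phi) = cj (iter_partial w phi).
Proof.
move=> sphi; elim: w => [//|b w ih]; apply/funext => z /=.
rewrite -/(iter_partial w (cj phi)) ih; apply: real_partial_conj.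
by have [_ /(_ z) []] := sphi w; case: b.
Qed.

Let continuous_conj q : continuous (q : C^o -> C^o) -> continuous (cj q : C^o -> C^o).
Proof.
move=> cq z.
apply/(@cvgrPdist_lt _ C^o _ _ (nbhs_filter (z : C^o))) => e e0; have /cvgrPdist_lt := cq z.
move=> /(_ _ e0) [d d0 Hd]; exists d => // t /Hd.
by rewrite /= /cj !normc_normE -rmorphB normc_conj.
Qed.

Let smooth_conj phi : smooth phi -> smooth (cj phi).
Proof.
move=> sphi w; rewrite iter_partial_conj//; have [cw dw] := sphi w; split.
  exact: continuous_conj.
by move=> z; have [d1 d2] := dw z; split; exact: real_derivable_conj.
Qed.

Let laplacian_conj phi z : smooth phi -> laplacian (cj phi) z = (laplacian phi z)^*%C.
Proof.
move=> sphi; rewrite (laplacianE (smooth_conj sphi)) (laplacianE sphi).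
have E1 : real_partial 1 (real_partial 1 (cj phi)) z =
    (real_partial 1 (real_partial 1 phi) z)^*%C.
  exact: (congr1 (fun F => F z) (iter_partial_conj [:: true; true] sphi)).
have E2 : real_partial (0 +i* 1) (real_partial (0 +i* 1) (cj phi)) z =
    (real_partial (0 +i* 1) (real_partial (0 +i* 1) phi) z)^*%C.
  exact: (congr1 (fun F => F z) (iter_partial_conj [:: false; false] sphi)).
rewrite E1 E2.
have four := invnC 4.
have conjZ (k : R) c : (k%:C * c)^*%C = k%:C * c^*%C.
  by case: c => a b /=; congr (_ +i* _); ring.
have conjD (c d : C) : (c + d)^*%C = c^*%C + d^*%C by exact: rmorphD.
have neg : - ((rho z)^-1)%:C = (- (rho z)^-1)%:C :> C by rewrite rmorphN.
rewrite four neg; move: (real_partial 1 (real_partial 1 phi) z).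
move: (real_partial (0 +i* 1) (real_partial (0 +i* 1) phi) z) => Y X.
transitivity ((- (rho z)^-1)%:C * ((4^-1 : R)%:C * (X + Y))^*%C); last first.
  by symmetry; exact: conjZ.
congr (_ * _); transitivity ((4^-1 : R)%:C * (X + Y)^*%C); last first.
  by symmetry; exact: conjZ.
by congr (_ * _); symmetry; exact: conjD.
Qed.

Let L2_sqnorm_conj f : L2_sqnorm (cj f) = L2_sqnorm f.
Proof. by apply: eq_integral => p _; rewrite /cj normc_conj. Qed.

Let L2_conj f : L2 f -> L2 (cj f).
Proof.
move=> Lf; have [mRe mIm ff] := Lf; split; last by rewrite L2_sqnorm_conj.
  by under eq_fun do rewrite Re_conjc.
have := dmeasurableZ (-1) (L2_dmeasurable (or_intror erefl) Lf).
apply: (@eq_dmeasurable _ _ (fun z => complex.Im (cj f z))) => z _.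
by rewrite /cj mulN1r /=; case: (f z).
Qed.

Let test_function_conj phi : test_function phi -> test_function (cj phi).
Proof.
move=> [sphi [r r1 phi0]]; split; first exact: smooth_conj.
by exists r => // z /phi0 pz; rewrite /cj pz conjc0.
Qed.

(** Conjugates of test functions are test functions and the Laplacian commutes with conjugation. The
    complex form matters because solvability of the complex equation decides whether [resolvent]
    takes its default value. *)
Lemma Laplace_Beltrami_conj U q : Laplace_Beltrami U q ->
  Laplace_Beltrami (fun z => (U z)^*%C) (fun z => (q z)^*%C).
Proof.
move=> [LU Lq H]; split; [exact: L2_conj|exact: L2_conj|move=> e /H [phi [tp d1 d2]]].
exists (cj phi); split; first exact: test_function_conj.
  rewrite -L2_sqnorm_conj in d1; move: d1; congr (L2_sqnorm _ < _)%E.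
  by apply/funext => z; rewrite /cj; exact: rmorphB.
rewrite -L2_sqnorm_conj in d2; move: d2; congr (L2_sqnorm _ < _)%E.
apply/funext => z; rewrite laplacian_conj; last by case: tp.
by rewrite /cj; exact: rmorphB.
Qed.

End ComplexLaplace.

(** * Curvature *)

Section Curvature.
Context {R : realType}.
Local Notation C := R[i].
Implicit Types (f nu q : C -> C) (h : C -> R) (z w : C).

Definition curv_bound : R := 3 / (4 * pi).

Lemma curv_bound_ge0 : 0 <= curv_bound.
Proof. by rewrite divr_ge0// mulr_ge0// pi_ge0. Qed.

Lemma holomorphic_dmeasurable (part : C -> R) q : is_part part -> holomorphic_on_disc q ->
  dmeasurable (part \o q).
Proof.
move=> hp hq; apply: cont_on_measurable => [|z e zD e0]; first exact: measurable_disc.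
move: zD; rewrite unit_discE => z1.
have [A /wirtinger_cont cq] := holomorphic_wirtinger hq z1.
have [d d0 H] := cq _ e0.
exists (Num.min d (1 - normc z)); first by rewrite lt_min d0 subr_gt0.
move=> h; rewrite lt_min => /andP[/H h1 h2]; split.
  by rewrite unit_discE (le_lt_trans (normcD _ _))// -ltrBrDl.
by rewrite /= -partB// (le_lt_trans (part_le _ hp)).
Qed.

(** What the curvature estimates retain of a unit harmonic Beltrami differential; holomorphy
    survives only through the pointwise bound. *)
Definition bounded_unit nu :=
  [/\ forall part, is_part part -> dmeasurable (part \o nu),
      dintegrable (fun z => normc (nu z) ^+ 2 * rho z),
      disc_int (fun z => normc (nu z) ^+ 2 * rho z) = 1 &
      forall z, unit_disc z -> normc (nu z) ^+ 2 <= curv_bound].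

Lemma Hm11_bounded_unit nu : Hm11 nu -> wp_norm nu = 1 -> bounded_unit nu.
Proof.
move=> [q [hq qfin] nuE] nu1.
have mq := fun part hp => @holomorphic_dmeasurable part q hp hq.
have mq2 : dmeasurable (fun z => normc (q z) ^+ 2).
  under eq_fun do rewrite normc_sqE !expr2.
  apply: dmeasurableD; apply: dmeasurableM;
    [exact: (mq _ (or_introl erefl))|exact: (mq _ (or_introl erefl))|
     exact: (mq _ (or_intror erefl))|exact: (mq _ (or_intror erefl))].
have mg : dmeasurable (fun z : C => (1 - normc z ^+ 2) ^+ 2).
  have mg : dmeasurable (fun z : C => 1 + -1 * normc z ^+ 2).
    apply: dmeasurableD; first exact: dmeasurable_cst.
    by apply: dmeasurableZ; apply: rcont_dmeasurable; exact: rcont_normc_sq.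
  by apply: (eq_dmeasurable _ (dmeasurableM mg mg)) => z _; rewrite mulN1r expr2.
have rhoV z : (rho z)^-1 = 4^-1 * (1 - normc z ^+ 2) ^+ 2 :> R.
  by rewrite /rho invf_div mulrC.
have Iq : dintegrable (fun z => normc (q z) ^+ 2 * (rho z)^-1).
  apply/integrableP; split.
    apply/measurable_EFinP; apply: dmeasurableM => //.
    apply: (eq_dmeasurable _ (dmeasurableZ 4^-1 mg)) => z _; exact/esym/rhoV.
  apply: le_lt_trans qfin; rewrite /area_integral le_eqVlt; apply/orP; left.
  apply/eqP; apply: eq_integral => p; rewrite inE => pD.
  by rewrite /= ger0_norm// mulr_ge0 ?sqr_ge0// invr_ge0 ltW// rho_gt0.
have nuq z : unit_disc z -> normc (nu z) ^+ 2 = normc (q z) ^+ 2 * (rho z)^-1 ^+ 2.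
  move=> zD; rewrite nuE// normcM normc_conj normc_real exprMn mulrC.
  by rewrite real_normK ?num_real.
have nuqr z : unit_disc z -> normc (q z) ^+ 2 * (rho z)^-1 = normc (nu z) ^+ 2 * rho z.
  by move=> zD; rewrite nuq//; field; rewrite gt_eqF// rho_gt0.
have Inu : dintegrable (fun z => normc (nu z) ^+ 2 * rho z) by apply: eq_dintegrable Iq.
have nuint : disc_int (fun z => normc (nu z) ^+ 2 * rho z) = 1.
  have E : complex.Re (wp_inner nu nu) = disc_int (fun z => normc (nu z) ^+ 2 * rho z).
    apply: eq_disc_int => z _; rewrite mulcJ -rmorphM /=.
    by [].
  move: nu1; rewrite /wp_norm E => /(congr1 (fun x => x ^+ 2)).
  rewrite expr1n sqr_sqrtr//; apply: disc_int_ge0 => z zD.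
  by rewrite mulr_ge0 ?sqr_ge0// ltW// rho_gt0.
split=> //.
- have mr : dmeasurable (fun z => (rho z)^-1).
    by apply: (eq_dmeasurable _ (dmeasurableZ 4^-1 mg)) => z _; exact/esym/rhoV.
  move=> part [] ->.
    apply: (eq_dmeasurable _ (dmeasurableM mr (mq _ (or_introl erefl)))) => z zD.
    by rewrite /= nuE//; case: (q z) => a b /=; ring.
  apply: (eq_dmeasurable _ (dmeasurableM mr (dmeasurableZ (-1) (mq _ (or_intror erefl))))) => z zD.
  by rewrite /= nuE//; case: (q z) => a b /=; ring.
- move=> w wD.
  (* The 4 of [rho] enters twice: the integral in the Bergman bound is 4 |nu|^2 = 4, and [rho ^-2]
     brings 1 / 16, so the bound is (3 / pi) 4 / 16. *)
  have q4 z : unit_disc z -> 4 * (normc (q z) ^+ 2 * (rho z)^-1) =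
      normc (q z) ^+ 2 * (1 - normc z ^+ 2) ^+ 2.
    by move=> zD; rewrite rhoV; field.
  have I4 : dintegrable (fun z => normc (q z) ^+ 2 * (1 - normc z ^+ 2) ^+ 2).
    exact: eq_dintegrable q4 (dintegrableZ 4 Iq).
  have := bergman_bound hq wD I4.
  rewrite -(eq_disc_int q4) disc_intZ// (eq_disc_int nuqr) nuint mulr1.
  rewrite nuq// rhoV /curv_bound.
  have -> : normc (q w) ^+ 2 * (4^-1 * (1 - normc w ^+ 2) ^+ 2) ^+ 2 =
    normc (q w) ^+ 2 * (1 - normc w ^+ 2) ^+ 4 / 16 by field.
  have pi0 := pi_gt0 R.
  move: (_ * _ ^+ 4) => X HX; rewrite ler_pdivlMr ?mulr_gt0//.
  by lra.
Qed.

Let hR : is_part (@complex.Re R). Proof. by left. Qed.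
Let hI : is_part (@complex.Im R). Proof. by right. Qed.

Let solution_part (part : C -> R) (k X : C -> C) : is_part part ->
  Laplace_Beltrami X (fun z => k z - 2^-1 * X z) ->
  Laplace_real (part \o X) (fun z => part (k z) - 2^-1 * part (X z)).
Proof.
move=> hp H; apply: Laplace_real_ext (Laplace_Beltrami_real hp H) => // z /=.
by rewrite partB// (invnC 2) partZ.
Qed.

Section Green.
Variable f : C -> C.
Hypothesis rf : forall part, is_part part -> rL2 (part \o f).

Let resolventP : Laplace_Beltrami (resolvent f) (fun z => f z - 2^-1 * resolvent f z) \/
  (resolvent f = (fun=> 0) /\
   forall u, ~ Laplace_Beltrami u (fun z => f z - 2^-1 * u z)).
Proof.
rewrite /resolvent; case: xgetP => [u -> Hu|noU]; [by left|right].
by split=> // u Hu; exact: (noU u).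
Qed.

Lemma resolvent_real (part : C -> R) : is_part part ->
  Laplace_real (part \o resolvent f) (fun z => part (f z) - 2^-1 * part (resolvent f z)) \/
  (forall z, part (resolvent f z) = 0).
Proof.
move=> hp; case: resolventP => [H|[-> _]]; last by right=> z; case: hp => ->.
by left; exact: solution_part.
Qed.

Lemma part_G (part : C -> R) z : is_part part -> part (G f z) = 2^-1 * part (resolvent f z).
Proof. by move=> hp; rewrite /G (invnC 2) partZ. Qed.

Let rL2_0 : rL2 (fun _ : C => 0 : R).
Proof. by have [] := @Laplace_real0 R. Qed.

Lemma rL2_resolvent (part : C -> R) : is_part part -> rL2 (part \o resolvent f).
Proof.
by move=> hp; case: (resolvent_real hp) => [[]//|E]; rewrite (_ : _ \o _ = fun=> 0)//;
  apply/funext.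
Qed.

Lemma rL2_G (part : C -> R) : is_part part -> rL2 (part \o G f).
Proof.
move=> hp; rewrite (_ : _ \o _ = fun z => 2^-1 * part (resolvent f z)).
  exact: (rL2Z 2^-1 (rL2_resolvent hp)).
by apply/funext => z; exact: part_G.
Qed.

Lemma ip_G (part : C -> R) h : is_part part -> rL2 h ->
  ip (part \o G f) h = 2^-1 * ip (part \o resolvent f) h.
Proof.
move=> hp Lh; rewrite -(ipZl _ (rL2_resolvent hp) Lh); congr ip.
by apply/funext => z; exact: part_G.
Qed.

Let ip_res0 (part : C -> R) h : (forall z, part (resolvent f z) = 0) ->
  ip (part \o resolvent f) h = 0.
Proof.
move=> E; rewrite /ip (_ : (fun z => _) = fun=> 0) ?/disc_int ?/Rintegral ?integral0//.
by apply/funext => z; rewrite /= E !mul0r.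
Qed.

(** For X the part of the resolvent, <f, X> = <Delta X, X> + |X|^2 / 2. *)
Lemma ip_G_ge0 (part : C -> R) : is_part part -> 0 <= ip (part \o G f) (part \o f).
Proof.
move=> hp; rewrite ip_G; [|by []|exact: rf]; rewrite mulr_ge0//.
case: (resolvent_real hp) => [H|E]; last by rewrite ip_res0.
have Lr := rL2_resolvent hp; have := Laplace_real_positive H.
rewrite (ipBl (rf hp) (rL2Z 2^-1 Lr) Lr) (ipZl _ Lr Lr) -nrm_sq ipC.
by have := sqr_ge0 (nrm (part \o resolvent f)); lra.
Qed.

Lemma ip_G_le (part : C -> R) h (M : R) : is_part part -> 0 <= M ->
  (forall z, unit_disc z -> `|part (f z)| <= M) -> rL2 h ->
  dintegrable (fun z => `|h z| * rho z) ->
  ip (part \o G f) h <= M * disc_int (fun z => `|h z| * rho z).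
Proof.
move=> hp M0 fM Lh Ih; rewrite ip_G//.
case: (resolvent_real hp) => [H|E].
  have := Laplace_real_bound (rf hp) M0 fM H Lh Ih.
  by rewrite -mulrA ler_pdivrMl.
rewrite ip_res0// mulr0 mulr_ge0//; apply: disc_int_ge0 => z zD.
by rewrite mulr_ge0// ltW// rho_gt0.
Qed.

End Green.

Lemma resolvent_conj_solvable f f' : (forall z, f' z = (f z)^*%C) ->
  (exists u, Laplace_Beltrami u (fun z => f z - 2^-1 * u z)) ->
  exists u, Laplace_Beltrami u (fun z => f' z - 2^-1 * u z).
Proof.
move=> ff' [u /Laplace_Beltrami_conj Hu]; exists (fun z => (u z)^*%C).
move: Hu; congr Laplace_Beltrami; apply/funext => z; rewrite ff'.
rewrite (invnC 2).
by case: (f z) (u z) => [a b] [c d] /=; congr (_ +i* _); ring.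
Qed.

(** The parts of the conjugate of [X] solve the same real equations as those of [X'], so uniqueness
    identifies the pairings. *)
Let ip_solution_conj f f' X X' h : (forall z, f' z = (f z)^*%C) ->
  Laplace_Beltrami X (fun z => f z - 2^-1 * X z) ->
  Laplace_Beltrami X' (fun z => f' z - 2^-1 * X' z) -> rL2 h ->
  ip (@complex.Re R \o X') h = ip (@complex.Re R \o X) h /\
  ip (@complex.Im R \o X') h = - ip (@complex.Im R \o X) h.
Proof.
move=> ff' H H' Lh; split.
  apply: (@Laplace_real_unique _ _ _ (fun z => complex.Re (f' z)) (fun z => complex.Re (f z))) => //.
  - by move=> z _; rewrite ff' Re_conjc.
  - exact: solution_part.
  - exact: solution_part.
have HI := solution_part hI H; have [LI _ _] := HI.
rewrite -mulN1r -(ipZl _ LI Lh).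
apply: (@Laplace_real_unique _ _ _ (fun z => complex.Im (f' z)) (fun z => complex.Im (f' z))) => //.
  exact: solution_part.
apply: Laplace_real_ext (Laplace_realN HI) => z /=; first by rewrite mulN1r.
have -> : complex.Im (f' z) = - complex.Im (f z) by rewrite ff'; case: (f z).
by ring.
Qed.

(** [xget] chooses for [f] and [f'] independently. If one equation is solvable so is the other, and
    pairings ignore the choice; otherwise both resolvents are the default 0. *)
Let resolvent_conj f f' h : (forall z, f' z = (f z)^*%C) -> rL2 h ->
  ip (@complex.Re R \o resolvent f') h = ip (@complex.Re R \o resolvent f) h /\
  ip (@complex.Im R \o resolvent f') h = - ip (@complex.Im R \o resolvent f) h.
Proof.
move=> ff' Lh; have ff z : f z = (f' z)^*%C by rewrite ff' conjcK.
have solved (k : C -> C) : (exists u, Laplace_Beltrami u (fun z => k z - 2^-1 * u z)) ->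
    Laplace_Beltrami (resolvent k) (fun z => k z - 2^-1 * resolvent k z).
  by move=> [u Hu]; rewrite /resolvent; case: xgetP => // /(_ u); case.
have unsolved (k : C -> C) : ~ (exists u, Laplace_Beltrami u (fun z => k z - 2^-1 * u z)) ->
    resolvent k = fun=> 0.
  by move=> noK; rewrite /resolvent; case: xgetP => // u _ Hu; case: noK; exists u.
have [ex|noU] := pselect (exists u, Laplace_Beltrami u (fun z => f z - 2^-1 * u z)).
  have ex' := resolvent_conj_solvable ff' ex.
  exact: ip_solution_conj ff' (solved _ ex) (solved _ ex') Lh.
have noU' : ~ (exists u, Laplace_Beltrami u (fun z => f' z - 2^-1 * u z)).
  by move=> /(resolvent_conj_solvable ff).
rewrite (unsolved _ noU) (unsolved _ noU').
rewrite /ip; under eq_fun do rewrite /= mul0r mul0r.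
by rewrite /disc_int /Rintegral integral0 oppr0.
Qed.

Lemma ip_G_conj f f' h : (forall z, f' z = (f z)^*%C) -> rL2 h ->
  ip (@complex.Re R \o G f') h = ip (@complex.Re R \o G f) h /\
  ip (@complex.Im R \o G f') h = - ip (@complex.Im R \o G f) h.
Proof.
move=> ff' Lh; have [eR eI] := resolvent_conj ff' Lh; split.
  transitivity (2^-1 * ip (@complex.Re R \o resolvent f') h); first exact: (ip_G f' hR Lh).
  transitivity (2^-1 * ip (@complex.Re R \o resolvent f) h).
    exact: (congr1 (fun x => 2^-1 * x) eR).
  exact: (esym (ip_G f hR Lh)).
transitivity (2^-1 * ip (@complex.Im R \o resolvent f') h); first exact: (ip_G f' hI Lh).
transitivity (- (2^-1 * ip (@complex.Im R \o resolvent f) h)).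
  exact: (etrans (congr1 (fun x => 2^-1 * x) eI) (mulrN _ _)).
exact: (esym (congr1 (fun x => - x) (ip_G f hI Lh))).
Qed.

End Curvature.

(** * The curvature tensor in real pairings *)

Section CurvatureBounds.
Context {R : realType}.
Local Notation C := R[i].
Implicit Types (a b c d nu : C -> C) (z w : C).

Let hR : is_part (@complex.Re R). Proof. by left. Qed.
Let hI : is_part (@complex.Im R). Proof. by right. Qed.

Definition cross a b : C -> C := fun z => a z * (b z)^*.

Lemma cross_conj a b z : cross b a z = (cross a b z)^*%C.
Proof.
by rewrite /cross; case: (a z) (b z) => [x y] [x' y']; simpc; congr (_ +i* _); ring.
Qed.

Lemma cross_le (part : C -> R) a b z : is_part part ->
  `|part (cross a b z)| <= 2^-1 * (normc (a z) ^+ 2 + normc (b z) ^+ 2).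
Proof.
move=> hp; apply: (le_trans (part_le _ hp)); rewrite normcM normc_conj.
by have := sqr_ge0 (normc (a z) - normc (b z)); lra.
Qed.

Lemma cross_dmeasurable (part : C -> R) a b : is_part part ->
  bounded_unit a -> bounded_unit b -> dmeasurable (part \o cross a b).
Proof.
move=> hp [ma _ _ _] [mb _ _ _].
have aR := ma _ (or_introl erefl); have aI := ma _ (or_intror erefl).
have bR := mb _ (or_introl erefl); have bI := mb _ (or_intror erefl).
case: hp => ->.
  apply: (eq_dmeasurable _ (dmeasurableD (dmeasurableM aR bR) (dmeasurableM aI bI))) => z _.
  by rewrite /cross /=; case: (a z) (b z) => [x y] [x' y'] /=; ring.
apply: (eq_dmeasurable _ (dmeasurableD (dmeasurableM aI bR)
  (dmeasurableZ (-1) (dmeasurableM aR bI)))) => z _.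
by rewrite /cross /=; case: (a z) (b z) => [x y] [x' y'] /=; ring.
Qed.

Lemma cross_bound (part : C -> R) a b z : is_part part ->
  bounded_unit a -> bounded_unit b -> unit_disc z -> `|part (cross a b z)| <= curv_bound.
Proof.
move=> hp [_ _ _ Ma] [_ _ _ Mb] zD; apply: (le_trans (cross_le _ _ _ hp)).
by have := Ma _ zD; have := Mb _ zD; lra.
Qed.

Let mean_dintegrable a b : bounded_unit a -> bounded_unit b ->
  dintegrable (fun z => 2^-1 * (normc (a z) ^+ 2 * rho z + normc (b z) ^+ 2 * rho z)).
Proof. by move=> [_ Ia _ _] [_ Ib _ _]; apply: dintegrableZ; exact: dintegrableD. Qed.

Lemma cross_dintegrable (part : C -> R) a b : is_part part ->
  bounded_unit a -> bounded_unit b -> dintegrable (fun z => `|part (cross a b z)| * rho z).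
Proof.
move=> hp ua ub; apply: dintegrable_le (mean_dintegrable ua ub) _.
  apply: dmeasurableM dmeasurable_rho.
  exact: (measurableT_comp (@normr_measurable R setT) (cross_dmeasurable hp ua ub)).
move=> z zD; have r0 := rho_gt0 zD.
rewrite normrM normr_id (gtr0_norm r0).
have -> : 2^-1 * (normc (a z) ^+ 2 * rho z + normc (b z) ^+ 2 * rho z) =
  2^-1 * (normc (a z) ^+ 2 + normc (b z) ^+ 2) * rho z by ring.
by rewrite ler_pM2r//; exact: cross_le.
Qed.

Lemma cross_int_le1 (part : C -> R) a b : is_part part ->
  bounded_unit a -> bounded_unit b -> disc_int (fun z => `|part (cross a b z)| * rho z) <= 1.
Proof.
move=> hp ua ub; have [_ Ia na _] := ua; have [_ Ib nb _] := ub.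
apply: (@le_trans _ _ (disc_int (fun z => 2^-1 * (normc (a z) ^+ 2 * rho z +
    normc (b z) ^+ 2 * rho z)))).
  apply: le_disc_int; [exact: cross_dintegrable|exact: mean_dintegrable|].
  move=> z zD; have r0 := rho_gt0 zD.
  have -> : 2^-1 * (normc (a z) ^+ 2 * rho z + normc (b z) ^+ 2 * rho z) =
    2^-1 * (normc (a z) ^+ 2 + normc (b z) ^+ 2) * rho z by ring.
  by rewrite ler_pM2r//; exact: cross_le.
rewrite (disc_intZ _ (dintegrableD Ia Ib)) (disc_intD Ia Ib) na nb; lra.
Qed.

(** Integrable and bounded by [curv_bound], hence square-integrable. *)
Lemma cross_rL2 (part : C -> R) a b : is_part part ->
  bounded_unit a -> bounded_unit b -> rL2 (part \o cross a b).
Proof.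
move=> hp ua ub; have mc := cross_dmeasurable hp ua ub; split=> //.
apply: dintegrable_le (dintegrableZ curv_bound (cross_dintegrable hp ua ub)) _.
  apply: dmeasurableM dmeasurable_rho.
  by under eq_fun do rewrite expr2; exact: dmeasurableM.
move=> z zD; have r0 := rho_gt0 zD.
rewrite normrM (gtr0_norm r0) [leRHS]mulrA ler_pM2r// normrX expr2.
by apply: ler_wpM2r => //; exact: (cross_bound hp ua ub zD).
Qed.

(** Each complex integral in the tensor expands into four of these; positivity and the upper bound
    are available for the real pairings. *)
Definition pairing (p p' : C -> R) a b c d : R := ip (p \o G (cross a b)) (p' \o cross c d).

Let area_integralC_ip (X Y : C -> C) :
  (forall part, is_part part -> rL2 (part \o X)) ->
  (forall part, is_part part -> rL2 (part \o Y)) ->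
  area_integralC (fun z => X z * Y z * (rho z)%:C) =
  (ip (@complex.Re R \o X) (@complex.Re R \o Y) - ip (@complex.Im R \o X) (@complex.Im R \o Y))
  +i* (ip (@complex.Re R \o X) (@complex.Im R \o Y) +
       ip (@complex.Im R \o X) (@complex.Re R \o Y)).
Proof.
move=> LX LY; rewrite /area_integralC; congr (_ +i* _).
  rewrite /ip -(disc_intB (ip_integrable (LX _ hR) (LY _ hR))
    (ip_integrable (LX _ hI) (LY _ hI))).
  apply: eq_disc_int => z _ /=.
  by case: (X z) (Y z) => [x y] [x' y'] /=; ring.
rewrite /ip -(disc_intD (ip_integrable (LX _ hR) (LY _ hI))
  (ip_integrable (LX _ hI) (LY _ hR))).
apply: eq_disc_int => z _ /=.
by case: (X z) (Y z) => [x y] [x' y'] /=; ring.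
Qed.

Lemma area_integralC_G a b c d :
  bounded_unit a -> bounded_unit b -> bounded_unit c -> bounded_unit d ->
  area_integralC (fun z => G (fun w => a w * (b w)^*) z * (c z * (d z)^*) * (rho z)%:C) =
  (pairing (@complex.Re R) (@complex.Re R) a b c d -
   pairing (@complex.Im R) (@complex.Im R) a b c d) +i*
  (pairing (@complex.Re R) (@complex.Im R) a b c d +
   pairing (@complex.Im R) (@complex.Re R) a b c d).
Proof.
move=> ua ub uc ud; apply: (@area_integralC_ip (G (cross a b)) (cross c d)) => part hp.
  by apply: rL2_G.
exact: cross_rL2.
Qed.

Lemma pairing_ge0 p a b : is_part p -> bounded_unit a -> bounded_unit b ->
  0 <= pairing p p a b a b.
Proof. by move=> hp ua ub; apply: ip_G_ge0 => // part hp'; exact: cross_rL2. Qed.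

Lemma pairing_le p p' a b c d : is_part p -> is_part p' ->
  bounded_unit a -> bounded_unit b -> bounded_unit c -> bounded_unit d ->
  pairing p p' a b c d <= curv_bound.
Proof.
move=> hp hp' ua ub uc ud.
have M0 := @curv_bound_ge0 R.
have := ip_G_le (fun part h => cross_rL2 h ua ub) hp M0
  (fun z zD => cross_bound hp ua ub zD) (cross_rL2 hp' uc ud) (cross_dintegrable hp' uc ud).
by move/le_trans; apply; rewrite ler_piMr//; exact: cross_int_le1.
Qed.

Lemma pairing_swapl p' a b c d : is_part p' -> bounded_unit c -> bounded_unit d ->
  pairing (@complex.Re R) p' b a c d = pairing (@complex.Re R) p' a b c d /\
  pairing (@complex.Im R) p' b a c d = - pairing (@complex.Im R) p' a b c d.
Proof. by move=> hp uc ud; apply: ip_G_conj (cross_conj a b) (cross_rL2 hp uc ud). Qed.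

Lemma pairing_swapr p a b c d : is_part p -> bounded_unit a -> bounded_unit b ->
  bounded_unit c -> bounded_unit d ->
  pairing p (@complex.Re R) a b d c = pairing p (@complex.Re R) a b c d /\
  pairing p (@complex.Im R) a b d c = - pairing p (@complex.Im R) a b c d.
Proof.
move=> hp ua ub uc ud; rewrite /pairing.
have LG : rL2 (p \o G (cross a b)) by exact: rL2_G.
move: (p \o _) LG => g LG; split.
  by congr ip; apply/funext => z; rewrite /= cross_conj Re_conjc.
rewrite -mulN1r [in RHS]ipC -(ipZl _ (cross_rL2 hI uc ud) LG) ipC; congr ip.
by apply/funext => z; rewrite /= cross_conj mulN1r; case: (cross c d z).
Qed.

(** [cross a a] is its own conjugate, so the pairing equals its negative. *)
Lemma pairing_diagl p' a c d : is_part p' -> bounded_unit c -> bounded_unit d ->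
  pairing (@complex.Im R) p' a a c d = 0.
Proof. by move=> hp uc ud; have [_] := @pairing_swapl p' a a c d hp uc ud; lra. Qed.

Lemma pairing_diagr p a b c : is_part p -> bounded_unit a -> bounded_unit b ->
  bounded_unit c -> pairing p (@complex.Im R) a b c c = 0.
Proof. by move=> hp ua ub uc; have [_] := @pairing_swapr p a b c c hp ua ub uc uc; lra. Qed.

Lemma two_curv_bound : 3 / (2 * pi) = 2 * curv_bound :> R.
Proof.
have pi0 : pi != 0 :> R by rewrite gt_eqF// pi_gt0.
by rewrite /curv_bound; move: (@pi R) pi0 => x x0; field.
Qed.

Definition cpairing a b c d : C :=
  (pairing (@complex.Re R) (@complex.Re R) a b c d -
   pairing (@complex.Im R) (@complex.Im R) a b c d) +i*
  (pairing (@complex.Re R) (@complex.Im R) a b c d +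
   pairing (@complex.Im R) (@complex.Re R) a b c d).

Lemma curvatureE a b c d :
  bounded_unit a -> bounded_unit b -> bounded_unit c -> bounded_unit d ->
  curvature a b c d = - cpairing a b c d - cpairing a d c b.
Proof.
move=> ua ub uc ud; rewrite /curvature.
by congr (- _ - _); exact: area_integralC_G.
Qed.

Lemma hol_sectional_curvature_ge nu : bounded_unit nu ->
  (- (3 / (2 * pi)) : R)%:C <= hol_sectional_curvature nu.
Proof.
move=> un; rewrite /hol_sectional_curvature (curvatureE un un un un) /cpairing.
(* As |nu|^2 is real a single pairing survives, and it occurs in both terms of the tensor. *)
rewrite !pairing_diagl// pairing_diagr//.
have := pairing_le hR hR un un un un.
rewrite two_curv_bound; move: (pairing _ _ _ _ _ _) (@curv_bound R) => x M xM.
by rewrite lecE /=; apply/andP; split; [apply/eqP; ring|lra].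
Qed.

Lemma sectional_curvature_ge a b : bounded_unit a -> bounded_unit b ->
  (- (3 / (2 * pi)) : R)%:C <= sectional_curvature a b.
Proof.
move=> ua ub.
have -> : sectional_curvature a b = 4^-1 * (
    (- cpairing a b b a - cpairing a a b b) + (- cpairing b a a b - cpairing b b a a) -
    (- cpairing a b a b - cpairing a b a b) - (- cpairing b a b a - cpairing b a b a)).
  by congr (_ * (_ + _ - _ - _)); exact: curvatureE.
rewrite /cpairing !(@pairing_diagl _ a)// !(@pairing_diagl _ b)//.
rewrite !(@pairing_diagr _ _ _ a)// !(@pairing_diagr _ _ _ b)//.
rewrite (invnC 4).
(* Every pairing of [cross a b] or its conjugate with either of them is brought to the order a b a
   b, up to sign. *)
have [RRl IRl] := @pairing_swapl _ a b a b hR ua ub.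
have [RIl IIl] := @pairing_swapl _ a b a b hI ua ub.
have [RRl' IRl'] := @pairing_swapl _ a b b a hR ub ua.
have [RIl' IIl'] := @pairing_swapl _ a b b a hI ub ua.
have [RRr RIr] := @pairing_swapr _ a b a b hR ua ub ua ub.
have [IRr IIr] := @pairing_swapr _ a b a b hI ua ub ua ub.
rewrite ?RRl' ?IRl' ?RIl' ?IIl' ?RRl ?IRl ?RIl ?IIl ?RRr ?RIr ?IRr ?IIr.
have := pairing_ge0 hR ua ub.
have := pairing_le hI hI ua ub ua ub.
have := pairing_le hR hR ua ua ub ub.
have := pairing_le hR hR ub ub ua ua.
move: (pairing _ _ a b a b) (pairing _ _ a b a b) (pairing _ _ a b a b) (pairing _ _ a b a b).
move: (pairing _ _ _ _ _ _) (pairing _ _ _ _ _ _) => z1 z2 p1 p2 p3 p4.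
rewrite two_curv_bound; move: (@curv_bound R) => M h1 h2 h3 h4; rewrite lecE /=.
clear - h1 h2 h3 h4.
(* The imaginary part cancels between each component and its conjugate. In the real part <Gv, v>
   costs 3 M / 2 and the two diagonal terms M / 4 each. *)
by apply/andP; split; [apply/eqP; ring|lra].
Qed.

End CurvatureBounds.

(* The order of R[i] is used: [x%:C <= y] says that y is real and x <= y. *)
Theorem proposition4p2 (R : realType) :
  (forall nu : R[i] -> R[i], Hm11 nu -> wp_norm nu = 1 ->
     (- (3 / (2 * pi)) : R)%:C <= hol_sectional_curvature nu) /\
  (forall nua nub : R[i] -> R[i], Hm11 nua -> Hm11 nub ->
     wp_norm nua = 1 -> wp_norm nub = 1 ->
     complex.Re (wp_inner nua nub) = 0 ->
     (- (3 / (2 * pi)) : R)%:C <= sectional_curvature nua nub).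
Proof.
split=> [nu H1 n1|nua nub H1 H2 n1 n2 _].
  by apply: hol_sectional_curvature_ge; exact: Hm11_bounded_unit.
by apply: sectional_curvature_ge; exact: Hm11_bounded_unit.
Qed.
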